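(* For every integer $p\ge 5$ there exists an integer $q_p\ge 3$ such that for every integer $q\ge q_p$ with $1/p+1/q<1/2$, there exist uncountably many extremal Series--Sinai states for the ferromagnetic nearest-neighbour Ising model on $\mathcal{L}_{p,q}$ at low enough temperature; that is, there is $\beta_0\in(0,\infty)$ (depending on $p,q$) such that for every $\beta\ge\beta_0$ the set of Series--Sinai states at inverse temperature $\beta$ that are extremal elements of the set $\mathcal{G}_\beta$ of infinite volume Gibbs measures is uncountable.
   Context: Let $\mathbb{H}_2$ be the hyperbolic plane of curvature $-1$. For integers $p,q\ge 3$ with $1/p+1/q<1/2$, $\mathcal{L}_{p,q}$ is the tiling of $\mathbb{H}_2$ by regular $p$-gons in which each vertex has degree $q$; it is also viewed as the graph $(V,E)=(V_{p,q},E_{p,q})$ whose vertices are the vertices of the $p$-gons and whose edges are their sides. Ising model: let $\Omega=\{-1,+1\}^V$. For a finite set $\Lambda\subset V$ and $\omega\in\Omega$ put $H_\Lambda(\omega)=-\sum_{\{i,j\}\in E,\ \{i,j\}\cap\Lambda\neq\emptyset}\omega_i\omega_j$. For $\beta\in(0,\infty)$ and $\eta\in\Omega$, let $\Omega_\Lambda^\eta=\{\omega\in\Omega:\ \omega_v=\eta_v\text{ for all } v\in V\setminus\Lambda\}$ and let $\mu^\eta_{\Lambda;\beta}$ be the probability measure on $\Omega_\Lambda^\eta$ (viewed as a measure on $\Omega$) given by $\mu^\eta_{\Lambda;\beta}(\omega)=\frac{1}{Z^\eta_{\Lambda;\beta}}\exp(-\beta H_\Lambda(\omega))$, where $Z^\eta_{\Lambda;\beta}=\sum_{\omega\in\Omega_\Lambda^\eta}\exp(-\beta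 H_\Lambda(\omega))$. The set $\mathcal{G}_\beta$ of infinite volume Gibbs measures is the set of probability measures $\mu$ on $\Omega$ such that $\mu=\int_\Omega\mu^\eta_{\Lambda;\beta}\,d\mu(\eta)$ for all finite $\Lambda\subset V$. It is a convex set (a Choquet simplex), and ''extremal'' means being an extreme point of $\mathcal{G}_\beta$. Series--Sinai states: let $\Gamma$ be the set of (oriented, complete) geodesics of $\mathbb{H}_2$. For $\gamma\in\Gamma$, let $\eta^\gamma\in\Omega$ be the configuration with $\eta^\gamma_v=+1$ if $v$ is to the left of or on $\gamma$, and $\eta^\gamma_v=-1$ if $v$ is to the right of $\gamma$. A Series--Sinai state (at inverse temperature $\beta$) is a measure $\mu^\gamma_\beta$, $\gamma\in\Gamma$, which is a (possibly subsequential) weak limit, as $\Lambda\uparrow V$ along finite sets, of the finite volume states $\mu^{\eta^\gamma}_{\Lambda;\beta}$ with boundary condition $\eta^\gamma$. *)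

(* Defs.v *)
From HB Require Import structures.
From mathcomp Require Import all_boot all_order all_algebra.
From mathcomp Require Import finmap.
From mathcomp Require Import all_classical all_reals all_analysis.

Set Implicit Arguments.
Unset Strict Implicit.
Unset Printing Implicit Defensive.
Import Order.TTheory GRing.Theory Num.Theory.
Import numFieldNormedType.Exports.

Local Open Scope classical_set_scope.
Local Open Scope ring_scope.

Section HyperbolicPlane.
Variable R : realType.
Local Notation vec := 'rV[R]_3.
Implicit Types (u x y z : vec) (v : nat -> vec).

Definition coshR (t : R) : R := (expR t + expR (- t)) / 2.
Definition sinhR (t : R) : R := (expR t - expR (- t)) / 2.

Definition mink x y : R := - (x 0 0 * y 0 0) + x 0 1 * y 0 1 + x 0 2 * y 0 2.

Definition det3 x y z : R := \det (\matrix_(i < 3) nth 0 [:: x; y; z] i).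

(* Hyperboloid model of the hyperbolic plane of curvature -1.  The hyperbolic
   distance d satisfies cosh (d x y) = - mink x y, and the tangent space at x
   is the mink-orthogonal of x, on which mink is positive definite. *)
Definition hyp : set vec := [set x | mink x x = -1 /\ 0 < x 0 0].

Definition hball x (r : R) : set vec :=
  [set y | hyp y /\ - mink x y < coshR r].

Definition unit_tangent x u : Prop := mink x u = 0 /\ mink u u = 1.

(* Unit speed geodesic issued from x with unit initial velocity u. *)
Definition geod x u (t : R) : vec := coshR t *: x + sinhR t *: u.

(* Oriented complete geodesics, given by a point and the unit velocity there.
   Different records may describe the same oriented geodesic. *)
Record geodesic := Geodesic {
  gpt : vec;
  gdir : vec;
  gpt_hyp : hyp gpt;
  gdir_unit : unit_tangent gpt gdir }.

(* On the hyperboloid, det3 (gpt g) (gdir g) vanishes exactly on the curve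
   geod (gpt g) (gdir g) and is positive exactly on its left, the plane being
   oriented by the coordinates (x 0 1, x 0 2). *)
Definition left_or_on (g : geodesic) z : Prop := 0 <= det3 (gpt g) (gdir g) z.

(* The geodesic segment between x and y: the radial projection to the
   hyperboloid of the straight chord. *)
Definition segment x y : set vec :=
  [set z | hyp z /\ exists s t : R, [/\ 0 <= s, 0 <= t & z = s *: x + t *: y]].

(* v enumerates counterclockwise, periodically in its index, the vertices of a
   regular p-gon: p equally spaced points on a circle of centre c and hyperbolic
   radius r, where (e1, e2) is a direct orthonormal frame at c. *)
Definition regular_vertices (p : nat) v : Prop :=
  exists c e1 e2 (r : R),
    [/\ hyp c, unit_tangent c e1, unit_tangent c e2,
        mink e1 e2 = 0 /\ 0 < det3 c e1 e2 & 0 < r] /\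
    forall k : nat, let t := (2 * pi * k%:R / p%:R : R) in
      v k = geod c (cos t *: e1 + sin t *: e2) r.

(* The closed polygon with (counterclockwise) vertices v: the intersection of
   the closed half-planes on the left of its sides. *)
Definition polygon v : set vec :=
  [set z | hyp z /\ forall k : nat, 0 <= det3 (v k) (v k.+1) z].

Definition regular_polygon (p : nat) v (P : set vec) : Prop :=
  regular_vertices p v /\ P = polygon v.

Section Tiling.
Variables (p : nat) (T : set (set vec)).

Definition tile_vertices : set vec :=
  [set x | exists P v k, [/\ T P, regular_polygon p v P & x = v k]].

Definition adjacent x y : Prop :=
  exists P v k, [/\ T P, regular_polygon p v P &
    (x = v k /\ y = v k.+1) \/ (y = v k /\ x = v k.+1)].

(* T is an edge-to-edge, locally finite tiling of the hyperbolic plane by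
   regular p-gons with q sides at each vertex; for given p and q it is unique up
   to isometry. *)
Definition regular_tiling (q : nat) : Prop :=
  [/\ forall P, T P -> exists v, regular_polygon p v P,
      forall x, hyp x -> exists2 P, T P & P x,
      forall P Q v w, T P -> T Q -> P <> Q ->
        regular_polygon p v P -> regular_polygon p w Q ->
        [\/ P `&` Q = set0,
            exists i j, v i = w j /\ P `&` Q = [set v i] |
            exists i j, P `&` Q = segment (v i) (v i.+1) /\
                        P `&` Q = segment (w j) (w j.+1)],
      forall x, hyp x -> exists2 r : R, 0 < r &
        finite_set [set P | T P /\ P `&` hball x r !=set0] &
      forall x, tile_vertices x -> ([set y | adjacent x y] #= `I_q)%card].

Definition tiling_edges : set (set (set_type tile_vertices)) :=
  [set e | exists x y : set_type tile_vertices,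
     e = [set x; y] /\ adjacent (val x) (val y)].

End Tiling.
End HyperbolicPlane.

Arguments tile_vertices {R} p T.
Arguments tiling_edges {R} p T.

(* Spin configurations on V: true stands for +1 and false for -1. *)
Definition cylinders (V : choiceType) : set (set (V -> bool)) :=
  [set A | exists v b, A = [set w | w v = b]].

(* The configuration space with its product sigma-algebra. *)
Definition config (V : choiceType) := g_sigma_algebraType (@cylinders V).
HB.instance Definition _ (V : choiceType) := Measurable.on (config V).

Section Ising.
Variables (R : realType) (V : choiceType) (E : set (set V)).
Local Notation Omega := (config V).

Definition spin (b : bool) : R := if b then 1 else -1.

(* Edges are two-element sets of vertices. *)
Definition hamiltonian (L : {fset V}) (w : Omega) : R :=
  - \sum_(e \in [set e | E e /\ exists2 v, v \in L & e v])
      \big[*%R/1]_(v \in e) spin (w v).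

Definition bc_configs (L : {fset V}) (eta : Omega) : set Omega :=
  [set w | forall v, v \notin L -> w v = eta v].

Section FiniteVolume.
Variables (beta : R) (L : {fset V}) (eta : Omega).

Definition boltzmann (w : Omega) : R := expR (- beta * hamiltonian L w).

Definition partition_function : R :=
  \sum_(w \in bc_configs L eta) boltzmann w.

Definition finite_gibbs (A : set Omega) : \bar R :=
  (\sum_(w \in bc_configs L eta)
     (boltzmann w / partition_function)%:E * \d_w A)%E.

Lemma finite_bc_configs : finite_set (bc_configs L eta).
Proof.
pose F (g : {ffun L -> bool}) : Omega :=
  fun v => if insub v is Some i then g i else eta v.
apply: (@sub_finite_set _ _ (F @` [set: {ffun L -> bool}])); last first.
  exact/finite_image/finite_finset.
move=> w /= Hw; exists [ffun i : L => w (val i)] => //.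
apply/funext => v; rewrite /F; case: insubP => [i _ <-|vL]; first by rewrite ffunE.
by rewrite Hw.
Qed.

Lemma partition_function_gt0 : 0 < partition_function.
Proof.
rewrite /partition_function fsbig_finite /=; last exact: finite_bc_configs.
have eL : eta \in fset_set (bc_configs L eta).
  by rewrite in_fset_set ?inE //; exact: finite_bc_configs.
rewrite (big_fsetD1 eta eL) /=.
by rewrite ltr_pwDl ?expR_gt0// sumr_ge0// => i _; exact: expR_ge0.
Qed.

Lemma weight_ge0 w : 0 <= boltzmann w / partition_function.
Proof. by rewrite divr_ge0 ?expR_ge0// ltW// partition_function_gt0. Qed.

Let summand (i : nat) : {measure set Omega -> \bar R} :=
  let w := nth eta (fset_set (bc_configs L eta)) i in
  mscale (NngNum (weight_ge0 w)) (dirac w).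

Let finite_gibbsE A :
  finite_gibbs A = msum summand (size (fset_set (bc_configs L eta))) A.
Proof.
rewrite /finite_gibbs fsbig_finite /=; last exact: finite_bc_configs.
by rewrite /msum (big_nth eta) big_mkord.
Qed.

Let finite_gibbs0 : finite_gibbs set0 = 0%E.
Proof. by rewrite finite_gibbsE measure0. Qed.

Let finite_gibbs_ge0 A : (0 <= finite_gibbs A)%E.
Proof. by rewrite finite_gibbsE measure_ge0. Qed.

Let finite_gibbs_sigma_additive : semi_sigma_additive finite_gibbs.
Proof.
move=> F mF tF mUF; rewrite finite_gibbsE.
under eq_fun do under eq_bigr do rewrite finite_gibbsE.
exact: measure_semi_sigma_additive.
Qed.

HB.instance Definition _ := isMeasure.Build _ _ _ finite_gibbs
  finite_gibbs0 finite_gibbs_ge0 finite_gibbs_sigma_additive.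

Let finite_gibbsT : finite_gibbs setT = 1%E.
Proof.
rewrite /finite_gibbs.
under eq_fsbigr do rewrite diracT mule1.
rewrite fsbig_finite /=; last exact: finite_bc_configs.
rewrite sumEFin -mulr_suml -fsbig_finite /=; last exact: finite_bc_configs.
by rewrite divff// gt_eqF// partition_function_gt0.
Qed.

HB.instance Definition _ := Measure_isProbability.Build _ _ _ finite_gibbs
  finite_gibbsT.

End FiniteVolume.

Definition gibbs_measures (beta : R) : set (probability Omega R) :=
  [set mu : probability Omega R |
    forall (L : {fset V}) (A : set Omega), measurable A ->
      mu A = (\int[mu]_eta finite_gibbs beta L eta A)%E].

(* A probability as a function on the sigma-algebra.  A term of type probability
   also assigns values to non-measurable sets, which carry no meaning: measures
   are compared and counted through this map. *)
Definition on_sigma_algebra (mu : probability Omega R)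
    (A : {A : set Omega | measurable A}) : \bar R := mu (sval A).

Definition extremal (G : set (probability Omega R)) : set (probability Omega R) :=
  [set mu : probability Omega R | G mu /\
    forall (mu1 mu2 : probability Omega R) (t : R), G mu1 -> G mu2 ->
      0 < t < 1 ->
      (forall A, measurable A -> mu A = t%:E * mu1 A + (1 - t)%:E * mu2 A)%E ->
      on_sigma_algebra mu1 = on_sigma_algebra mu2].

Definition weak_limit (mu_ : nat -> probability Omega R)
    (mu : probability Omega R) : Prop :=
  forall f : Omega -> R,
    continuous (f : prod_topology (fun _ : V => bool) -> R) ->
    (\int[mu_ n]_w (f w)%:E)%E @[n --> \oo] --> (\int[mu]_w (f w)%:E)%E.

Definition exhaustion (L_ : nat -> {fset V}) : Prop :=
  (forall n, (L_ n `<=` L_ n.+1)%fset) /\ (forall v, exists n, v \in L_ n).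

End Ising.

Arguments on_sigma_algebra {R V} mu A.

Section SeriesSinai.
Variables (R : realType) (p : nat) (T : set (set 'rV[R]_3)).

Definition eta_geodesic (g : geodesic R) : config (set_type (tile_vertices p T)) :=
  fun v => `[< left_or_on g (val v) >].

(* The sequence of volumes is arbitrary, so subsequential limits are included. *)
Definition series_sinai_states (beta : R) :
    set (probability (config (set_type (tile_vertices p T))) R) :=
  [set mu : probability _ R | exists (g : geodesic R) L_, exhaustion L_ /\
    weak_limit
      (fun n => finite_gibbs (tiling_edges p T) beta (L_ n) (eta_geodesic g)) mu].

End SeriesSinai.

Arguments series_sinai_states {R} p T beta.

(* Main.v *)
Require Import Defs.
From HB Require Import structures.
From mathcomp Require Import all_boot all_order all_algebra.
From mathcomp Require Import finmap.
From mathcomp Require Import all_classical all_reals all_analysis measurable_realfun.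
From mathcomp Require Import ring lra zify.
Import Order.TTheory GRing.Theory Num.Theory.
Import numFieldNormedType.Exports.
Set Implicit Arguments.
Unset Strict Implicit.
Unset Printing Implicit Defensive.
Local Open Scope fset_scope.
Local Open Scope classical_set_scope.
Local Open Scope ring_scope.

(* In the coordinates of the set of vertices flipped with respect to the boundary
   configuration s, the model is a hard-core gas of connected droplets.  If flipping
   any finite set D costs at least |D| (an isoperimetric inequality for s), a Peierls
   estimate gives at low temperature a unique Gibbs state whose flipped set is
   locally small: it is the weak limit of the finite volume states, it is extremal,
   and each spin agrees with s with probability greater than 1/2.

   The p-gons at a vertex determine its neighbours as one orbit of a rotation, by an
   angle about 2 pi / q, so for q large the sides are long, vertices are far apart,
   and any cone of half-angle arccos(9/10) contains at most q/5 of the neighbours of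
   its apex.  The neighbours closer to a fixed point than the vertex itself lie in
   such a cone, and so do its neighbours across a geodesic at distance at least
   arcsinh 3.  Hence the isoperimetric inequality holds for every geodesic keeping
   this distance from all vertices.

   Uncountably many such geodesics pass through a point o far from all vertices.
   Their slopes form a Cantor set: since vertices are sparse, each stage has at most
   two vertices to avoid, each excluding at most one of four subintervals.  Two of
   these geodesics are separated by a vertex, so their states differ there. *)

(** * Droplets and the Peierls estimate *)

(** Extremality is the demanding requirement: the components of a decomposition are arbitrary Gibbs
    states, known only to be dominated by a multiple of the given one. Uniqueness is therefore
    proved in a class stable under such domination: DLR states that flip all of [S] with probability
    at most [K] times a small number to the power [|S|], for any constant [K]. Comparing two such
    states by an exchange inside a common droplet costs only a factor [K^2], against a decay [2^-n]
    in the radius [n].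

    The fraction 1/5 is the budget of the isoperimetric inequality. Per vertex of [D], at most
    [2q/5] of the [q] edge ends are lost to edges inside [D], and frustrated edges, counted [-1]
    instead of [1], cost at most another [2q/5]; what is left is [q/5 >= 1]. The bound 9/10 is
    chosen so that the cone opens by less than [pi/3].

    A tiling is given by axioms on closed sets whose vertices carry no canonical enumeration. The
    local picture at a side or a vertex is recovered from covering, local finiteness and the
    edge-to-edge condition by following a curve out of it and asking which tile it enters. *)

Section Droplets.
Variables (V : choiceType) (nb : V -> {fset V}).
Hypothesis nb_sym : forall x y, (y \in nb x) = (x \in nb y).
Implicit Types (A B C D F L S : {fset V}).

Definition closed_in D A : Prop :=
  (A `<=` D)%fset /\ forall x y, x \in A -> y \in nb x -> y \in D -> y \in A.

(* For [S] included in [D], the union of the components of [D] that meet [S]. *)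
Definition droplet S D : {fset V} :=
  [fset x in D | `[< forall A, (S `<=` A)%fset -> closed_in D A -> x \in A >]]%fset.

Lemma droplet_sub S D : (droplet S D `<=` D)%fset.
Proof. by apply/fsubsetP => x; rewrite !inE /= => /andP[]. Qed.

Lemma sub_droplet S D : (S `<=` D)%fset -> (S `<=` droplet S D)%fset.
Proof.
move=> SD; apply/fsubsetP => x xS; rewrite !inE /= (fsubsetP SD)//=.
by apply/asboolP => A /fsubsetP SA _; exact: SA.
Qed.

Lemma droplet_closed S D : closed_in D (droplet S D).
Proof.
split; first exact: droplet_sub.
move=> x y; rewrite !inE /= => /andP[xD /asboolP Hx] yx yD; rewrite yD /=.
apply/asboolP => A SA cA; case: (cA) => _; apply; [exact: Hx SA cA|exact: yx|exact: yD].
Qed.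

Lemma droplet_min S D A : (S `<=` A)%fset -> closed_in D A ->
  (droplet S D `<=` A)%fset.
Proof.
move=> SA cA; apply/fsubsetP => x; rewrite !inE /= => /andP[xD /asboolP]; exact.
Qed.

Definition closure_nb C : {fset V} := (C `|` \bigcup_(x <- C) nb x)%fset.

Lemma closure_nbP C y :
  reflect (y \in C \/ exists2 x, x \in C & y \in nb x) (y \in closure_nb C).
Proof.
rewrite inE; apply: (iffP orP) => [[|/bigfcupP[x]]|[|[x xC yx]]]; first by left.
- by rewrite andbT => xC yx; right; exists x.
- by left.
- by right; apply/bigfcupP; exists x => //; rewrite xC.
Qed.

Lemma sub_closure_nb C : (C `<=` closure_nb C)%fset.
Proof. by apply/fsubsetP => x xC; apply/closure_nbP; left. Qed.

Lemma nb_closure C x y : x \in C -> y \in nb x -> y \in closure_nb C.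
Proof. by move=> xC yx; apply/closure_nbP; right; exists x. Qed.

Lemma card_closure_nb q C : (forall x, #|` nb x| <= q)%N ->
  (#|` closure_nb C| <= q.+1 * #|` C|)%N.
Proof.
move=> hq; apply: leq_trans (_ : #|` C| + #|` \bigcup_(x <- C) nb x| <= _)%N.
  by rewrite cardfsU leq_subr.
rewrite mulSn leq_add2l.
apply: (@leq_trans (\sum_(x <- C) #|` nb x|)%N).
  elim: (enum_fset C) => [|x r IH]; first by rewrite !big_nil cardfs0.
  rewrite !big_cons; apply: leq_trans (leq_add (leqnn _) IH).
  by rewrite cardfsU leq_subr.
apply: leq_trans (leq_sum _ (fun x _ => hq x)) _.
by rewrite big_const_seq count_predT iter_addn_0.
Qed.

(* The condition on [D] only involves its trace on [closure_nb C]. *)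
Lemma droplet_eq S D0 D : (S `<=` D0)%fset ->
  (D `&` closure_nb (droplet S D0) = droplet S D0)%fset ->
  droplet S D = droplet S D0.
Proof.
move=> SD0; set C := droplet S D0 => DC.
have CD : (C `<=` D)%fset by rewrite -DC fsubsetIl.
have SC : (S `<=` C)%fset by exact: sub_droplet.
have CcD : closed_in D C.
  split=> // x y xC yx yD; rewrite -DC inE yD /=; exact: nb_closure xC yx.
have sub : (droplet S D `<=` C)%fset by exact: droplet_min.
apply/eqP; rewrite eqEfsubset sub /=; apply: droplet_min.
  by apply: sub_droplet; exact: fsubset_trans SC CD.
split; first exact: fsubset_trans sub (droplet_sub _ _).
move=> x y xA yx yD0; have xC := fsubsetP sub _ xA.
have [_ + ] := droplet_closed S D0; move=> /(_ x y xC yx yD0) yC.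
have [_] := droplet_closed S D; apply; [exact: xA|exact: yx|exact: (fsubsetP CD)].
Qed.

(** With [droplet_eq], this turns the event that the droplet is a given set [C] into a condition on
    the trace of [D] on the closed neighbourhood of [C]. *)
Lemma droplet_trace S D : (D `&` closure_nb (droplet S D) = droplet S D)%fset.
Proof.
apply/fsetP => y; rewrite inE; apply/andP/idP => [[yD /closure_nbP[//|[x xC yx]]]|yC].
  have [_] := droplet_closed S D; apply; [exact: xC|exact: yx|exact: yD].
split; [exact: (fsubsetP (droplet_sub _ _)) yC|exact: (fsubsetP (sub_closure_nb _))].
Qed.

End Droplets.

Section PowersetSums.
Local Open Scope fset_scope.
Local Open Scope ring_scope.
Variables (R : realType) (V : choiceType).
Implicit Types (B C D F L N S : {fset V}) (f : {fset V} -> R).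

Lemma sum_trace F N C f : (C `<=` F)%fset -> (C `<=` N)%fset ->
  \sum_(D <- fpowerset F | (D `&` N == C)%fset) f D =
  \sum_(D <- fpowerset (F `\` N)) f (C `|` D)%fset.
Proof.
move=> CF CN; rewrite big_fset_condE.
have -> : [fset D in fpowerset F | (D `&` N == C)%fset]%fset =
          [fset (C `|` D)%fset | D in fpowerset (F `\` N)]%fset.
  apply/fsetP => D; rewrite !inE /=; apply/andP/imfsetP => /=.
    move=> [DF /eqP DN]; exists (D `\` N)%fset; last by rewrite -DN fsetID.
    rewrite !fpowersetE in DF *; exact: fsetSD.
  move=> [D']; rewrite !fpowersetE => D'F ->; split.
    by rewrite fsubUset CF (fsubset_trans D'F) ?fsubsetDl.
  apply/eqP/fsetP => x; rewrite !inE.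
  move: (fsubsetP CN x) (fsubsetP D'F x); rewrite !inE => /implyP + /implyP.
  by do ?case: (x \in _).
rewrite big_imfset //= => D1 D2; rewrite !fpowersetE => D1F D2F E.
apply/fsetP => x; move/fsetP: E => /(_ x); rewrite !inE.
move: (fsubsetP CN x) (fsubsetP D1F x) (fsubsetP D2F x); rewrite !inE.
by move=> /implyP + /implyP + /implyP; do ?case: (x \in _).
Qed.

Lemma sum_powerset_const F (c : R) : \sum_(D <- fpowerset F) c = 2 ^+ #|` F| * c.
Proof.
by rewrite big_const_seq count_predT iter_addr_0 (card_fpowerset F) -natrX mulr_natl.
Qed.

End PowersetSums.

Section DropletCount.
Local Open Scope fset_scope.
Local Open Scope ring_scope.
Variables (R : realType) (V : choiceType) (nb : V -> {fset V}) (q : nat).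
Hypothesis nb_le : forall x, (#|` nb x| <= q)%N.
Implicit Types (B C D F L S : {fset V}) (f : {fset V} -> R).

Definition droplets S F : {fset {fset V}} :=
  [fset droplet nb S D | D in [fset D in fpowerset F | (S `<=` D)%fset]]%fset.

Lemma dropletsP S F C : C \in droplets S F ->
  exists D, [/\ (S `<=` D)%fset, (D `<=` F)%fset & C = droplet nb S D].
Proof.
by move=> /imfsetP[/= D]; rewrite !inE /= fpowersetE => /andP[DF SD] ->; exists D.
Qed.

(** Fixing the droplet [C] of [S] freezes [D] on the closed neighbourhood of [C] and leaves it
    arbitrary elsewhere. *)
Lemma sum_droplets S F f :
  \sum_(D <- fpowerset F | (S `<=` D)%fset) f D =
  \sum_(C <- droplets S F) \sum_(D <- fpowerset (F `\` closure_nb nb C)) f (C `|` D)%fset.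
Proof.
rewrite big_fset_condE (partition_big_imfset _ (droplet nb S)) /=.
rewrite big_seq [RHS]big_seq; apply: eq_bigr => C /dropletsP[D0 [SD0 D0F ->]].
set C0 := droplet nb S D0.
rewrite -sum_trace; last 2 first.
- exact: fsubset_trans (droplet_sub _ _ _) D0F.
- exact: sub_closure_nb.
rewrite [LHS]big_fset_condE [RHS]big_fset_condE; apply: eq_fbigl => D.
rewrite !inE /=; apply/andP/andP => [[/andP[DF SD] /eqP <-]|[DF /eqP DC]].
  by rewrite droplet_trace eqxx; split.
have SD : (S `<=` D)%fset.
  by apply: fsubset_trans (sub_droplet nb SD0) _; rewrite -/C0 -DC fsubsetIl.
by rewrite DF SD; split => //; apply/eqP; exact: droplet_eq.
Qed.

(** This entropy bound replaces the enumeration of connected sets. A uniformly random subset of [F]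
    contains [S] and has droplet [C] with probability at least [2^-((q+1)|C|)], because that event
    only fixes the trace on the closed neighbourhood of [C]; for distinct [C] these events are
    disjoint. *)
Lemma sum_droplets_le1 S F : \sum_(C <- droplets S F) (2^-1 ^+ q.+1) ^+ #|` C| <= 1 :> R.
Proof.
have : \sum_(D <- fpowerset F | (S `<=` D)%fset) 1 <= 2 ^+ #|` F| :> R.
  rewrite -[leRHS]mulr1 -sum_powerset_const big_mkcond /=.
  by apply: ler_sum => D _; case: ifP.
rewrite sum_droplets => h.
rewrite -(@ler_pM2l _ (2 ^+ #|` F|)) ?exprn_gt0// mulr1; apply: le_trans h.
rewrite mulr_sumr; apply: ler_sum => C _; rewrite sum_powerset_const mulr1.
have hc := card_closure_nb (nb := nb) C nb_le.
rewrite -exprM exprVn -ler_pdivlMr ?invr_gt0 ?exprn_gt0// invrK -exprD.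
rewrite ler_weXn2l ?ler1n//; apply: leq_trans (leq_add (leqnn _) hc).
by rewrite -(cardfsID (closure_nb nb C) F) addnC leq_add2l fsubset_leq_card ?fsubsetIr.
Qed.
End DropletCount.

Section Energy.
Local Open Scope fset_scope.
Local Open Scope ring_scope.
Variables (R : realType) (V : choiceType) (nb : V -> {fset V}) (s : V -> bool).
Hypothesis nb_sym : forall x y, (y \in nb x) = (x \in nb y).
Implicit Types (A B C D F L S : {fset V}).

(* Half the energy cost of flipping [s] on [D], edges inside [D] costing nothing. *)
Definition excess D : R :=
  \sum_(x <- D) \sum_(y <- nb x `\` D) spin R (s x) * spin R (s y).

Lemma excessU C D : [disjoint C & D] ->
  (forall x y, x \in C -> y \in nb x -> y \notin D) ->
  excess (C `|` D) = excess C + excess D.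
Proof.
move=> dCD sep.
have CDn x : x \in C -> x \notin D by move/fdisjointP: dCD; exact.
rewrite /excess (big_fsetID _ (mem C)) /=; congr (_ + _).
- have -> : [fset x in C `|` D | x \in C] = C.
    by apply/fsetP => x; rewrite !inE; case: (x \in C) => //=; rewrite andbF.
  rewrite big_seq [RHS]big_seq; apply: eq_bigr => x xC; apply: eq_fbigl => y.
  rewrite !inE negb_or; case yx: (y \in nb x); last by rewrite !andbF.
  by rewrite (sep _ _ xC yx) andbT.
- have -> : [fset x in C `|` D | x \notin C] = D.
    apply/fsetP => x; rewrite !inE; case xC: (x \in C) => //=; last by rewrite andbT.
    by rewrite (negbTE (CDn _ xC)).
  rewrite big_seq [RHS]big_seq; apply: eq_bigr => x xD; apply: eq_fbigl => y.
  rewrite !inE negb_or; case yx: (y \in nb x); last by rewrite !andbF.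
  case yC: (y \in C) => //=.
  by move: (sep y x yC); rewrite nb_sym yx xD => /(_ isT).
Qed.

Variable beta : R.

Definition weight D : R := expR (- (2 * beta * excess D)).

Lemma weight_gt0 D : 0 < weight D. Proof. exact: expR_gt0. Qed.

Lemma weightU C D : [disjoint C & D] ->
  (forall x y, x \in C -> y \in nb x -> y \notin D) ->
  weight (C `|` D) = weight C * weight D.
Proof. by move=> ? ?; rewrite /weight excessU// mulrDr opprD expRD. Qed.

Definition mass L : R := \sum_(D <- fpowerset L) weight D.

Lemma mass_gt0 L : 0 < mass L.
Proof.
rewrite /mass (big_fsetD1 fset0) /=; last by rewrite fpowersetE fsub0set.
by rewrite ltr_pwDl ?weight_gt0// sumr_ge0// => D _; exact/ltW/weight_gt0.
Qed.

Lemma le_mass L F : L `<=` F -> mass L <= mass F.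
Proof.
move=> LF; rewrite /mass [leRHS](big_fsetID _ (fun D => D `<=` L)) /=.
rewrite -[leLHS]addr0 lerD//; last by rewrite sumr_ge0// => D _; exact/ltW/weight_gt0.
rewrite le_eqVlt; apply/orP; left; apply/eqP; apply: eq_fbigl => D.
rewrite !inE !fpowersetE /=; apply/idP/andP => [DL|[]//]; split=> //.
exact: fsubset_trans LF.
Qed.

Variable q : nat.
Hypothesis nb_le : forall x, (#|` nb x| <= q)%N.
Hypothesis iso : forall D, #|` D|%:R <= excess D.
Hypothesis cold : expR (- (2 * beta)) <= 2^-1 ^+ (q.+1 + q.+3).
Hypothesis beta_ge0 : 0 <= beta.

(** The first factor pays for the sum over droplets in [sum_droplets_le1]; the second is the gain
    that survives. *)
Lemma weight_le D : weight D <= (2^-1 ^+ q.+1) ^+ #|` D| * (2^-1 ^+ q.+3) ^+ #|` D|.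
Proof.
rewrite -exprMn -exprD; apply: le_trans (lerXn2r _ _ _ cold); rewrite ?nnegrE ?expR_ge0//.
rewrite -expRM_natl /weight ler_expR mulrN lerN2 mulrC ler_wpM2l ?iso//.
by rewrite mulr_ge0.
Qed.

(** The weight factorizes over the droplet of [S] and the rest of [D], whose total weight is at most
    [mass F]; erasing the droplet thus costs at most its own weight. *)
Lemma peierls S F :
  \sum_(D <- fpowerset F | S `<=` D) weight D <= (2^-1 ^+ q.+3) ^+ #|` S| * mass F.
Proof.
rewrite (sum_droplets nb).
have h0 : 0 <= 2^-1 :> R by lra.
have h1 : 2^-1 <= 1 :> R by lra.
apply: (@le_trans _ _ (\sum_(C <- droplets nb S F) (2^-1 ^+ q.+1) ^+ #|` C| *
   ((2^-1 ^+ q.+3) ^+ #|` S| * mass F))); last first.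
  rewrite -mulr_suml -[leRHS]mul1r ler_wpM2r ?sum_droplets_le1//.
  rewrite mulr_ge0 ?(ltW (mass_gt0 _))// !exprn_ge0.
rewrite big_seq [leRHS]big_seq; apply: ler_sum => C /dropletsP[D0 [SD0 D0F ->]].
set C0 := droplet nb S D0.
apply: (@le_trans _ _ (\sum_(D <- fpowerset (F `\` closure_nb nb C0)) weight C0 * weight D)).
  rewrite big_seq [leRHS]big_seq; apply: ler_sum => D; rewrite fpowersetE => DF.
  rewrite weightU //.
    apply/fdisjointP => x xC; apply/negP => /(fsubsetP DF); rewrite inE.
    by rewrite (fsubsetP (sub_closure_nb _ _)).
  move=> x y xC yx; apply/negP => /(fsubsetP DF); rewrite inE.
  by rewrite (nb_closure xC).
rewrite -mulr_sumr mulrA; apply: ler_pM; rewrite ?(ltW (weight_gt0 _))//.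
- exact/ltW/mass_gt0.
- apply: le_trans (weight_le _) _; rewrite ler_wpM2l ?exprn_ge0//.
  apply: ler_wiXn2l; rewrite ?exprn_ge0 ?exprn_ile1//.
  exact/fsubset_leq_card/sub_droplet.
- exact/le_mass/fsubsetDl.
Qed.

End Energy.

Lemma sum_involution (R : nmodType) (T : eqType) (r : seq T) (h : T -> T) (f : T -> R) :
  uniq r -> {in r, forall x, h x \in r} -> {in r, involutive h} ->
  \sum_(x <- r) f (h x) = \sum_(x <- r) f x.
Proof.
move=> ur hr hK; rewrite -(big_map h xpredT f); apply: perm_big; apply: uniq_perm => //.
  by rewrite map_inj_in_uniq// => x y xr yr E; rewrite -(hK x)// -(hK y)// E.
move=> x; apply/mapP/idP => [[y yr ->]|xr]; first exact: hr.
by exists (h x); rewrite ?hr ?hK.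
Qed.

(** * Comparison of two states by exchanging samples inside a droplet *)

Section Balls.
Local Open Scope fset_scope.
Variables (V : choiceType) (nb : V -> {fset V}).
Implicit Types (A B D : {fset V}).

Definition nball n B := iter n (closure_nb nb) B.

Lemma nball_sub n B : B `<=` nball n B.
Proof.
elim: n => [//|n IH]; apply: fsubset_trans IH _; exact: sub_closure_nb.
Qed.

Lemma nball_le m n B : (m <= n)%N -> nball m B `<=` nball n B.
Proof.
move=> /subnK <-; rewrite /nball iterD -/(nball _ _).
elim: (n - m)%N => [|k IH]; first exact: fsubset_refl.
apply: fsubset_trans IH _; exact: sub_closure_nb.
Qed.

(** A droplet leaving the ball of radius [n] gains a new point in each of the [n] successive shells:
    were one shell missed, its part inside the smaller ball would already be closed and contain
    [B]. *)
Lemma card_droplet_far B D n : B `<=` D -> ~~ (droplet nb B D `<=` nball n B) ->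
  (n <= #|` droplet nb B D|)%N.
Proof.
set A := droplet nb B D => BD Anot.
have BA : B `<=` A by exact: sub_droplet.
have step k : (k < n)%N -> exists2 y, y \in A & (y \in nball k.+1 B) && (y \notin nball k B).
  move=> kn; apply: contrapT => noy; move/negP: Anot; apply.
  apply: fsubset_trans (_ : A `&` nball k B `<=` _); last first.
    by apply: fsubset_trans (fsubsetIr _ _) _; exact/nball_le/ltnW.
  apply: droplet_min; first by rewrite fsubsetI BA nball_sub.
  split; first exact: fsubset_trans (fsubsetIl _ _) (droplet_sub _ _ _).
  move=> x y; rewrite !in_fsetI => /andP[xA xk] yx yD.
  have [_ cl] := droplet_closed nb B D; have yA : y \in A := cl _ _ xA yx yD.
  rewrite yA /=; apply/negPn/negP => yk; apply: noy; exists y => //.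
  by rewrite yk andbT; apply: nb_closure xk yx.
have {step} : forall k, (k <= n)%N -> (k <= #|` A `&` nball k B|)%N.
  elim=> // k IH kn; have [y yA /andP[y1 y2]] := step _ kn.
  apply: leq_ltn_trans (IH (ltnW kn)) _; apply: fproper_ltn_card.
  rewrite fproperEneq fsetIS ?sub_closure_nb// andbT.
  apply/negP => /eqP/fsetP/(_ y); rewrite !in_fsetI yA y1 /=; exact/negP.
move=> /(_ n (leqnn n)) h; apply: leq_trans h _; apply: fsubset_leq_card; exact: fsubsetIl.
Qed.

End Balls.

Section Swap.
Local Open Scope fset_scope.
Local Open Scope ring_scope.
Variables (R : realType) (V : choiceType) (nb : V -> {fset V}) (s : V -> bool).
Hypothesis nb_sym : forall x y, (y \in nb x) = (x \in nb y).
Variables (q : nat) (beta : R).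
Hypothesis nb_le : forall x, (#|` nb x| <= q)%N.
Implicit Types (A B C D F L S : {fset V}) (p : {fset V} -> R).
Local Notation W := (weight nb s beta).

(* [p] is the law, read in the window [F], of the set of vertices at which a
   configuration differs from [s]; the balance condition is the DLR equation
   inside [L]. *)
Record droplet_law (F L : {fset V}) (K : R) p : Prop := DropletLaw {
  law_ge0 : forall D, 0 <= p D;
  law_sum : \sum_(D <- fpowerset F) p D = 1;
  law_balance : forall D D', D `<=` F -> D' `<=` F -> D `\` L = D' `\` L ->
     p D * W D' = p D' * W D;
  law_peierls : forall S, S `<=` F ->
     \sum_(D <- fpowerset F | S `<=` D) p D <= K * (2^-1 ^+ q.+3) ^+ #|` S| }.

Variables (F L B : {fset V}) (n : nat) (K : R) (p1 p2 : {fset V} -> R).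
Hypotheses (BF : B `<=` F) (BL : nball nb n B `<=` L) (K0 : 0 <= K).
Hypotheses (H1 : droplet_law F L K p1) (H2 : droplet_law F L K p2).

(** Attached to the union of the two samples, which the exchange does not alter, so that the
    exchange is an involution; [B] is added to the union so that the droplet always covers it. *)
Let drop (x : {fset V} * {fset V}) := droplet nb B (x.1 `|` x.2 `|` B).
Let mix A (x : {fset V} * {fset V}) := (x.1 `\` A) `|` (x.2 `&` A).
Let swp (x : {fset V} * {fset V}) := (mix (drop x) x, mix (drop x) (x.2, x.1)).
Let r := [seq (D, D') | D <- fpowerset F, D' <- fpowerset F].
Let g (x : {fset V} * {fset V}) := p1 x.1 * p2 x.2.

Let mem_r x : (x \in r) = (x.1 `<=` F) && (x.2 `<=` F).
Proof.
by case: x => D D'; rewrite -!fpowersetE; apply/allpairsP/andP => /= [[[a b] /= [? ? [-> ->]]]|[? ?]];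
  [|exists (D, D')].
Qed.

Let uniq_r : uniq r.
Proof. by apply: allpairs_uniq; rewrite ?fset_uniq//; move=> [a b] [c d] _ _. Qed.

Let swp_union x : (swp x).1 `|` (swp x).2 = x.1 `|` x.2.
Proof.
apply/fsetP => y; rewrite /swp /mix /= !(in_fsetU, in_fsetD, in_fsetI).
by case: (y \in drop x); case: (y \in x.1); case: (y \in x.2).
Qed.

Let drop_swp x : drop (swp x) = drop x.
Proof. by rewrite /drop swp_union. Qed.

Let drop_sub x : x \in r -> drop x `<=` F.
Proof.
rewrite mem_r => /andP[xF1 xF2]; apply: fsubset_trans (droplet_sub _ _ _) _.
by rewrite !fsubUset xF1 xF2.
Qed.

Let swp_r : {in r, forall x, swp x \in r}.
Proof.
move=> x xr; have := xr; rewrite !mem_r => /andP[xF1 xF2] /=.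
rewrite /mix /= !fsubUset !(fsubset_trans (fsubsetDl _ _))//=.
by rewrite !(fsubset_trans (fsubsetIl _ _)).
Qed.

Let swpK : {in r, involutive swp}.
Proof.
move=> x _; rewrite {1}/swp drop_swp; case: x => D D'; rewrite /swp /mix /=.
by congr (_, _); apply/fsetP => y; rewrite !(in_fsetU, in_fsetD, in_fsetI); case: (y \in drop _);
  case: (y \in D); case: (y \in D').
Qed.

(** No edge joins the droplet to the rest of the union of the samples, so each weight is a product
    of an inner and an outer factor, and the exchange only permutes the inner ones. *)
Let weight_swp x :
  W (swp x).1 * W (swp x).2 = W x.1 * W x.2.
Proof.
set A := drop x; have sep (X Y : {fset V}) : Y `<=` x.1 `|` x.2 ->
    W ((Y `\` A) `|` (X `&` A)) = W (X `&` A) * W (Y `\` A).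
  move=> YU; rewrite fsetUC; apply: weightU => //.
    by apply/fdisjointP => y; rewrite in_fsetI in_fsetD => /andP[_ ->].
  move=> a y; rewrite in_fsetI => /andP[_ aA] ya; apply/negP; rewrite in_fsetD => /andP[yA yY].
  move/negP: yA; apply; have [_ cl] := droplet_closed nb B (x.1 `|` x.2 `|` B).
  by apply: cl aA ya _; rewrite inE (fsubsetP YU).
have split (X : {fset V}) : X `<=` x.1 `|` x.2 -> W X = W (X `&` A) * W (X `\` A).
  by move=> XU; rewrite -sep// fsetUC fsetID.
rewrite (split x.1 (fsubsetUl _ _)) (split x.2 (fsubsetUr _ _)).
rewrite /swp /mix /= -/A !sep ?fsubsetUl ?fsubsetUr//; ring.
Qed.

(** When the droplet lies in [L], both samples keep their trace outside [L], and the DLR balance of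
    each law converts the invariance of the weights into that of the product law. *)
Let g_swp x : x \in r -> drop x `<=` L -> g (swp x) = g x.
Proof.
move=> xr AL; have := swp_r xr; rewrite mem_r => /andP[y1 y2].
have := xr; rewrite mem_r => /andP[x1 x2].
have out (X Y : {fset V}) : ((X `\` drop x) `|` (Y `&` drop x)) `\` L = X `\` L.
  apply/fsetP => y; rewrite !(in_fsetU, in_fsetD, in_fsetI); have := fsubsetP AL y.
  case: (y \in drop x) => [/(_ isT) ->//|_]; by rewrite andbF orbF.
have E1 := law_balance H1 y1 x1 (out _ _).
have E2 := law_balance H2 y2 x2 (out _ _).
have Wn : W (swp x).1 * W (swp x).2 != 0 by rewrite mulf_neq0 ?gt_eqF ?weight_gt0.
apply: (mulIf Wn); rewrite {1}weight_swp /g.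
transitivity ((p1 (swp x).1 * W x.1) * (p2 (swp x).2 * W x.2)); first by ring.
by rewrite E1 E2; ring.
Qed.

Let g_ge0 x : 0 <= g x.
Proof. by rewrite mulr_ge0 ?(law_ge0 H1) ?(law_ge0 H2). Qed.

Let sum_g (f1 f2 : {fset V} -> R) :
  \sum_(x <- r) g x * (f1 x.1 * f2 x.2) =
  (\sum_(D <- fpowerset F) p1 D * f1 D) * (\sum_(D <- fpowerset F) p2 D * f2 D).
Proof.
rewrite big_allpairs mulr_suml; apply: eq_bigr => D _.
by rewrite mulr_sumr; apply: eq_bigr => D' _; rewrite /g /=; ring.
Qed.

(** A set covered by two samples splits into a part [S] flipped in the first and the rest flipped in
    the second. Summing over the splittings costs a factor 2 per point, which lowers the exponent
    from [q+3] to [q+2]. *)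
Let far_le A : A `<=` F ->
  \sum_(x <- r) g x * (A `\` B `<=` x.1 `|` x.2)%:R <=
  K ^+ 2 * (2^-1 ^+ q.+2) ^+ #|` A `\` B|.
Proof.
move=> AF; set T := A `\` B.
have TF : T `<=` F by exact: fsubset_trans (fsubsetDl _ _) AF.
apply: (@le_trans _ _ (\sum_(S <- fpowerset T)
   \sum_(x <- r) g x * ((S `<=` x.1)%:R * (T `\` S `<=` x.2)%:R))).
  rewrite exchange_big /=; apply: ler_sum => x _; rewrite -mulr_sumr ler_wpM2l//.
  case: (boolP (T `<=` _)) => [Tx|_]; last by rewrite sumr_ge0.
  rewrite (big_fsetD1 (T `&` x.1)) /=; last by rewrite fpowersetE fsubsetIl.
  rewrite fsubsetIr mul1r.
  have -> : T `\` (T `&` x.1) `<=` x.2.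
    apply/fsubsetP => y; rewrite in_fsetD in_fsetI negb_and => /andP[+ yT]; rewrite yT /=.
    by have := fsubsetP Tx _ yT; rewrite inE => /orP[->|].
  by rewrite lerDl sumr_ge0.
have -> : K ^+ 2 * (2^-1 ^+ q.+2) ^+ #|` T| =
    \sum_(S <- fpowerset T) K ^+ 2 * (2^-1 ^+ q.+3) ^+ #|` T|.
  rewrite sum_powerset_const mulrCA; congr (_ * _); rewrite -exprMn; congr (_ ^+ _).
  by rewrite [in RHS]exprS mulrA divff// mul1r.
rewrite big_seq [leRHS]big_seq; apply: ler_sum => S; rewrite fpowersetE => ST.
rewrite (sum_g (fun D => (S `<=` D)%:R) (fun D => (T `\` S `<=` D)%:R)).
have pe p X : droplet_law F L K p -> X `<=` F ->
    \sum_(D <- fpowerset F) p D * (X `<=` D)%:R <= K * (2^-1 ^+ q.+3) ^+ #|` X|.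
  move=> Hp XF; apply: le_trans (law_peierls Hp XF); rewrite [leRHS]big_mkcond /=.
  by apply: ler_sum => D _; case: ifP; rewrite ?mulr1 ?mulr0.
apply: le_trans (ler_pM _ _ (pe p1 S H1 _) (pe p2 (T `\` S) H2 _)) _.
- by apply: sumr_ge0 => D _; rewrite mulr_ge0 ?(law_ge0 H1).
- by apply: sumr_ge0 => D _; rewrite mulr_ge0 ?(law_ge0 H2).
- exact: fsubset_trans ST TF.
- exact: fsubset_trans (fsubsetDl _ _) TF.
rewrite mulrACA -expr2 -exprD cardfsDS// subnKC//; exact: fsubset_leq_card.
Qed.

(* Exchange two independent samples on the droplet attached to [B] in the union of
   their flipped sets: this preserves the product law unless the droplet is large. *)
Lemma swap_le b :
  \sum_(D <- fpowerset F | D `&` B == b) p1 D <=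
  \sum_(D <- fpowerset F | D `&` B == b) p2 D +
    K ^+ 2 * (2 ^+ q.+2) ^+ #|` B| * 2^-1 ^+ n.
Proof.
pose ind D : R := (D `&` B == b)%:R.
have indE p : \sum_(D <- fpowerset F | D `&` B == b) p D =
              \sum_(D <- fpowerset F) p D * ind D.
  rewrite big_mkcond /=; apply: eq_bigr => D _; rewrite /ind.
  by case: ifP; rewrite ?mulr1 ?mulr0.
pose good x : R := (drop x `<=` L)%:R.
pose bad x : R := (~~ (drop x `<=` L))%:R.
have -> : \sum_(D <- fpowerset F | D `&` B == b) p1 D =
   \sum_(x <- r) g x * good x * ind x.1 + \sum_(x <- r) g x * bad x * ind x.1.
  rewrite indE -[LHS]mulr1 -(law_sum H2).
  under [X in _ * X]eq_bigr do rewrite -[p2 _]mulr1.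
  rewrite -(sum_g ind (fun=> 1)) -big_split /=; apply: eq_bigr => x _.
  by rewrite /good /bad; case: (_ `<=` _) => /=; ring.
apply: lerD.
  have -> : \sum_(x <- r) g x * good x * ind x.1 = \sum_(x <- r) g x * good x * ind x.2.
    rewrite -(sum_involution _ uniq_r swp_r swpK) big_seq [RHS]big_seq.
    apply: eq_bigr => x xr; rewrite /good drop_swp.
    case: (boolP (_ `<=` _)) => [AL|]; last by rewrite !mulr0 !mul0r.
    rewrite g_swp//; congr (_ * _); rewrite /ind; congr (_ == _)%:R.
    apply/fsetP => y; rewrite !(in_fsetU, in_fsetD, in_fsetI); case yB: (y \in B); last by rewrite !andbF.
    have -> : y \in drop x; last by rewrite /= !andbT.
    by apply: (fsubsetP (sub_droplet _ _)) yB; exact: fsubsetUr.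
  rewrite indE -[leRHS]mul1r -(law_sum H1).
  under [X in _ <= X * _]eq_bigr do rewrite -[p1 _]mulr1.
  rewrite -(sum_g (fun=> 1) ind); apply: ler_sum => x _.
  rewrite mul1r -mulrA ler_wpM2l// /good; case: (_ `<=` _); rewrite ?mul1r ?mul0r//.
(* On the bad event the droplet leaves the ball of radius [n], hence is one of the droplets with at
   least [n] points. *)
pose T := [fset A in droplets nb B F | (n <= #|` A|)%N].
have badE x : x \in r -> bad x * ind x.1 <=
    \sum_(A <- T) (A `\` B `<=` x.1 `|` x.2)%:R.
  move=> xr; rewrite /bad; case: (boolP (_ `<=` _)) => [_|AL]; rewrite ?mul0r ?sumr_ge0//.
  rewrite (big_fsetD1 (drop x)) /=.
    have -> : drop x `\` B `<=` x.1 `|` x.2.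
      apply/fsubsetP => y; rewrite in_fsetD => /andP[yB /(fsubsetP (droplet_sub _ _ _))].
      by rewrite inE (negbTE yB) orbF.
    rewrite mul1r -[leLHS]addr0 lerD ?sumr_ge0//.
    by rewrite /ind; case: (_ == _).
  rewrite !inE /=; apply/andP; split.
    apply/imfsetP; exists (x.1 `|` x.2 `|` B) => //=.
    rewrite !inE fsubsetUr andbT fpowersetE !fsubUset BF.
    by move: xr; rewrite mem_r => ->.
  apply: card_droplet_far; first exact: fsubsetUr.
  by apply: contraNN AL => h; exact: fsubset_trans h BL.
apply: (@le_trans _ _ (\sum_(x <- r) \sum_(A <- T) g x * (A `\` B `<=` x.1 `|` x.2)%:R)).
  rewrite big_seq [leRHS]big_seq; apply: ler_sum => x xr.
  by rewrite -mulr_sumr -mulrA ler_wpM2l// badE.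
rewrite exchange_big /=.
have h0 : 0 <= 2^-1 :> R by lra.
have h1 : 2^-1 <= 1 :> R by lra.
(* Of the factor [2^-(q+2)] per point of [A], the part [2^-(q+1)] pays for the sum over droplets and
   the remaining [2^-|A|] is at most [2^-n]. The points of [B], added by hand and hence not known to
   be flipped, are compensated by the power of [|B|]. *)
apply: (@le_trans _ _ (\sum_(A <- droplets nb B F)
    K ^+ 2 * (2 ^+ q.+2) ^+ #|` B| * 2^-1 ^+ n * (2^-1 ^+ q.+1) ^+ #|` A|)); last first.
  rewrite -mulr_sumr -[leRHS]mulr1 ler_wpM2l ?sum_droplets_le1//.
  by rewrite !mulr_ge0 ?exprn_ge0.
rewrite -big_fset_condE /= big_mkcond /= big_seq [leRHS]big_seq.
apply: ler_sum => A /dropletsP[D [BD DF AE]].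
case: ifP => [nA|_]; last by rewrite !mulr_ge0 ?exprn_ge0.
have BA : B `<=` A by rewrite AE sub_droplet.
apply: le_trans (far_le _) _.
  by rewrite AE; apply: fsubset_trans (droplet_sub _ _ _) DF.
rewrite -!mulrA ler_wpM2l// ler_wpM2l//.
have -> : #|` A `\` B| = (#|` A| - #|` B|)%N by rewrite cardfsDS.
have BAc : (#|` B| <= #|` A|)%N by exact: fsubset_leq_card.
rewrite -(@ler_pM2l _ ((2^-1 ^+ q.+2) ^+ #|` B|)); last by rewrite !exprn_gt0//; lra.
rewrite -exprD subnKC// [leRHS]mulrA -[_ * (2 ^+ _) ^+ _]exprMn -[_ * 2 ^+ _]exprMn.
rewrite mulVf// !expr1n mul1r.
rewrite exprS exprMn ler_wpM2r ?exprn_ge0//.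
by apply: ler_wiXn2l.
Qed.

End Swap.

(** * Gibbs states at low temperature *)

Section Hamiltonian.
Local Open Scope fset_scope.
Local Open Scope classical_set_scope.
Local Open Scope ring_scope.
Variables (R : realType) (V : choiceType) (nb : V -> {fset V}).
Hypothesis nb_sym : forall x y, (y \in nb x) = (x \in nb y).
Hypothesis nb_irr : forall x, x \notin nb x.
Variable E : set (set V).
Hypothesis edgeE : E = [set e | exists x y, e = [set x; y] /\ y \in nb x].
Implicit Types (A B C D F L S : {fset V}) (w : config V).

Definition flip (s : config V) D : config V := fun v => s v (+) (v \in D).

Definition touching L : set (set V) := [set e | E e /\ exists2 v, v \in L & e v].

Lemma finite_touching L : finite_set (touching L).
Proof.
apply: (@sub_finite_set _ _ ((fun p : V * V => [set p.1; p.2]) @`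
   [set` [seq (x, y) | x <- L, y <- nb x]])); last first.
  apply: finite_image; exact: finite_seq.
move=> e []; rewrite edgeE => -[x [y [-> yx]]] [v vL] [vx|vx] /=; rewrite vx in vL.
- by exists (x, y) => //=; apply/allpairsPdep; exists x, y.
- exists (y, x) => /=; last by rewrite setUC.
  by apply/allpairsPdep; exists y, x; split => //; rewrite nb_sym.
Qed.

Definition bond w (e : set V) : R := \big[*%R/1]_(v \in e) spin R (w v).

Lemma bond2 w x y : x != y -> bond w [set x; y] = spin R (w x) * spin R (w y).
Proof.
move=> xy; rewrite /bond fsbigU0; [by rewrite !fsbig_set1| | |]; try exact: finite_set1.
by move=> z [/= -> h]; rewrite h eqxx in xy.
Qed.

Lemma nb_neq x y : y \in nb x -> x != y.
Proof. by move=> yx; apply: contraTneq yx => ->; exact: nb_irr. Qed.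

Lemma hamiltonianE L w : hamiltonian R E L w = - \sum_(e <- fset_set (touching L)) bond w e.
Proof. by rewrite /hamiltonian fsbig_finite//; exact: finite_touching. Qed.

Lemma hamiltonian_eq L w w' : (forall v, v \in closure_nb nb L -> w v = w' v) ->
  hamiltonian R E L w = hamiltonian R E L w'.
Proof.
move=> ww'; rewrite !hamiltonianE; congr (- _); rewrite big_seq [RHS]big_seq.
apply: eq_bigr => e; rewrite in_fset_set; last exact: finite_touching.
rewrite inE => -[]; rewrite edgeE => -[x [y [-> yx]]] [v vL xyv].
have xy := nb_neq yx; rewrite !bond2// !ww' //.
- case: xyv => vE; rewrite vE in vL; apply/closure_nbP; last by left.
  by right; exists x.
- case: xyv => vE; rewrite vE in vL; apply/closure_nbP; first by left.
  by right; exists y; rewrite // nb_sym.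
Qed.

Lemma hamiltonian_local L F w w' : (L `<=` F)%fset -> (forall v, v \notin L -> w v = w' v) ->
  hamiltonian R E F w - hamiltonian R E F w' = hamiltonian R E L w - hamiltonian R E L w'.
Proof.
move=> LF ww'; rewrite !hamiltonianE -!opprD -!sumrB.
rewrite -(big_fset_incl _ (A := fset_set (touching L))) //.
  rewrite -fset_set_sub; try exact: finite_touching.
  by move=> e [Ee [v vL ev]]; split=> //; exists v => //; exact: (fsubsetP LF).
move=> e; rewrite !in_fset_set; try exact: finite_touching.
rewrite inE notin_setE => -[Ee _] h; suff -> : bond w e = bond w' e by rewrite subrr.
rewrite /bond; apply: eq_fsbigr => v; rewrite inE => ev; rewrite ww' //.
by apply/negP => vL; apply: h; split => //; exists v.
Qed.

Lemma spin_negb b : spin R (~~ b) = - spin R b.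
Proof. by case: b; rewrite /spin ?opprK. Qed.

Lemma hamiltonian_flip s L D : (D `<=` L)%fset ->
  hamiltonian R E L (flip s D) = hamiltonian R E L s + 2 * excess R nb s D.
Proof.
move=> DL; apply/eqP; rewrite addrC -subr_eq; apply/eqP; rewrite !hamiltonianE -opprD -sumrB.
(* The bonds that change sign, listed as pairs of inner and outer end so that each occurs once. *)
pose r := [seq (x, y) | x <- D, y <- (nb x `\` D)%fset].
pose phi (p : V * V) : set V := [set p.1; p.2].
have rP p : p \in r -> [/\ p.1 \in D, p.2 \in nb p.1 & p.2 \notin D].
  by move=> /allpairsPdep[x [y [xD]]]; rewrite inE => /andP[yD yx] ->.
have ur : uniq r.
  by apply: allpairs_uniq_dep => [|x _|[a b] [c d] _ _ /= [-> ->]]; rewrite ?fset_uniq.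
have phi_inj : {in r &, injective phi}.
  move=> [x y] [x' y'] /rP[/= xD yx yD] /rP[/= xD' yx' yD'] /seteqP[/= h1 h2].
  have [E1|E1] : x = x' \/ x = y' by apply: h1; left.
    have [E2|E2] : y = x' \/ y = y' by apply: h1; right.
      by rewrite E2 xD' in yD.
    by rewrite E1 E2.
  by rewrite -E1 xD in yD'.
rewrite -(big_fset_incl _ (A := [fset phi p | p in r]%fset)); last 2 first.
- apply/fsubsetP => e /imfsetP[/= p pr ->]; have [pD p1 p2] := rP _ pr.
  rewrite in_fset_set; last exact: finite_touching.
  rewrite inE; split; first by rewrite edgeE; exists p.1, p.2.
  by exists p.1; [exact: (fsubsetP DL)|left].
- move=> e; rewrite in_fset_set; last exact: finite_touching.
  rewrite inE => -[+ _]; rewrite edgeE => -[x [y [-> yx]]] /imfsetP nr.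
  have xy := nb_neq yx; rewrite !bond2// /flip.
  case xD: (x \in D); case yD: (y \in D).
  + by rewrite !addbT !spin_negb mulrNN subrr.
  + exfalso; apply: nr; exists (x, y) => //=.
    by apply/allpairsPdep; exists x, y; rewrite xD inE yD yx.
  + exfalso; apply: nr; exists (y, x) => /=; last by rewrite /phi/= setUC.
    by apply/allpairsPdep; exists y, x; rewrite yD inE xD nb_sym yx.
  + by rewrite !addbF subrr.
rewrite big_imfset //= undup_id// /excess mulr_sumr.
have -> : \sum_(i <- r) (bond (flip s D) (phi i) - bond s (phi i)) =
          \sum_(p <- r) - (2 * (spin R (s p.1) * spin R (s p.2))).
  rewrite big_seq [RHS]big_seq; apply: eq_bigr => p /rP[pD p1 p2].
  have xy := nb_neq p1; rewrite /phi !bond2// /flip pD (negbTE p2) addbT addbF spin_negb; ring.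
rewrite big_allpairs_dep /= -sumrN; apply: eq_bigr => x _; rewrite mulr_sumr -sumrN.
by apply: eq_bigr => y _ /=; rewrite opprK.
Qed.

End Hamiltonian.

Section Cylinders.
Local Open Scope fset_scope.
Local Open Scope classical_set_scope.
Local Open Scope ring_scope.
Variables (R : realType) (V : choiceType) (s : config V).
Implicit Types (A B C D F L S : {fset V}) (w : config V).

(** For [D] included in [F] these are the atoms of the window [F], labelled by the set of sites at
    which the configuration departs from [s]. *)
Definition cyl F D : set (config V) := [set w | forall v, v \in F -> w v = flip s D v].

Lemma measurable_coord (v : V) (b : bool) : measurable ([set w | w v = b] : set (config V)).
Proof. by apply: sub_sigma_algebra; exists v, b. Qed.

Lemma measurable_cyl F D : measurable (cyl F D).
Proof.
have -> : cyl F D = \bigcap_(v in [set` F]) [set w | w v = flip s D v].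
  by apply/seteqP; split => w /= h v; exact: h.
apply: fin_bigcap_measurable => // v _; exact: measurable_coord.
Qed.

Lemma cyl_eq F D D' : (D `&` F = D' `&` F)%fset -> cyl F D = cyl F D'.
Proof.
move=> DD'; have h v : v \in F -> flip s D v = flip s D' v.
  by move=> vF; move/fsetP: DD' => /(_ v); rewrite !in_fsetI vF !andbT /flip => ->.
by apply/seteqP; split => w h1 v vF; rewrite h1// h.
Qed.

Lemma cyl_inj F D D' w : (D `<=` F)%fset -> (D' `<=` F)%fset ->
  cyl F D w -> cyl F D' w -> D = D'.
Proof.
move=> DF DF' h h'; apply/fsetP => v; case vF: (v \in F).
  by move: (h v vF); rewrite h'// /flip; case: (s v); case: (v \in D); case: (v \in D').
by apply/idP/idP => [/(fsubsetP DF)|/(fsubsetP DF')]; rewrite vF.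
Qed.

Lemma cyl_exists F w : exists2 D, (D `<=` F)%fset & cyl F D w.
Proof.
exists [fset v in F | w v != s v]%fset; first by apply/fsubsetP => v; rewrite !inE => /andP[].
by move=> v vF; rewrite /flip !inE vF /=; case: (w v); case: (s v).
Qed.

Lemma cyl_marginal (m : probability (config V) R) B F b :
  (B `<=` F)%fset -> (b `<=` B)%fset ->
  m (cyl B b) = (\sum_(D <- fpowerset F | (D `&` B == b)%fset) m (cyl F D))%E.
Proof.
move=> BF bB; rewrite big_fset_condE /= -measure_fbigsetU; last 2 first.
- by move=> *; exact: measurable_cyl.
- move=> D D' /=; rewrite !inE !fpowersetE => /andP[DF _] /andP[DF' _] [w [h h']].
  exact: cyl_inj h h'.
congr (m _); rewrite -bigcup_fset; apply/seteqP; split => w.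
  move=> h; have [D DF wD] := cyl_exists F w; exists D => //=.
  rewrite !inE fpowersetE DF /=; apply/eqP.
  apply: (@cyl_inj B _ _ w) => //; first exact: fsubsetIr.
  move=> v vB; rewrite wD ?(fsubsetP BF)// /flip in_fsetI vB andbT //.
move=> [D /=]; rewrite !inE => /andP[DF /eqP Db] wD v vB.
by rewrite wD ?(fsubsetP BF)// /flip -Db in_fsetI vB andbT.
Qed.

Lemma cyl0 : cyl fset0 fset0 = setT.
Proof. by apply/seteqP; split. Qed.

Lemma cyl_sum1 (m : probability (config V) R) F :
  (\sum_(D <- fpowerset F) m (cyl F D) = 1)%E.
Proof.
rewrite -(probability_setT m) -cyl0 (cyl_marginal m (fsub0set F) (fsub0set _)).
by apply: eq_bigl => D; rewrite fsetI0 eqxx.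
Qed.

End Cylinders.

Section FiniteGibbs.
Local Open Scope fset_scope.
Local Open Scope classical_set_scope.
Local Open Scope ring_scope.
Variables (R : realType) (V : choiceType) (nb : V -> {fset V}).
Hypothesis nb_sym : forall x y, (y \in nb x) = (x \in nb y).
Hypothesis nb_irr : forall x, x \notin nb x.
Variable E : set (set V).
Hypothesis edgeE : E = [set e | exists x y, e = [set x; y] /\ y \in nb x].
Variables (s : config V) (beta : R).
Implicit Types (A B C D F L S : {fset V}) (w : config V).
Local Notation W := (weight nb s beta).

Definition patch_conf L w A : config V := fun v => if v \in L then flip s A v else w v.

Lemma sum_bc_configs (U : Type) (idx : U) (op : Monoid.com_law idx) L w (f : config V -> U) :
  \big[op/idx]_(x \in bc_configs L w) f x =
  \big[op/idx]_(A <- fpowerset L) f (patch_conf L w A).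
Proof.
have -> : bc_configs L w = patch_conf L w @` [set` fpowerset L].
  apply/seteqP; split => x.
    move=> h; have [D DL xD] := cyl_exists s L x.
    exists D => /=; first by rewrite fpowersetE.
    apply/funext => v; rewrite /patch_conf; case: ifPn => vL; first by rewrite xD.
    by rewrite h.
  by move=> [D _ <-] v vL; rewrite /patch_conf (negbTE vL).
rewrite fsbig_image; first by rewrite -fsbig_seq ?fset_uniq.
move=> D D'; rewrite !in_setE /= !fpowersetE => DL DL' h.
apply: (@cyl_inj _ s L _ _ (patch_conf L w D)) => //.
  by move=> v vL; rewrite /patch_conf vL.
by move=> v vL; rewrite h /patch_conf vL.
Qed.

(** The exponential in front depends on the boundary data only and cancels against the partition
    function. *)
Lemma boltzmann_patch L F w D A : (closure_nb nb L `<=` F)%fset -> (D `<=` F)%fset ->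
  cyl s (F `\` L)%fset D w -> (A `<=` L)%fset ->
  boltzmann E beta L (patch_conf L w A) =
  expR (- beta * (hamiltonian R E L (flip s D) - 2 * excess R nb s D)) *
   W ((D `\` L) `|` A)%fset.
Proof.
move=> LF DF wD AL; set D' := (_ `|` A)%fset.
have LF' : (L `<=` F)%fset by exact: fsubset_trans (sub_closure_nb _ _) LF.
have DF' : (D' `<=` F)%fset.
  by rewrite fsubUset (fsubset_trans AL LF') (fsubset_trans (fsubsetDl _ _) DF).
rewrite /boltzmann /weight -expRD.
rewrite (@hamiltonian_eq R V nb nb_sym nb_irr E edgeE L _ (flip s D')); last first.
  move=> v vL; rewrite /patch_conf /D' /flip; case: ifPn => vL'.
    by rewrite in_fsetU in_fsetD vL'.
  rewrite wD ?in_fsetD ?vL' ?(fsubsetP LF)//= /flip in_fsetU in_fsetD vL' /=.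
  case vA: (v \in A); last by rewrite orbF.
  by rewrite (fsubsetP AL _ vA) in vL'.
have := @hamiltonian_local R V nb nb_sym E edgeE L F (flip s D') (flip s D) LF'.
rewrite (hamiltonian_flip R nb_sym nb_irr edgeE s DF').
rewrite (hamiltonian_flip R nb_sym nb_irr edgeE s DF) => h.
congr (expR _); have /h {h}h : forall v, v \notin L -> flip s D' v = flip s D v.
  move=> v vL; rewrite /flip /D' in_fsetU in_fsetD vL /=.
  case vA: (v \in A); last by rewrite orbF.
  by rewrite (fsubsetP AL _ vA) in vL.
have -> : hamiltonian R E L (flip s D') =
  2 * excess R nb s D' - 2 * excess R nb s D + hamiltonian R E L (flip s D) by lra.
ring.
Qed.

(** The conditional probability, inside [L], of the trace of [D] given its part outside [L]. *)
Definition gibbs_ratio L D : R :=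
  W D / \sum_(A <- fpowerset L) W ((D `\` L) `|` A)%fset.

Lemma gibbs_ratio_ge0 L D : 0 <= gibbs_ratio L D.
Proof. by rewrite divr_ge0 ?expR_ge0// sumr_ge0// => A _; exact: expR_ge0. Qed.

Lemma finite_gibbs_cyl L F w D : (closure_nb nb L `<=` F)%fset -> (D `<=` F)%fset ->
  finite_gibbs E beta L w (cyl s F D) =
  (\1_(cyl s (F `\` L)%fset D) w * gibbs_ratio L D)%:E.
Proof.
move=> LF DF; rewrite /finite_gibbs /partition_function !sum_bc_configs.
rewrite indicE; case: (boolP (w \in _)) => [|wD]; last first.
  rewrite mul0r big1// => A _; rewrite diracE memNset ?mule0//.
  move=> h; move/negP: wD; apply; rewrite inE => v.
  rewrite in_fsetD => /andP[vL vF]; rewrite -(h v vF) /patch_conf; by rewrite (negbTE vL).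
rewrite inE => wD.
have LF' : (L `<=` F)%fset by exact: fsubset_trans (sub_closure_nb _ _) LF.
rewrite (big_fsetD1 (D `&` L)%fset) /=; last by rewrite fpowersetE fsubsetIr.
rewrite [X in (_ + X)%E]big_seq [X in (_ + X)%E]big1 ?adde0; last first.
  move=> A; rewrite in_fsetD1 fpowersetE => /andP[AD AL].
  rewrite diracE memNset ?mule0// => h; move/eqP: AD; apply.
  apply: (@cyl_inj _ s L _ _ (patch_conf L w A)) => //; first exact: fsubsetIr.
    by move=> v vL; rewrite /patch_conf vL.
  move=> v vL; rewrite (h v (fsubsetP LF' _ vL)) /flip in_fsetI vL andbT //.
rewrite diracE mem_set ?mule1; last first.
  move=> v vF; rewrite /patch_conf; case: ifPn => vL.
    by rewrite /flip in_fsetI vL andbT.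
  by rewrite wD// in_fsetD vL.
congr (_%:E); rewrite mul1r (boltzmann_patch LF DF wD (fsubsetIr _ _)).
have -> : (D `\` L `|` D `&` L = D)%fset by rewrite fsetUC fsetID.
rewrite (_ : \sum_(A <- fpowerset L) boltzmann E beta L (patch_conf L w A) =
   \sum_(A <- fpowerset L) expR (- beta * (hamiltonian R E L (flip s D) - 2 * excess R nb s D)) *
   W ((D `\` L) `|` A)%fset); last first.
  rewrite big_seq [RHS]big_seq; apply: eq_bigr => A; rewrite fpowersetE => AL.
  exact: (boltzmann_patch LF DF wD AL).
by rewrite -mulr_sumr /gibbs_ratio -mulf_div divff ?mul1r// gt_eqF// expR_gt0.
Qed.

Lemma finite_gibbs_self L F D : (closure_nb nb L `<=` F)%fset -> (D `<=` F)%fset ->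
  finite_gibbs E beta L s (cyl s F D) =
  (if (D `<=` L)%fset then W D / mass nb s beta L else 0)%:E.
Proof.
move=> LF DF; rewrite (finite_gibbs_cyl _ LF DF) indicE; case: ifPn => DL.
  rewrite mem_set; last first.
    move=> v; rewrite in_fsetD => /andP[vL _]; rewrite /flip.
    by case vD: (v \in D); [rewrite (fsubsetP DL _ vD) in vL|rewrite addbF].
  rewrite mul1r /gibbs_ratio /mass; congr (_ / _)%:E.
  have -> : (D `\` L = fset0)%fset by apply/eqP; rewrite fsetD_eq0.
  by apply: eq_bigr => A _; rewrite fset0U.
rewrite memNset ?mul0r// => h; move/negP: DL; apply; apply/fsubsetP => v vD.
apply/negPn/negP => vL; have := h v; rewrite in_fsetD vL (fsubsetP DF)// /flip vD addbT.
by move=> /(_ isT); case: (s v).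
Qed.

End FiniteGibbs.

Section Laws.
Local Open Scope fset_scope.
Local Open Scope classical_set_scope.
Local Open Scope ring_scope.
Variables (R : realType) (V : choiceType) (nb : V -> {fset V}).
Hypothesis nb_sym : forall x y, (y \in nb x) = (x \in nb y).
Hypothesis nb_irr : forall x, x \notin nb x.
Variable E : set (set V).
Hypothesis edgeE : E = [set e | exists x y, e = [set x; y] /\ y \in nb x].
Variables (s : config V) (beta : R) (q : nat).
Hypothesis nb_le : forall x, (#|` nb x| <= q)%N.
Implicit Types (A B C D F L S : {fset V}) (w : config V).
Implicit Types m : probability (config V) R.
Local Notation W := (weight nb s beta).
Local Notation ratio := (gibbs_ratio nb s beta).
Local Notation P L := (finite_gibbs E beta L s).

Definition pcyl m F D : R := fine (m (cyl s F D)).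

Lemma pcylE m F D : (pcyl m F D)%:E = m (cyl s F D).
Proof. by rewrite /pcyl fineK// fin_num_measure//; exact: measurable_cyl. Qed.

Lemma pcyl_ge0 m F D : 0 <= pcyl m F D.
Proof. by rewrite /pcyl fine_ge0. Qed.

Lemma pcyl_marginal m B F b : (B `<=` F)%fset -> (b `<=` B)%fset ->
  pcyl m B b = \sum_(D <- fpowerset F | (D `&` B == b)%fset) pcyl m F D.
Proof.
move=> BF bB; apply: EFin_inj; rewrite pcylE (cyl_marginal s m BF bB) -sumEFin.
by apply: eq_bigr => D _; rewrite pcylE.
Qed.

(** The DLR equation tested on cylinders. It involves no integral, only finitely many cylinder
    probabilities, and so passes to limits. *)
Definition dlr m L : Prop := forall F D, (closure_nb nb L `<=` F)%fset ->
  (D `<=` F)%fset -> pcyl m F D = ratio L D * pcyl m (F `\` L)%fset D.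

(** [cyl s S S] is the event that every site of [S] is flipped. *)
Definition peierls_bound m (K : R) : Prop :=
  forall S, pcyl m S S <= K * (2^-1 ^+ q.+3) ^+ #|` S|.

Lemma droplet_law_dlr m F L K : (closure_nb nb L `<=` F)%fset -> dlr m L ->
  peierls_bound m K -> droplet_law nb s q beta F L K (pcyl m F).
Proof.
move=> LF hm hp; split.
- by move=> D; exact: pcyl_ge0.
- apply: EFin_inj; rewrite -sumEFin -(cyl_sum1 s m F).
  by apply: eq_bigr => D _; rewrite pcylE.
- move=> D D' DF DF' DD'; rewrite (hm F D)// (hm F D')// /gibbs_ratio DD'.
  have -> : pcyl m (F `\` L)%fset D = pcyl m (F `\` L)%fset D'.
    rewrite /pcyl (@cyl_eq _ _ _ _ D') //; apply/fsetP => v.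
    move/fsetP: DD' => /(_ v); rewrite !(in_fsetI, in_fsetD).
    by case: (v \in L) => //=; rewrite ?andbF//= => ->.
  ring.
- move=> S SF; apply: le_trans (hp S); rewrite (pcyl_marginal m SF (fsubset_refl _)).
  rewrite le_eqVlt; apply/orP; left; apply/eqP; apply: eq_bigl => D.
  by apply/idP/eqP => [/fsetIidPr//|/fsetIidPr].
Qed.

Lemma swap_le_abs m1 m2 K n B b : 0 <= K -> (b `<=` B)%fset ->
  dlr m1 (nball nb n B) -> dlr m2 (nball nb n B) ->
  peierls_bound m1 K -> peierls_bound m2 K ->
  `|pcyl m1 B b - pcyl m2 B b| <= K ^+ 2 * (2 ^+ q.+2) ^+ #|` B| * 2^-1 ^+ n.
Proof.
move=> K0 bB d1 d2 p1 p2; pose F := closure_nb nb (nball nb n B).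
have BF : (B `<=` F)%fset := fsubset_trans (nball_sub nb n B) (sub_closure_nb _ _).
have H1 := droplet_law_dlr (fsubset_refl F) d1 p1.
have H2 := droplet_law_dlr (fsubset_refl F) d2 p2.
rewrite !(pcyl_marginal _ BF bB) ler_norml.
have := swap_le nb_sym nb_le BF (fsubset_refl _) K0 H1 H2 b.
have := swap_le nb_sym nb_le BF (fsubset_refl _) K0 H2 H1 b.
by move=> h1 h2; apply/andP; split; lra.
Qed.

Lemma finite_gibbs_eq L w (X Y : set (config V)) :
  (forall x, bc_configs L w x -> X x <-> Y x) ->
  finite_gibbs E beta L w X = finite_gibbs E beta L w Y.
Proof.
move=> XY; apply: eq_fsbigr => x; rewrite inE => /XY h; congr (_ * _)%E.
rewrite !diracE; congr (_%:R%:E); congr nat_of_bool; apply/idP/idP; rewrite !inE; tauto.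
Qed.

(** Both sides are the same finite volume probability, with boundary condition [flip s D'], read in
    the windows [F] and [G]: outside [L] the spins are fixed, so the two cylinders coincide. *)
Lemma gibbs_ratio_local L F G D D' : (closure_nb nb L `<=` F)%fset -> (F `<=` G)%fset ->
  (D `<=` F)%fset -> (D' `<=` G)%fset -> (D' `&` F = D)%fset -> ratio L D' = ratio L D.
Proof.
move=> LF FG DF DG DD'.
have LG := fsubset_trans LF FG.
have inF v : v \in F -> flip s D' v = flip s D v.
  by move=> vF; rewrite /flip -DD' in_fsetI vF andbT.
have := finite_gibbs_cyl nb_sym nb_irr edgeE s beta (flip s D') LF DF.
rewrite (finite_gibbs_eq (Y := cyl s G D')); last first.
  move=> x xL; split => h v vG; last first.
    by rewrite h ?(fsubsetP FG)// inF.
  case: (boolP (v \in L)) => vL; last by rewrite xL.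
  have vF : v \in F by apply: (fsubsetP LF); exact: (fsubsetP (sub_closure_nb _ _)).
  by rewrite h// inF.
rewrite (finite_gibbs_cyl nb_sym nb_irr edgeE s beta _ LG DG) !indicE !mem_set //.
  by rewrite !mul1r => -[].
by move=> v; rewrite in_fsetD => /andP[_ vF]; rewrite inF.
Qed.

Lemma pcyl_self L F D : (closure_nb nb L `<=` F)%fset -> (D `<=` F)%fset ->
  pcyl (P L) F D = if (D `<=` L)%fset then W D / mass nb s beta L else 0.
Proof. by move=> LF DF; rewrite /pcyl /= (finite_gibbs_self nb_sym nb_irr edgeE s beta LF DF). Qed.

(** In a window containing the closed neighbourhood of [L'] the probabilities are explicit and the
    equation is a cancellation; a smaller window follows by summing over the remaining sites, on
    which the ratio does not depend. *)
Lemma dlr_self L L' : (L `<=` L')%fset -> dlr (P L') L.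
Proof.
move=> LL F D LF DF; pose G := (F `|` closure_nb nb L')%fset.
have FG : (F `<=` G)%fset by exact: fsubsetUl.
have LG : (closure_nb nb L' `<=` G)%fset by exact: fsubsetUr.
have subLF : (L `<=` F)%fset := fsubset_trans (sub_closure_nb _ _) LF.
have subLG := fsubset_trans subLF FG.
have step D' : (D' `<=` G)%fset ->
    pcyl (P L') G D' = ratio L D' * pcyl (P L') (G `\` L)%fset D'.
  move=> DG.
  have -> : pcyl (P L') (G `\` L)%fset D' = pcyl (P L') (G `\` L)%fset (D' `\` L)%fset.
    rewrite /pcyl (@cyl_eq _ _ _ _ (D' `\` L)%fset) //; apply/fsetP => v.
    by rewrite !(in_fsetI, in_fsetD); case: (v \in L); rewrite ?andbF ?andbT.
  rewrite (pcyl_marginal _ (fsubsetDl G L) (fsetSD L DG)) sum_trace; last 2 first.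
  - exact: fsubset_trans (fsubsetDl _ _) DG.
  - exact: fsetSD.
  have -> : (G `\` (G `\` L) = L)%fset by rewrite fsetDK.
  have sub A : (A `<=` L)%fset -> (D' `\` L `|` A `<=` G)%fset.
    by move=> AL; rewrite fsubUset (fsubset_trans (fsubsetDl _ _) DG) (fsubset_trans AL subLG).
  have eqsub A : (A `<=` L)%fset -> (D' `\` L `|` A `<=` L')%fset = (D' `<=` L')%fset.
    move=> AL; rewrite fsubUset (fsubset_trans AL LL) andbT.
    apply/idP/idP => [/fsubsetP h|/(fsubset_trans (fsubsetDl _ _))//].
    apply/fsubsetP => v vD; case vL: (v \in L); first exact: (fsubsetP LL).
    by apply: h; rewrite in_fsetD vL.
  rewrite pcyl_self//; under eq_big_seq => A.
    rewrite fpowersetE => AL; rewrite pcyl_self ?sub// eqsub//; over.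
  case: ifP => DL; last by rewrite big1// mulr0.
  rewrite -mulr_suml /gibbs_ratio mulrA divfK// gt_eqF//.
  rewrite (big_fsetD1 fset0) /=; last by rewrite fpowersetE fsub0set.
  by rewrite ltr_pwDl ?weight_gt0// sumr_ge0// => A _; exact/ltW/weight_gt0.
rewrite (pcyl_marginal _ FG DF) sum_trace//; last exact: fsubset_trans DF FG.
have -> : pcyl (P L') (F `\` L)%fset D = pcyl (P L') (F `\` L)%fset (D `\` L)%fset.
  rewrite /pcyl (@cyl_eq _ _ _ _ (D `\` L)%fset) //; apply/fsetP => v.
  by rewrite !(in_fsetI, in_fsetD); case: (v \in L); rewrite ?andbF ?andbT.
rewrite (pcyl_marginal _ (fsetSD L FG) (fsetSD L DF)) sum_trace; last 2 first.
- by apply: fsubset_trans (fsetSD L FG); exact: fsetSD.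
- exact: fsetSD.
have -> : ((G `\` L) `\` (F `\` L) = G `\` F)%fset.
  apply/fsetP => v; rewrite !in_fsetD negb_and negbK.
  by case vL: (v \in L) => //=; rewrite (fsubsetP subLF).
rewrite mulr_sumr big_seq [RHS]big_seq; apply: eq_bigr => A; rewrite fpowersetE => AG.
have DAG : (D `|` A `<=` G)%fset.
  by rewrite fsubUset (fsubset_trans DF FG) (fsubset_trans AG (fsubsetDl _ _)).
rewrite step// (@gibbs_ratio_local L F G D)//.
  congr (_ * _); rewrite /pcyl (@cyl_eq _ _ _ _ (D `\` L `|` A)%fset) //; apply/fsetP => v.
  by rewrite !(in_fsetI, in_fsetU, in_fsetD); case: (v \in L); rewrite ?andbF ?andbT.
apply/fsetP => v; rewrite in_fsetI in_fsetU; case vD: (v \in D); first by rewrite (fsubsetP DF).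
by apply/andP => -[/= /(fsubsetP AG)]; rewrite in_fsetD => /andP[/negbTE ->].
Qed.

Lemma dlr_gibbs m L : gibbs_measures E beta m -> dlr m L.
Proof.
move=> hm F D LF DF; apply: EFin_inj; rewrite pcylE (hm L (cyl s F D)); last exact: measurable_cyl.
under eq_integral do rewrite (finite_gibbs_cyl nb_sym nb_irr edgeE s beta _ LF DF) mulrC EFinM.
rewrite ge0_integralZl ?lee_fin ?gibbs_ratio_ge0//; last first.
  by apply/measurable_EFinP; apply: measurable_indic; exact: measurable_cyl.
rewrite integral_indic//; last exact: measurable_cyl.
by rewrite setIT (EFinM (ratio L D)) pcylE.
Qed.

Hypothesis iso : forall D, #|` D|%:R <= excess R nb s D.
Hypothesis cold : expR (- (2 * beta)) <= 2^-1 ^+ (q.+1 + q.+3).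
Hypothesis beta_ge0 : 0 <= beta.

Lemma peierls_self L : peierls_bound (P L) 1.
Proof.
move=> S; rewrite mul1r; pose F := (S `|` closure_nb nb L)%fset.
have SF : (S `<=` F)%fset by exact: fsubsetUl.
have LF : (closure_nb nb L `<=` F)%fset by exact: fsubsetUr.
rewrite (pcyl_marginal _ SF (fsubset_refl _)) /=.
have -> : \sum_(D <- fpowerset F | (D `&` S == S)%fset) pcyl (P L) F D =
   (\sum_(D <- fpowerset L | (S `<=` D)%fset) W D) / mass nb s beta L.
  rewrite mulr_suml big_fset_condE [RHS]big_fset_condE /=; apply/esym.
  have LF' : (L `<=` F)%fset := fsubset_trans (sub_closure_nb nb L) LF.
  transitivity (\sum_(D <- [fset D in fpowerset L | (S `<=` D)%fset]%fset) pcyl (P L) F D).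
    rewrite big_seq [RHS]big_seq; apply: eq_bigr => D.
    rewrite !inE fpowersetE => /andP[DL _].
    by rewrite pcyl_self ?DL// (fsubset_trans DL).
  apply: big_fset_incl.
    apply/fsubsetP => D; rewrite !inE !fpowersetE => /andP[DL SD].
    by rewrite (fsubset_trans DL)//=; apply/eqP/fsetIidPr.
  move=> D; rewrite !inE !fpowersetE => /andP[DF /eqP/fsetIidPr SD]; rewrite SD andbT => DL.
  by rewrite pcyl_self// (negbTE DL).
rewrite ler_pdivrMr ?mass_gt0//.
exact: (peierls nb_sym nb_le iso cold beta_ge0).
Qed.

End Laws.

(** * Kolmogorov extension by coding spins in a uniform random number *)

Section Coding.
Local Open Scope classical_set_scope.
Local Open Scope ring_scope.
Variables (R : realType) (M : seq bool -> R).
Hypothesis M_ge0 : forall t, 0 <= M t.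
Hypothesis M_nil : M [::] = 1.
Hypothesis M_rcons : forall t, M t = M (rcons t false) + M (rcons t true).

Lemma uniform01E (A : set R) : measurable A ->
  uniform_prob (@ltr01 R) A = lebesgue_measure (A `&` `[0, 1[).
Proof.
move=> mA; rewrite /uniform_prob integral_uniform_pdf.
have mI : measurable (A `&` `[0%R, 1%R]) by exact: measurableI.
have -> : (\int[lebesgue_measure]_(x in A `&` `[0%R, 1%R]) (uniform_pdf 0 1 x)%:E =
    lebesgue_measure (A `&` `[0%R, 1%R]))%E.
  rewrite -[RHS]mul1e -integral_cst//; apply: eq_integral => x.
  rewrite inE => -[_ /=]; rewrite in_itv /= => x01.
  by rewrite /uniform_pdf x01 subr0 invr1.
apply/eqP; rewrite eq_le; apply/andP; split; last first.
  apply: le_measure; rewrite ?inE//; first exact: measurableI.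
  by move=> x [Ax]; rewrite /= !in_itv /= => /andP[x0 /ltW x1]; rewrite x0.
have -> : lebesgue_measure (A `&` `[0, 1[) =
    (lebesgue_measure (A `&` `[0%R, 1%R[) + lebesgue_measure [set 1%R : R])%E.
  by rewrite lebesgue_measure_set1 adde0.
apply: le_trans (measureU2 _ _ _); [|exact: measurableI|by []].
apply: le_measure; rewrite ?inE//.
  by apply: measurableU => //; exact: measurableI.
move=> x [Ax]; rewrite /= !in_itv /= => /andP[x0]; rewrite le_eqVlt => /predU1P[->|x1].
  by right.
by left; rewrite x0.
Qed.

(* Subdivides [0, 1[ dyadically into intervals of length [M t]: the state is the
   address of the current interval and its left end. *)
Fixpoint address (n : nat) (u : R) : seq bool * R :=
  if n is n'.+1 then
    let: (t, l) := address n' u in let c := l + M (rcons t false) in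
    if u < c then (rcons t false, l) else (rcons t true, c)
  else ([::], 0).

Lemma size_address n u : size (address n u).1 = n.
Proof.
by elim: n => //= n; case: (address n u) => t l /= <-; case: ifP; rewrite size_rcons.
Qed.

Lemma nth_address n k u i : (i < n)%N ->
  nth false (address (n + k) u).1 i = nth false (address n u).1 i.
Proof.
move=> ni; elim: k => [|k IH]; first by rewrite addn0.
rewrite addnS /=; have := size_address (n + k) u.
case: (address (n + k) u) IH => t l /= IH sz.
by case: ifP; rewrite /= nth_rcons sz (leq_trans ni (leq_addr _ _)).
Qed.

(** The left end is a function of the address alone, which is what the induction on the last bit
    requires; the intervals are half-open so that the two children partition their parent. *)
Lemma address_interval t : exists l : R,
  [/\ 0 <= l, l + M t <= 1,
      forall u, (address (size t) u).1 = t -> (address (size t) u).2 = l,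
      forall u, 0 <= u < 1 -> ((address (size t) u).1 = t <-> l <= u < l + M t) &
      measurable [set u | (address (size t) u).1 = t]].
Proof.
elim/last_ind: t => [|t b [l [l0 l1 H1 H2 H3]]].
  exists 0; rewrite M_nil add0r; split=> //.
  by rewrite (_ : [set u | _] = setT)//; apply/seteqP; split.
rewrite size_rcons; have Mt := M_rcons t.
have M0 := M_ge0 (rcons t false); have M1 := M_ge0 (rcons t true).
pose c := l + M (rcons t false).
have key u : (address (size t).+1 u).1 = rcons t b <->
    (address (size t) u).1 = t /\ (u < c) = ~~ b.
  rewrite /=; have := H1 u; case: (address (size t) u) => t' l' /= H.
  split.
    by case: ifP => h /= /rcons_inj[tt' <-]; move: h; rewrite tt' H//.
  by move=> [tt']; rewrite tt' H// -/c => ->; case: (b).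
exists (if b then c else l); split.
- by case: b {key}; rewrite ?addr_ge0.
- by rewrite /c; case: b {key}; lra.
- move=> u /key[tE cb]; move: (H1 u tE) cb => /=; move: tE.
  case: (address (size t) u) => t' l' /= -> ->; rewrite -/c => ->.
  by case: b {key}.
- move=> u u01; rewrite key H2// /c; case: b {key}; split.
  + by move=> [/andP[a1 a2]] /negbT; rewrite -leNgt => a3; apply/andP; split; lra.
  + by move=> /andP[a1 a2]; split; [apply/andP; split; lra|apply/negbTE; rewrite -leNgt].
  + by move=> [/andP[a1 a2]] a3; apply/andP.
  + by move=> /andP[a1 a2]; split => //; apply/andP; split; lra.
- rewrite (_ : [set u | _] =
      [set u | (address (size t) u).1 = t] `&` [set u | (u < c) = ~~ b]); last first.
    by apply/seteqP; split => u /key.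
  apply: measurableI => //; case: (b) => /=.
    rewrite (_ : [set u | _] = `[c, +oo[%classic)//.
    apply/seteqP; split => u /=; rewrite in_itv /= andbT; first by move=> /negbT; rewrite -leNgt.
    by move=> h; apply/negbTE; rewrite -leNgt.
  by rewrite (_ : [set u | _] = `]-oo, c[%classic)//; apply/seteqP; split => u /=; rewrite in_itv.
Qed.

Lemma uniform_address t :
  uniform_prob (@ltr01 R) [set u | (address (size t) u).1 = t] = (M t)%:E.
Proof.
have [l [l0 l1 _ H2 H3]] := address_interval t.
rewrite uniform01E// (_ : _ `&` _ = `[l, l + M t[%classic); last first.
  apply/seteqP; split => u /=; rewrite !in_itv /=.
    by move=> [h u01]; apply/H2.
  move=> h; have u01 : 0 <= u < 1 by move/andP: h => [? ?]; apply/andP; split; lra.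
  by split => //; apply/H2.
rewrite lebesgue_measure_itv /= lte_fin; case: ltP => h.
  by rewrite -EFinB addrAC subrr add0r.
by congr (_%:E); have := M_ge0 t; lra.
Qed.

Variables (V : choiceType) (e : nat -> V) (h : V -> nat).
Hypothesis eK : cancel e h.

Let X (u : R) : config V := fun v => nth false (address (h v).+1 u).1 (h v).

(** The spin at [e i] is the [i]-th bit of the address of a uniform point of the unit interval, and
    the measure is the law of the resulting configuration. *)
Lemma kolmogorov_extension : exists m : probability (config V) R, forall t : seq bool,
  m [set w | forall i, (i < size t)%N -> w (e i) = nth false t i] = (M t)%:E.
Proof.
have XE u i n : (i < n)%N -> X u (e i) = nth false (address n u).1 i.
  by move=> ni; rewrite /X eK -(subnKC ni) nth_address.
have mZ t : measurable [set u | (address (size t) u).1 = t].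
  by have [l [_ _ _ _]] := address_interval t.
have mX : @measurable_fun _ _ (measurableTypeR R) (config V) setT X.
  apply: (@measurability _ _ _ (config V) setT X (@cylinders V)) => //.
  move=> _ [_ [v [b ->]] <-]; rewrite setTI.
  have -> : X @^-1` [set w | w v = b] =
     \bigcup_(t in [set t | size t = (h v).+1 /\ nth false t (h v) = b])
       [set u | (address (size t) u).1 = t].
    apply/seteqP; split => [u /= ub|u [t [szt tb] /=]].
      have sz := size_address (h v).+1 u.
      by exists (address (h v).+1 u).1; [split|rewrite /mkset sz].
    by rewrite szt /X => ->.
  rewrite bigcup_mkcond; apply: countable_bigcupT_measurable => //= t.
  by case: ifP.
pose X' : {mfun (measurableTypeR R) >-> config V} := HB.pack X (isMeasurableFun.Build _ _ (measurableTypeR R) (config V) X mX).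
exists (distribution (uniform_prob (@ltr01 R)) X' : probability _ _) => t.
rewrite -uniform_address; congr (uniform_prob _ _).
apply/seteqP; split => u /=.
  move=> H; apply: (@eq_from_nth _ false); rewrite size_address// => i it.
  by rewrite -H// -XE.
by move=> tE i it; rewrite (XE _ _ _ it) tE.
Qed.

End Coding.

(** * Finite windows: continuous functions, events and the Gibbs property *)

Section UniformContinuity.
Local Open Scope fset_scope.
Local Open Scope classical_set_scope.
Local Open Scope ring_scope.
Variables (R : realType) (V : choiceType).
Local Notation X := (prod_topology (fun _ : V => bool)).

(** The sets containing a finite-window cylinder around [w] form a filter that converges to [w] in
    every coordinate, hence in the product topology. *)
Lemma nbhs_window (w : X) (U : set X) : nbhs w U ->
  exists F : {fset V}, forall w' : X, (forall v, v \in F -> w' v = w v) -> U w'.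
Proof.
pose Fl : set_system X := [set A | exists F : {fset V},
  forall w' : X, (forall v, v \in F -> w' v = w v) -> A w'].
have FF : Filter Fl.
  split; first by exists fset0.
    move=> A B [F hA] [G hB]; exists (F `|` G)%fset => w' h; split.
      by apply: hA => v vF; apply: h; rewrite in_fsetU vF.
    by apply: hB => v vF; apply: h; rewrite in_fsetU vF orbT.
  by move=> A B AB [F hA]; exists F => w' /hA/AB.
suff : Fl --> w by apply.
apply/cvg_sup => v; apply/cvg_image.
  apply/seteqP; split => // b _; exists (fun v' => if v' == v then b else w v') => /=; rewrite ?eqxx.
move=> A nA; have Aw : A (w v) by apply: nbhs_singleton nA.
exists [set g : X | A (g v)]; first by exists [fset v]%fset => g h; rewrite /= h ?inE.
apply/seteqP; split => [b [g Ag <-]//|b Ab].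
by exists (fun v' => if v' == v then b else w v'); rewrite /= eqxx.
Qed.

Lemma nbhs_cyl (w : X) (F : {fset V}) :
  nbhs w [set w' : X | forall v, v \in F -> w' v = w v].
Proof.
have : nbhs w (\bigcap_(v in [set` F]) [set w' : X | w' v = w v]).
  apply: filter_bigI => v _.
  have := @proj_continuous V (fun _ => bool) v w [set b | b = w v]; apply.
  by rewrite nbhs_principalE; apply/principal_filterP.
by apply: filterS => w' h v vF; exact: h.
Qed.

(** The configuration space is compact by Tychonoff's theorem, so the window that serves near each
    point can be chosen uniformly. *)
Lemma uniform_window (f : X -> R) (L : nat -> {fset V}) : continuous f -> exhaustion L ->
  forall eps, 0 < eps -> exists N, forall n w w', (N <= n)%N ->
    (forall v, v \in L n -> w v = w' v) -> `|f w - f w'| <= eps.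
Proof.
Proof.
move=> fc Lex eps eps0.
have Lmono m n : (m <= n)%N -> (L m `<=` L n)%fset.
  move=> /subnK <-; elim: (n - m)%N => [|k IH]; first exact: fsubset_refl.
  by apply: fsubset_trans IH _; have [h _] := Lex; exact: h.
have Lin (F : {fset V}) : exists N, (F `<=` L N)%fset.
  elim/finSet_rect: F => F IH; have [->|/fset0Pn[v vF]] := eqVneq F fset0.
    by exists 0%N; exact: fsub0set.
  have [N1 h1] := IH _ (fproperD1 vF); have [N2 h2] := Lex.2 v.
  exists (maxn N1 N2); apply/fsubsetP => x xF; have [->|xv] := eqVneq x v.
    by apply: (fsubsetP (Lmono _ _ (leq_maxr _ _))).
  by apply: (fsubsetP (Lmono _ _ (leq_maxl _ _))); apply: (fsubsetP h1); rewrite !inE xv.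
have cT : compact [set: X].
  have := @tychonoff V (fun _ => bool) (fun _ => setT) (fun _ => bool_compact).
  by congr compact; apply/seteqP; split.
have := (compact_near_coveringP _).1 cT nat (@nbhs _ _ \oo)
  (fun n w => forall w' : X, (forall v, v \in L n -> w v = w' v) -> `|f w - f w'| <= eps).
case=> // [w _|N _ h]; last by exists N => n w w' Nn; exact: h.
have : nbhs w [set w' | `|f w - f w'| < eps / 2].
  have := fc w; move/cvgrPdist_lt; apply; exact: divr_gt0.
move=> /nbhs_window[F hF]; have [N hN] := Lin F.
exists ([set w' : X | forall v, v \in F -> w' v = w v], [set n | (N <= n)%N]).
  by split; [exact: nbhs_cyl|exists N].
move=> [w1 n] [/= h1 Nn] w2 h2.
have a1 : `|f w - f w1| < eps / 2 by exact: hF.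
have a2 : `|f w - f w2| < eps / 2.
  apply: hF => v vF; rewrite -h2 ?h1//.
  by apply: (fsubsetP (Lmono _ _ Nn)); exact: (fsubsetP hN).
have -> : f w1 - f w2 = (f w - f w2) - (f w - f w1) by ring.
apply: le_trans (ler_normB _ _) _; lra.
Qed.
End UniformContinuity.

Section WindowSets.
Local Open Scope fset_scope.
Local Open Scope classical_set_scope.
Local Open Scope ring_scope.
Variables (R : realType) (V : choiceType) (s : config V).
Implicit Types (A B : set (config V)) (F : {fset V}).

Definition window F A : Prop :=
  forall w w' : config V, (forall v, v \in F -> w v = w' v) -> A w -> A w'.

Definition windows : set (set (config V)) := [set A | exists F, window F A].

Lemma windowS F F' A : (F `<=` F')%fset -> window F A -> window F' A.
Proof. by move=> FF' h w w' ww'; apply: h => v vF; apply: ww'; exact: (fsubsetP FF'). Qed.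

Lemma window_decomp F A : window F A ->
  A = \big[setU/set0]_(D <- [fset D in fpowerset F | `[< A (flip s D) >] ]%fset) cyl s F D.
Proof.
move=> hA; rewrite -bigcup_fset; apply/seteqP; split => w.
  move=> Aw; have [D DF wD] := cyl_exists s F w.
  exists D => //=; rewrite !inE /= fpowersetE DF /=; apply/asboolP.
  by apply: hA Aw => v vF; rewrite wD.
move=> [D /=]; rewrite !inE => /andP[_ /asboolP AD] wD.
by apply: hA AD => v vF; rewrite wD.
Qed.

Lemma windows_setI : setI_closed windows.
Proof.
move=> A B [F hA] [G hB]; exists (F `|` G)%fset => w w' h [Aw Bw]; split.
  by apply: hA Aw => v vF; apply: h; rewrite in_fsetU vF.
by apply: hB Bw => v vF; apply: h; rewrite in_fsetU vF orbT.
Qed.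

Lemma measurable_window F A : window F A -> measurable A.
Proof.
move=> /window_decomp ->; apply: bigsetU_measurable => D _; exact: measurable_cyl.
Qed.

Lemma measurable_windows : @measurable _ (config V) = <<s windows >>.
Proof.
apply/seteqP; split => A.
  apply: sub_sigma_algebra2 => B [v [b ->]]; exists [fset v]%fset => w w' h /= <-.
  by apply/esym/h; rewrite inE.
apply: smallest_sub; first exact: sigma_algebra_measurable.
by move=> B [F]; exact: measurable_window.
Qed.

Lemma measure_window (m : {measure set (config V) -> \bar R}) F A : window F A ->
  m A = (\sum_(D <- [fset D in fpowerset F | `[< A (flip s D) >] ]%fset) m (cyl s F D))%E.
Proof.
move=> hA; rewrite {1}(window_decomp hA) measure_fbigsetU//.
  by move=> D _; exact: measurable_cyl.
move=> D D' /=; rewrite !inE !fpowersetE => /andP[DF _] /andP[DF' _] [w [h h']].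
exact: cyl_inj h h'.
Qed.

(** Events read in a finite window form a generating class stable under intersection, and each is a
    finite disjoint union of cylinders. *)
Lemma probability_ext (m1 m2 : probability (config V) R) :
  (forall F D, (D `<=` F)%fset -> m1 (cyl s F D) = m2 (cyl s F D)) ->
  on_sigma_algebra m1 = on_sigma_algebra m2.
Proof.
move=> h; apply/funext => -[A mA]; rewrite /on_sigma_algebra /=.
apply: (measure_unique windows (fun=> setT)) => //.
- exact: measurable_windows.
- exact: windows_setI.
- by move=> _; exists fset0.
- by apply/seteqP; split => // w _; exists 0%N.
- move=> B [F hB]; rewrite !(measure_window _ hB) big_seq [RHS]big_seq.
  by apply: eq_bigr => D; rewrite !inE fpowersetE => /andP[DF _]; exact: h.
- by move=> _; apply: le_lt_trans (probability_le1 _ _) (ltry _).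
Qed.

End WindowSets.

Section GibbsOfDLR.
Local Open Scope fset_scope.
Local Open Scope classical_set_scope.
Local Open Scope ring_scope.
Variables (R : realType) (V : choiceType) (nb : V -> {fset V}).
Hypothesis nb_sym : forall x y, (y \in nb x) = (x \in nb y).
Hypothesis nb_irr : forall x, x \notin nb x.
Variable E : set (set V).
Hypothesis edgeE : E = [set e | exists x y, e = [set x; y] /\ y \in nb x].
Variables (s : config V) (beta : R).
Implicit Types (m : probability (config V) R).

Lemma gibbs_of_dlr m : (forall L, dlr nb s beta m L) -> gibbs_measures E beta m.
Proof.
move=> hm L A mA.
(* The measurability of the kernel is carried along in the Dynkin induction: complements and
   countable unions need it to split the integral. *)
suff : measurable_fun setT (fun w => finite_gibbs E beta L w A) /\
   m A = (\int[m]_w finite_gibbs E beta L w A)%E by case.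
have fg1 w B : measurable B ->
   (finite_gibbs E beta L w (~` B) = 1 - finite_gibbs E beta L w B)%E.
  by move=> mB; rewrite probability_setC.
have fg0 w B : (0 <= finite_gibbs E beta L w B)%E by exact: measure_ge0.
move: mA; rewrite (measurable_windows s); move: A.
apply: (@dynkin_induction _ (config V) (@windows V)
  (fun A => measurable_fun setT (fun w => finite_gibbs E beta L w A) /\
   m A = (\int[m]_w finite_gibbs E beta L w A)%E)).
- exact: (measurable_windows s).
- exact: windows_setI.
- have fgT : (fun w => finite_gibbs E beta L w setT) = cst 1%E.
    by apply/funext => w; rewrite probability_setT.
  rewrite fgT; split; first exact: measurable_cst.
  by rewrite integral_cst// mul1e.
- move=> A [F0 hA]; pose F := (F0 `|` closure_nb nb L)%fset.
  have hF : window F A by apply: windowS hA; exact: fsubsetUl.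
  have LF : (closure_nb nb L `<=` F)%fset by exact: fsubsetUr.
  set r := [fset D in fpowerset F | `[< A (flip s D) >] ]%fset.
  have rF D : D \in r -> (D `<=` F)%fset by rewrite !inE fpowersetE => /andP[].
  have fgE : (fun w => finite_gibbs E beta L w A) =
     (fun w => \sum_(D <- r) (\1_(cyl s (F `\` L)%fset D) w * gibbs_ratio nb s beta L D)%:E)%E.
    apply/funext => w; rewrite (measure_window s _ hF) big_seq [RHS]big_seq.
    by apply: eq_bigr => D /rF DF; exact: (finite_gibbs_cyl nb_sym nb_irr edgeE s beta _ LF DF).
  have mI D : measurable_fun setT
     (fun w => (\1_(cyl s (F `\` L)%fset D) w * gibbs_ratio nb s beta L D)%:E).
    apply/measurable_EFinP; apply: measurable_funM; last exact: measurable_cst.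
    by apply: measurable_indic; exact: measurable_cyl.
  rewrite fgE; split; first by apply: emeasurable_sum => D _; exact: mI.
  rewrite (measure_window s m hF) ge0_integral_sum//; last first.
    by move=> D w _; rewrite lee_fin mulr_ge0 ?gibbs_ratio_ge0// indicE.
  rewrite big_seq [RHS]big_seq; apply: eq_bigr => D /rF DF.
  transitivity (pcyl s m F D)%:E; first exact/esym/pcylE.
  rewrite (hm L F D LF DF).
  under eq_integral do rewrite mulrC EFinM.
  rewrite ge0_integralZl ?lee_fin ?gibbs_ratio_ge0//; last first.
    by apply/measurable_EFinP; apply: measurable_indic; exact: measurable_cyl.
  rewrite integral_indic//; last exact: measurable_cyl.
  by rewrite setIT (EFinM (gibbs_ratio _ _ _ _ _)) pcylE.
- move=> A mA [mf mE].
  have fgC : (fun w => finite_gibbs E beta L w (~` A)) =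
             (fun w => 1 - finite_gibbs E beta L w A)%E.
    by apply/funext => w; rewrite fg1.
  have mfC : measurable_fun setT (fun w => finite_gibbs E beta L w (~` A)).
    by rewrite fgC; apply: emeasurable_funB => //; exact: measurable_cst.
  split=> //; have h1 :
      (\int[m]_w (finite_gibbs E beta L w A + finite_gibbs E beta L w (~` A)) = 1)%E.
    rewrite -(@probability_setT _ _ _ m) -[RHS]mul1e -integral_cst//; apply: eq_integral => w _.
    by rewrite fg1// addeC subeK ?fin_num_measure.
  move: h1; rewrite ge0_integralD// -mE probability_setC// => h1.
  have mfin : m A \is a fin_num by exact: fin_num_measure.
  by rewrite -h1 addeAC subee// add0e.
- move=> F mF tF hF; have mU : measurable (\bigcup_k F k) by exact: bigcup_measurable.
  have mb (nu : {measure set (config V) -> \bar R}) :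
      nu (\bigcup_k F k) = (\sum_(0 <= k <oo) nu (F k))%E.
    by rewrite measure_bigcup//; apply: eq_eseriesl => k; rewrite in_setT.
  have fgE : (fun w => finite_gibbs E beta L w (\bigcup_k F k)) =
     (fun w => \sum_(0 <= k <oo) finite_gibbs E beta L w (F k))%E.
    by apply/funext => w; rewrite mb.
  rewrite fgE; split; first by apply: ge0_emeasurable_sum => // k _; exact: (hF k).1.
  rewrite integral_nneseries//; last by move=> k; exact: (hF k).1.
  rewrite mb; apply: eq_eseriesr => k _; exact: (hF k).2.
Qed.

End GibbsOfDLR.

Lemma cvg_sum_seq (R : realType) (T : eqType) (r : seq T) (f : nat -> T -> R) (l : T -> R) :
  (forall i, i \in r -> f n i @[n --> \oo] --> l i) ->
  \sum_(i <- r) f n i @[n --> \oo] --> \sum_(i <- r) l i.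
Proof.
elim: r => [_|i r IH h].
  by under eq_fun do rewrite big_nil; rewrite big_nil; exact: cvg_cst.
under eq_fun do rewrite big_cons; rewrite big_cons; apply: cvgD.
  by apply: h; rewrite mem_head.
by apply: IH => j jr; apply: h; rewrite inE jr orbT.
Qed.

(** * Existence, uniqueness and extremality of the low temperature state *)

Section LimitState.
Local Open Scope fset_scope.
Local Open Scope classical_set_scope.
Local Open Scope ring_scope.
Variables (R : realType) (V : choiceType) (nb : V -> {fset V}).
Hypothesis nb_sym : forall x y, (y \in nb x) = (x \in nb y).
Hypothesis nb_irr : forall x, x \notin nb x.
Variable E : set (set V).
Hypothesis edgeE : E = [set e | exists x y, e = [set x; y] /\ y \in nb x].
Variables (s : config V) (beta : R) (q : nat).
Hypothesis nb_le : forall x, (#|` nb x| <= q)%N.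
Hypothesis iso : forall D, #|` D|%:R <= excess R nb s D.
Hypothesis cold : expR (- (2 * beta)) <= 2^-1 ^+ (q.+1 + q.+3).
Hypothesis beta_ge0 : 0 <= beta.
Implicit Types (A B C D F L S : {fset V}) (w : config V).
Implicit Types m : probability (config V) R.
Local Notation P L := (finite_gibbs E beta L s).

(** The bound of [swap_le_abs] holds for every radius [n], and its right-hand side tends to 0. *)
Lemma gibbs_peierls_unique m1 m2 K : 0 <= K ->
  (forall L, dlr nb s beta m1 L) -> (forall L, dlr nb s beta m2 L) ->
  peierls_bound s q m1 K -> peierls_bound s q m2 K ->
  on_sigma_algebra m1 = on_sigma_algebra m2.
Proof.
move=> K0 d1 d2 p1 p2; apply: (probability_ext (s := s)) => B b bB.
rewrite -!pcylE; congr (_%:E); apply/eqP; rewrite -subr_eq0 -normr_le0.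
set C := K ^+ 2 * (2 ^+ q.+2) ^+ #|` B|.
have bnd n : `|pcyl s m1 B b - pcyl s m2 B b| <= C * 2^-1 ^+ n.
  exact: (swap_le_abs nb_sym nb_le K0 bB (d1 _) (d2 _) p1 p2).
have C2 : C * 2^-1 ^+ n @[n --> \oo] --> C * (0 : R).
  apply: cvgMr; apply: cvg_expr; rewrite ger0_norm; lra.
rewrite -(mulr0 C) -(cvg_lim _ C2)//; apply: limr_ge.
  by apply/cvg_ex; eexists; exact: C2.
by apply: nearW => n; exact: bnd.
Qed.

(** In a decomposition of [m] with weight [t], the components are dominated by [m / t] and
    [m / (1 - t)]; they inherit the Peierls bound with the constant [K] below, and uniqueness
    identifies them. *)
Lemma extremal_peierls m : gibbs_measures E beta m -> peierls_bound s q m 1 ->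
  extremal (gibbs_measures E beta) m.
Proof.
move=> mG mP; split=> // m1 m2 t m1G m2G /andP[t0 t1] mE.
have t1' : 0 < 1 - t by lra.
pose K : R := t^-1 + (1 - t)^-1.
have it0 : 0 < t^-1 by rewrite invr_gt0.
have it1 : 0 < (1 - t)^-1 by rewrite invr_gt0.
have mc S : pcyl s m S S = t * pcyl s m1 S S + (1 - t) * pcyl s m2 S S.
  apply: EFin_inj; rewrite pcylE EFinD !EFinM !pcylE; apply: mE; exact: measurable_cyl.
apply: (@gibbs_peierls_unique m1 m2 K); first by rewrite /K; lra.
- by move=> L; exact: (dlr_gibbs nb_sym nb_irr edgeE).
- by move=> L; exact: (dlr_gibbs nb_sym nb_irr edgeE).
- move=> S; have := mP S; rewrite mul1r mc => h.
  apply: (@le_trans _ _ (t^-1 * (2^-1 ^+ q.+3) ^+ #|` S|)).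
    rewrite ler_pdivlMl//; apply: le_trans h; rewrite lerDl.
    by rewrite mulr_ge0 ?pcyl_ge0// ltW.
  by rewrite ler_wpM2r ?exprn_ge0 /K//; lra.
- move=> S; have := mP S; rewrite mul1r mc => h.
  apply: (@le_trans _ _ ((1 - t)^-1 * (2^-1 ^+ q.+3) ^+ #|` S|)).
    rewrite ler_pdivlMl//; apply: le_trans h; rewrite lerDr.
    by rewrite mulr_ge0 ?pcyl_ge0// ltW.
  by rewrite ler_wpM2r ?exprn_ge0 /K//; lra.
Qed.

Lemma peierls_bound_majority m v : peierls_bound s q m 1 ->
  (2^-1%:E < m [set w | w v = s v])%E.
Proof.
move=> /(_ [fset v]%fset); rewrite cardfs1 expr1 mul1r => h.
have -> : [set w : config V | w v = s v] = ~` cyl s [fset v]%fset [fset v]%fset.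
  apply/seteqP; split => w /=.
    by move=> wv /(_ v); rewrite inE eqxx => /(_ isT); rewrite wv /flip inE eqxx; case: (s v).
  move=> wn; apply: contrapT => wv; apply: wn => u; rewrite inE => /eqP ->.
  by move: wv; rewrite /flip inE eqxx; case: (w v); case: (s v).
rewrite probability_setC; last exact: measurable_cyl.
rewrite -pcylE -EFinB lte_fin.
have : 2^-1 ^+ q.+3 <= 4^-1 :> R.
  rewrite (_ : 4^-1 = 2^-1 ^+ 2); last by rewrite expr2; lra.
  by apply: ler_wiXn2l => //; lra.
lra.
Qed.

Variables (e : nat -> V) (h : V -> nat).
Hypotheses (eK : cancel e h) (hK : cancel h e).

Definition volume n : {fset V} := [fset e i | i in iota 0 n]%fset.

Lemma mem_volume n v : (v \in volume n) = (h v < n)%N.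
Proof.
apply/imfsetP/idP => [[i /=]|hn]; first by rewrite mem_iota /= => ? ->; rewrite eK.
by exists (h v); rewrite ?hK//= mem_iota.
Qed.

Lemma volume_sub i j : (i <= j)%N -> (volume i `<=` volume j)%fset.
Proof. by move=> ij; apply/fsubsetP => v; rewrite !mem_volume => /leq_trans; apply. Qed.

Lemma volume_exhaustion : exhaustion volume.
Proof.
split; first by move=> n; exact/volume_sub/leqnSn.
by move=> v; exists (h v).+1; rewrite mem_volume.
Qed.

Lemma volume_absorbs F : exists n, (F `<=` volume n)%fset.
Proof.
exists (\max_(v <- F) h v).+1; apply/fsubsetP => v vF.
by rewrite mem_volume ltnS; exact: leq_bigmax_seq.
Qed.

(** Two volumes containing the ball of radius [N] around [B] give states that both satisfy the DLR
    equation in that ball, hence differ on [B] by at most a multiple of [2^-N]. *)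
Lemma pcyl_cauchy B b : (b `<=` B)%fset ->
  cvg (pcyl s (P (volume n)) B b @[n --> \oo]).
Proof.
move=> bB; apply/cauchy_cvgP/cauchy_ballP => eps eps0.
set C := 1 ^+ 2 * (2 ^+ q.+2) ^+ #|` B| : R.
have C2 : C * 2^-1 ^+ n @[n --> \oo] --> C * (0 : R).
  apply: cvgMr; apply: cvg_expr; rewrite ger0_norm; lra.
have : \forall n \near \oo, `|C * 0 - C * 2^-1 ^+ n| < eps by move/cvgrPdist_lt: C2; apply.
move=> [N _ /(_ N (leqnn N))]; rewrite mulr0 sub0r normrN => hN.
have [M hM] := volume_absorbs (nball nb N B).
rewrite near_map2; exists ([set n | (M <= n)%N], [set n | (M <= n)%N]); first by split; exists M.
move=> [i j] [/= Mi Mj]; rewrite /ball /=; apply: le_lt_trans hN.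
apply: le_trans (ler_norm _).
apply: (swap_le_abs nb_sym nb_le ler01 bB).
- apply: (dlr_self nb_sym nb_irr edgeE); exact: fsubset_trans hM (volume_sub Mi).
- apply: (dlr_self nb_sym nb_irr edgeE); exact: fsubset_trans hM (volume_sub Mj).
- exact: (peierls_self nb_sym nb_irr edgeE nb_le iso cold beta_ge0).
- exact: (peierls_self nb_sym nb_irr edgeE nb_le iso cold beta_ge0).
Qed.

(** A word of bits prescribes the spins at [e 0], [e 1], and so on; this is the set where it departs
    from [s]. It translates between the words of the extension theorem and flipped sets. *)
Definition pattern (t : seq bool) : {fset V} :=
  [fset v in volume (size t) | nth false t (h v) != s v]%fset.

Lemma pattern_sub t : (pattern t `<=` volume (size t))%fset.
Proof. by apply/fsubsetP => v; rewrite !inE => /andP[]. Qed.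

Lemma cyl_pattern t :
  cyl s (volume (size t)) (pattern t) =
  [set w | forall i, (i < size t)%N -> w (e i) = nth false t i].
Proof.
have fp v : v \in volume (size t) -> flip s (pattern t) v = nth false t (h v).
  by move=> vt; rewrite /flip !inE vt /=; case: (s v); case: (nth _ _ _).
apply/seteqP; split => w H.
  by move=> i it; have ei : e i \in volume (size t); rewrite ?mem_volume ?eK// H// fp ?eK.
by move=> v vt; rewrite fp// -H ?hK// -mem_volume.
Qed.

Let M t : R := lim (pcyl s (P (volume n)) (volume (size t)) (pattern t) @[n --> \oo]).

Let cvgM t : pcyl s (P (volume n)) (volume (size t)) (pattern t) @[n --> \oo] --> M t.
Proof. exact: (pcyl_cauchy (pattern_sub t)). Qed.

(** The limiting probabilities of words are additive in the last bit, so the extension theorem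
    applies; an arbitrary window is handled as a marginal of some [volume n]. *)
Lemma limit_state : exists m : probability (config V) R,
  forall B b, (b `<=` B)%fset ->
    pcyl s (P (volume n)) B b @[n --> \oo] --> pcyl s m B b.
Proof.
have M_ge0 t : 0 <= M t.
  apply: limr_ge; first exact/pcyl_cauchy/pattern_sub.
  by apply: nearW => n; exact: pcyl_ge0.
have M_nil : M [::] = 1.
  apply/cvg_lim => //; apply: cvg_near_cst; apply: nearW => n.
  apply: EFin_inj; rewrite pcylE cyl_pattern -[RHS](probability_setT (P (volume n))).
  by congr (_ _); apply/seteqP; split.
have M_rcons t : M t = M (rcons t false) + M (rcons t true).
  apply/cvg_lim => //; apply: cvg_trans (cvgD (@cvgM (rcons t false)) (@cvgM (rcons t true))).
  apply: near_eq_cvg; apply: nearW => n.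
  apply: EFin_inj; rewrite /= EFinD !pcylE -measureU; try exact: measurable_cyl.
    congr (_ _); rewrite !cyl_pattern; apply/seteqP; split => w.
      move=> [|] H i it; move: (H i); rewrite size_rcons nth_rcons it; apply; exact: ltnW.
    move=> H; case wt: (w (e (size t))); [right|left] => i; rewrite size_rcons ltnS nth_rcons leq_eqVlt.
      by move=> /predU1P[->|it]; rewrite ?ltnn ?eqxx// it H.
    by move=> /predU1P[->|it]; rewrite ?ltnn ?eqxx// it H.
  rewrite !cyl_pattern; apply/seteqP; split => // w [/(_ (size t)) + /(_ (size t))].
  by rewrite !size_rcons !nth_rcons ltnn eqxx => -> // /(_ (ltnSn _)).
have [m mM] := kolmogorov_extension M_ge0 M_nil M_rcons eK.
exists m => B b bB; have [n Bn] := volume_absorbs B.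
have lim_volume D : (D `<=` volume n)%fset ->
    pcyl s (P (volume k)) (volume n) D @[k --> \oo] --> pcyl s m (volume n) D.
  move=> Dn; pose t := mkseq (fun i => flip s D (e i)) n.
  have szt : size t = n by rewrite size_mkseq.
  have tD : D = pattern t.
    apply/fsetP => v; rewrite !inE szt; case vn: (v \in volume n); last first.
      by apply/negP => /(fsubsetP Dn); rewrite vn.
    rewrite nth_mkseq -?mem_volume// hK /flip /=; by case: (s v); case: (v \in D).
  have := @cvgM t; rewrite szt -tD; suff -> : M t = pcyl s m (volume n) D by [].
  by apply: EFin_inj; rewrite pcylE -mM -cyl_pattern szt -tD.
rewrite (pcyl_marginal _ _ Bn bB).
under eq_fun do rewrite (pcyl_marginal _ _ Bn bB) big_fset_condE.
rewrite big_fset_condE; apply: cvg_sum_seq => D; rewrite !inE fpowersetE => /andP[Dn _].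
exact: lim_volume.
Qed.

End LimitState.

Section WeakLimit.
Local Open Scope fset_scope.
Local Open Scope classical_set_scope.
Local Open Scope ring_scope.
Variables (R : realType) (V : choiceType) (s : config V).
Implicit Types (P : probability (config V) R) (F D : {fset V}).

Lemma integrable_bounded P (f : config V -> R) (M : R) : measurable_fun setT f ->
  (forall w, `|f w| <= M) -> P.-integrable setT (EFin \o f).
Proof.
move=> mf fM; apply: measurable_bounded_integrable => //.
  by apply: le_lt_trans (probability_le1 _ _) (ltry _).
by exists M; split; [exact: num_real|move=> y My w _; exact: le_trans (fM w) (ltW My)].
Qed.

Definition window_sum F (c : {fset V} -> R) (w : config V) : R :=
  \sum_(D <- fpowerset F) c D * \1_(cyl s F D) w.

Lemma measurable_window_sum F c : measurable_fun setT (window_sum F c).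
Proof.
apply: measurable_sum => D; apply: measurable_funM; first exact: measurable_cst.
by apply: measurable_indic; exact: measurable_cyl.
Qed.

Lemma window_sum_le F c w : `|window_sum F c w| <= \sum_(D <- fpowerset F) `|c D|.
Proof.
apply: le_trans (ler_norm_sum _ _ _) _; apply: ler_sum => D _.
by rewrite normrM ler_piMr// indicE; case: (_ \in _); rewrite ?normr1 ?normr0.
Qed.

Lemma Rintegral_window_sum P F c :
  (\int[P]_w window_sum F c w)%R = \sum_(D <- fpowerset F) c D * pcyl s P F D.
Proof.
have mi D : measurable_fun setT (\1_(cyl s F D) : config V -> R).
  by apply: measurable_indic; exact: measurable_cyl.
have int1 D : P.-integrable setT (EFin \o (fun w => c D * \1_(cyl s F D) w)).
  apply: (@integrable_bounded _ _ `|c D|).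
    by apply: measurable_funM => //; exact: measurable_cst.
  by move=> w; rewrite normrM ler_piMr// indicE; case: (_ \in _); rewrite ?normr1 ?normr0.
rewrite /Rintegral; under eq_integral do rewrite /window_sum -sumEFin.
rewrite integral_sum// -[RHS]/(fine (_)%:E) -sumEFin; congr fine; apply: eq_bigr => D _.
rewrite EFinM pcylE; under eq_integral do rewrite EFinM.
rewrite integralZl//; last first.
  by apply: (@integrable_bounded _ _ 1) => // w; rewrite indicE; case: (_ \in _); rewrite ?normr1 ?normr0.
by rewrite integral_indic ?setIT//; exact: measurable_cyl.
Qed.

Lemma window_sum_flip F (f : config V -> R) w :
  window_sum F (fun D => f (flip s D)) w = f (fun v => if v \in F then w v else s v).
Proof.
have [D DF wD] := cyl_exists s F w.
rewrite /window_sum (big_fsetD1 D) /=; last by rewrite fpowersetE.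
rewrite indicE mem_set// mulr1 big_seq big1 ?addr0 => [|D'].
  congr f; apply/funext => v; case: ifPn => vF; first by rewrite wD.
  rewrite /flip; case vD: (v \in D); last by rewrite addbF.
  by rewrite (fsubsetP DF _ vD) in vF.
rewrite in_fsetD1 fpowersetE => /andP[D'D D'F].
rewrite indicE memNset ?mulr0// => wD'; move/eqP: D'D; apply.
exact: cyl_inj wD' wD.
Qed.

(** Resetting the spins outside [L N] to [s] changes a continuous function uniformly little and
    leaves a finite combination of cylinder indicators, whose integrals converge by hypothesis. *)
Lemma weak_limit_cyl (L : nat -> {fset V}) (P_ : nat -> probability (config V) R) P :
  exhaustion L ->
  (forall F D, (D `<=` F)%fset -> pcyl s (P_ n) F D @[n --> \oo] --> pcyl s P F D) ->
  weak_limit P_ P.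
Proof.
move=> Lex hP f fc; have unif := uniform_window fc Lex.
pose g N := window_sum (L N) (fun D => f (flip s D)).
have gE N w : g N w = f (fun v => if v \in L N then w v else s v) by exact: window_sum_flip.
have fg (eps : R) : 0 < eps -> exists N, forall n w, (N <= n)%N -> `|f w - g n w| <= eps.
  move=> /unif[N hN]; exists N => n w Nn; rewrite gE; apply: hN Nn _ => v vL.
  by rewrite vL.
have mf : measurable_fun setT (f : config V -> R).
  apply: (@measurable_fun_cvg _ _ _ _ g) => [N|w _]; first exact: measurable_window_sum.
  apply/cvgrPdist_le => eps eps0; have [N hN] := fg _ eps0.
  by exists N => // n /= Nn; exact: hN.
have [N1 hN1] := fg 1 ltr01.
have fb w : `|f w| <= 1 + \sum_(D <- fpowerset (L N1)) `|f (flip s D)|.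
  have -> : f w = (f w - g N1 w) + g N1 w by ring.
  by apply: le_trans (ler_normD _ _) _; apply: lerD; [exact: hN1|exact: window_sum_le].
have fi (Q : probability (config V) R) : Q.-integrable setT (EFin \o (f : config V -> R)) by exact: integrable_bounded mf fb.
have gi (Q : probability (config V) R) N : Q.-integrable setT (EFin \o g N).
  apply: integrable_bounded; first exact: measurable_window_sum.
  by move=> w; exact: window_sum_le.
have appr (Q : probability (config V) R) N (eps : R) : 0 <= eps -> (forall w, `|f w - g N w| <= eps) ->
    `|(\int[Q]_w f w)%R - (\int[Q]_w g N w)%R| <= eps.
  move=> eps0 h; rewrite -(RintegralB measurableT (fi Q) (gi Q N)).
  have md : measurable_fun setT (fun w : config V => f w - g N w).
    by apply: measurable_funB => //; exact: measurable_window_sum.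
  have di : Q.-integrable setT (EFin \o (fun w : config V => f w - g N w)).
    exact: integrable_bounded md h.
  apply: le_trans (le_normr_Rintegral measurableT di) _.
  apply: (@le_trans _ _ (\int[Q]_w (cst eps w))%R).
    apply: le_Rintegral => //.
    - apply: (@integrable_bounded _ _ eps); first by apply: measurableT_comp.
      by move=> w; rewrite normr_id.
    - apply: (@integrable_bounded _ _ eps); first exact: measurable_cst.
      by move=> w; rewrite ger0_norm.
  by rewrite Rintegral_cst//= probability_setT mulr1.
have fineE (Q : probability (config V) R) : (\int[Q]_w (f w)%:E)%E = (\int[Q]_w f w)%R%:E.
  by rewrite /Rintegral fineK//; apply: (integrable_fin_num measurableT (fi Q)).
rewrite fineE; under eq_fun do rewrite fineE.
apply: cvg_EFin; first exact: nearW.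
apply/cvgrPdist_le => eps eps0.
have eps3 : 0 < eps / 3 by rewrite divr_gt0.
have [N hN] := fg _ eps3.
have cg : (\int[P_ n]_w g N w)%R @[n --> \oo] --> (\int[P]_w g N w)%R.
  rewrite Rintegral_window_sum; under eq_fun do rewrite Rintegral_window_sum.
  apply: cvg_sum_seq => D; rewrite fpowersetE => DL; apply: cvgMr; exact: hP.
move/cvgrPdist_le: cg => /(_ _ eps3)[n0 _ hn]; exists n0 => // n /= n0n.
have h1 := appr P N _ (ltW eps3) (fun w => hN N w (leqnn N)).
have h2 := appr (P_ n) N _ (ltW eps3) (fun w => hN N w (leqnn N)).
have h3 := hn n n0n; move: h1 h2 h3; rewrite !ler_norml => /andP[? ?] /andP[? ?] /andP[? ?].
by apply/andP; split; lra.
Qed.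

End WeakLimit.

Section LowTemperature.
Local Open Scope fset_scope.
Local Open Scope classical_set_scope.
Local Open Scope ring_scope.
Variables (R : realType) (V : choiceType) (nb : V -> {fset V}).
Hypothesis nb_sym : forall x y, (y \in nb x) = (x \in nb y).
Hypothesis nb_irr : forall x, x \notin nb x.
Variable E : set (set V).
Hypothesis edgeE : E = [set e | exists x y, e = [set x; y] /\ y \in nb x].
Variables (s : config V) (beta : R) (q : nat).
Hypothesis nb_le : forall x, (#|` nb x| <= q)%N.
Hypothesis iso : forall D, #|` D|%:R <= excess R nb s D.
Hypothesis beta_ge : q.+2%:R <= beta.
Hypothesis cV : countable [set: V].
Variable v0 : V.

Theorem low_temperature_state : exists m : probability (config V) R,
  [/\ exists L_, exhaustion L_ /\ weak_limit (fun n => finite_gibbs E beta (L_ n) s) m,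
      extremal (gibbs_measures E beta) m &
      forall v, (2^-1%:E < m [set w | w v = s v])%E].
Proof.
have beta_ge0 : 0 <= beta by apply: le_trans beta_ge; exact: ler0n.
(* Since [exp(-1) <= 1/2], the bound [beta >= q+2] yields [2^-(2(q+2))], and [2(q+2)] is the sum of
   the entropy exponent [q+1] and the gain exponent [q+3]. *)
have cold : expR (- (2 * beta)) <= 2^-1 ^+ (q.+1 + q.+3).
  have -> : (q.+1 + q.+3 = 2 * q.+2)%N by lia.
  have e2 : expR (-1) <= 2^-1 :> R.
    rewrite expRN lef_pV2 ?posrE ?expR_gt0//; apply: le_trans (expR_ge1Dx _); lra.
  apply: le_trans (lerXn2r _ _ _ e2); rewrite ?nnegrE ?expR_ge0//.
  by rewrite -expRM_natl ler_expR natrM mulrN1 lerN2 ler_pM2l.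
(* Flipping all of a finite graph would cost nothing, against the isoperimetric inequality; with
   countability this gives an enumeration of [V] by all of [nat]. *)
have infV : ~ finite_set [set: V].
  move=> fV; have := iso (fset_set [set: V]); rewrite /excess.
  rewrite big1 => [|x _]; last first.
    rewrite (_ : _ `\` _ = fset0)%fset ?big_seq_fset0//; apply/fsetP => y.
    by rewrite in_fsetD in_fset_set// in_setT.
  rewrite lern0 cardfs_eq0 => /eqP/fsetP/(_ v0); by rewrite in_fset_set// in_setT.
have [h [e [he eh]]] : exists (h : V -> nat) (e : nat -> V), cancel h e /\ cancel e h.
  have /pcard_eqP/bijPex[h [_ hinj hsurj]] := eq_card_nat cV infV.
  have /choice[e eP] : forall n, exists v, h v = n.
    by move=> n; have [v _ <-] := hsurj n I; exists v.
  exists h, e; split => // v; apply: hinj; rewrite ?inE// eP //.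
have [m mlim] := limit_state nb_sym nb_irr edgeE nb_le iso cold beta_ge0 eh he.
have Lex := volume_exhaustion eh he.
have mP : peierls_bound s q m 1.
  move=> S; have := mlim S S (fsubset_refl _) => c; rewrite -(cvg_lim _ c)//.
  apply: limr_le; first by apply/cvg_ex; eexists; exact: c.
  apply: nearW => n; exact: (peierls_self nb_sym nb_irr edgeE nb_le iso cold beta_ge0).
have mG : gibbs_measures E beta m.
  apply: (gibbs_of_dlr nb_sym nb_irr edgeE (s := s)) => L F D LF DF.
  have DLF : cyl s (F `\` L)%fset D = cyl s (F `\` L)%fset (D `\` L)%fset.
    apply: cyl_eq; apply/fsetP => v.
    by rewrite !(in_fsetI, in_fsetD); case: (v \in L); rewrite ?andbF ?andbT.
  have c1 := mlim F D DF; have c2 := mlim (F `\` L)%fset (D `\` L)%fset (fsetSD L DF).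
  have -> : pcyl s m (F `\` L)%fset D = pcyl s m (F `\` L)%fset (D `\` L)%fset.
    by rewrite /pcyl DLF.
  have c3 : gibbs_ratio nb s beta L D *
      pcyl s (finite_gibbs E beta (volume e n) s) (F `\` L)%fset (D `\` L)%fset @[n --> \oo]
      --> gibbs_ratio nb s beta L D * pcyl s m (F `\` L)%fset (D `\` L)%fset.
    by apply: cvgMr; exact: c2.
  rewrite -(cvg_lim _ c1)//; apply/cvg_lim => //; apply: cvg_trans c3; apply: near_eq_cvg.
  have [n0 Ln0] := volume_absorbs eh he L; exists n0 => // n /= n0n.
  have LV := fsubset_trans Ln0 (volume_sub eh he n0n).
  by rewrite (dlr_self nb_sym nb_irr edgeE s beta LV LF DF) /pcyl DLF.
exists m; split.
- exists (volume e); split => //; exact: weak_limit_cyl Lex mlim.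
- exact: (extremal_peierls nb_sym nb_irr edgeE).
- by move=> v; exact: peierls_bound_majority mP.
Qed.

End LowTemperature.

(** * The hyperboloid model *)

Section Minkowski.
Local Open Scope ring_scope.
Variable R : realType.
Local Notation vec := 'rV[R]_3.
Implicit Types (x y z u a b c : vec) (k : R).

Lemma vecP x y : x 0 0 = y 0 0 -> x 0 1 = y 0 1 -> x 0 2 = y 0 2 -> x = y.
Proof.
move=> h0 h1 h2; apply/rowP => i; case: i => [[|[|[|//]]] hi].
- by move: h0; congr (_ = _); congr (_ _ _); apply: val_inj.
- by move: h1; congr (_ = _); congr (_ _ _); apply: val_inj.
- by move: h2; congr (_ = _); congr (_ _ _); apply: val_inj.
Qed.

Lemma det3E x y z : det3 x y z =
  x 0 0 * (y 0 1 * z 0 2 - y 0 2 * z 0 1) - x 0 1 * (y 0 0 * z 0 2 - y 0 2 * z 0 0)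
  + x 0 2 * (y 0 0 * z 0 1 - y 0 1 * z 0 0).
Proof.
rewrite /det3 (expand_det_row _ 0) !big_ord_recl big_ord0 /cofactor.
rewrite !(expand_det_row _ 0) !big_ord_recl !big_ord0 /cofactor !det_mx11 !mxE /=.
have E (w : vec) : exists f, forall i, w 0 i = f (val i).
  by exists (fun n => w 0 (inord n)) => i; rewrite inord_val.
have [fx hx] := E x; have [fy hy] := E y; have [fz hz] := E z; rewrite !hx !hy !hz.
rewrite /= /bump /= !expr0 !expr1 /=; ring.
Qed.

Definition vec3 (p q r : R) : vec := \row_i nth 0 [:: p; q; r] i.

Lemma vec3E p q r : (vec3 p q r 0 0 = p) * (vec3 p q r 0 1 = q) * (vec3 p q r 0 2 = r).
Proof. by rewrite !mxE. Qed.

Lemma minkC x y : mink x y = mink y x.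
Proof. by rewrite /mink; ring. Qed.

Lemma minkDl x y z : mink (x + y) z = mink x z + mink y z.
Proof. by rewrite /mink !mxE; ring. Qed.

Lemma minkZl k x z : mink (k *: x) z = k * mink x z.
Proof. by rewrite /mink !mxE; ring. Qed.

Lemma minkNl x z : mink (- x) z = - mink x z.
Proof. by rewrite /mink !mxE; ring. Qed.

Lemma minkDr x y z : mink z (x + y) = mink z x + mink z y.
Proof. by rewrite /mink !mxE; ring. Qed.

Lemma minkZr k x z : mink z (k *: x) = k * mink z x.
Proof. by rewrite /mink !mxE; ring. Qed.

Lemma minkNr x z : mink z (- x) = - mink z x.
Proof. by rewrite /mink !mxE; ring. Qed.

Definition minkE := (minkDl, minkZl, minkNl, minkDr, minkZr, minkNr).

Lemma det3D x y z z' : det3 x y (z + z') = det3 x y z + det3 x y z'.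
Proof. by rewrite !det3E !mxE; ring. Qed.

Lemma det3Z x y k z : det3 x y (k *: z) = k * det3 x y z.
Proof. by rewrite !det3E !mxE; ring. Qed.

Lemma det3N x y z : det3 x y (- z) = - det3 x y z.
Proof. by rewrite !det3E !mxE; ring. Qed.

Definition det3r := (det3D, det3Z, det3N).

Lemma det3_rot x y z : det3 x y z = det3 y z x.
Proof. by rewrite !det3E; ring. Qed.

Lemma det3_swap x y z : det3 x y z = - det3 y x z.
Proof. by rewrite !det3E; ring. Qed.

Lemma det3xyx x y : det3 x y x = 0.
Proof. by rewrite !det3E; ring. Qed.

Lemma det3xyy x y : det3 x y y = 0.
Proof. by rewrite !det3E; ring. Qed.

(** The Minkowski normal of the plane spanned by [a] and [b]: it represents [det3 a b] through
    [mink], so that signs of determinants become sides of a geodesic. *)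
Definition cross a b : vec := vec3 (- (a 0 1 * b 0 2 - a 0 2 * b 0 1))
  (- (a 0 0 * b 0 2 - a 0 2 * b 0 0)) (a 0 0 * b 0 1 - a 0 1 * b 0 0).

Lemma mink_cross a b z : mink (cross a b) z = det3 a b z.
Proof. by rewrite det3E /mink /cross !vec3E; ring. Qed.

Lemma mink_cross2 a b : mink (cross a b) (cross a b) = mink a b ^+ 2 - mink a a * mink b b.
Proof. by rewrite /mink /cross !vec3E; ring. Qed.

(** The Gram determinant, with a minus sign because the form has determinant -1. *)
Lemma det3_sq x y z : det3 x y z ^+ 2 =
  - (mink x x * (mink y y * mink z z - mink y z ^+ 2)
   - mink x y * (mink x y * mink z z - mink y z * mink x z)
   + mink x z * (mink x y * mink y z - mink y y * mink x z)).
Proof. by rewrite det3E /mink; ring. Qed.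

Lemma det3_cramer a b c z :
  det3 a b c *: z = det3 z b c *: a + det3 a z c *: b + det3 a b z *: c.
Proof. by apply: vecP; rewrite !mxE !det3E; ring. Qed.

(** After multiplication by the square of [x 0 0], orthogonality eliminates [u 0 0] and leaves a sum
    of squares. *)
Lemma mink_tangent_ge0 x u : mink x x = -1 -> mink x u = 0 -> 0 <= mink u u.
Proof.
rewrite /mink; set x0 := x 0 0; set x1 := x 0 1; set x2 := x 0 2.
set u0 := u 0 0; set u1 := u 0 1; set u2 := u 0 2 => h1 h2.
have e : x0 * u0 = x1 * u1 + x2 * u2 by lra.
have x0p : 0 < x0 * x0 by nra.
rewrite -(pmulr_rge0 _ x0p).
have -> : x0 * x0 * (- (u0 * u0) + u1 * u1 + u2 * u2) =
   - (x0 * u0) ^+ 2 + x0 * x0 * (u1 * u1 + u2 * u2) by ring.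
rewrite e (_ : x0 * x0 = 1 + x1 * x1 + x2 * x2); last by lra.
rewrite [leRHS](_ : _ = u1 ^+ 2 + u2 ^+ 2 + (x1 * u2 - x2 * u1) ^+ 2); last by ring.
by rewrite !addr_ge0 ?sqr_ge0.
Qed.

Lemma mink_cauchy x u v : mink x x = -1 -> mink x u = 0 -> mink x v = 0 ->
  mink u v ^+ 2 <= mink u u * mink v v.
Proof.
move=> hx hu hv; have v0 := mink_tangent_ge0 hx hv; have u0 := mink_tangent_ge0 hx hu.
have key k l : 0 <= k ^+ 2 * mink u u + 2 * k * l * mink u v + l ^+ 2 * mink v v.
  have := @mink_tangent_ge0 x (k *: u + l *: v) hx.
  rewrite !minkE hu hv (minkC v u) !mulr0 addr0 => /(_ erefl); lra.
have [v00|v00] := eqVneq (mink v v) 0.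
  have [uv|uv] := eqVneq (mink u v) 0; first by rewrite uv v00 mulr0 expr0n.
  have := key 1 (- (mink u u + 1) / (2 * mink u v)); rewrite v00 mulr0 addr0.
  have -> : 1 ^+ 2 * mink u u + 2 * 1 * (- (mink u u + 1) / (2 * mink u v)) * mink u v = -1.
    by field.
  by rewrite oppr_ge0 ler10.
have vp : 0 < mink v v by rewrite lt_neqAle eq_sym v00.
have := key (mink v v) (- mink u v) => h.
rewrite -subr_ge0 -(pmulr_rge0 _ vp); apply: le_trans h _; lra.
Qed.

Lemma mink_tangent_eq0 x u : mink x x = -1 -> mink x u = 0 -> mink u u = 0 -> u = 0.
Proof.
rewrite /mink; set x0 := x 0 0; set x1 := x 0 1; set x2 := x 0 2 => h1 h2 h3.
have e : x0 * u 0 0 = x1 * u 0 1 + x2 * u 0 2 by lra.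
have k1 : (u 0 1) ^+ 2 + (u 0 2) ^+ 2 + (x1 * u 0 2 - x2 * u 0 1) ^+ 2 = 0.
  have : x0 * x0 * (- (u 0 0 * u 0 0) + u 0 1 * u 0 1 + u 0 2 * u 0 2) = 0 by rewrite h3 mulr0.
  have -> : x0 * x0 * (- (u 0 0 * u 0 0) + u 0 1 * u 0 1 + u 0 2 * u 0 2) =
     - (x0 * u 0 0) ^+ 2 + x0 * x0 * (u 0 1 * u 0 1 + u 0 2 * u 0 2) by ring.
  rewrite e (_ : x0 * x0 = 1 + x1 * x1 + x2 * x2); last by lra.
  by move=> <-; ring.
have u1 : u 0 1 = 0.
  by apply/eqP; rewrite -sqrf_eq0 eq_le sqr_ge0 andbT; have := sqr_ge0 (u 0 2);
    have := sqr_ge0 (x1 * u 0 2 - x2 * u 0 1); lra.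
have u2 : u 0 2 = 0.
  by apply/eqP; rewrite -sqrf_eq0 eq_le sqr_ge0 andbT; have := sqr_ge0 (u 0 1);
    have := sqr_ge0 (x1 * u 0 2 - x2 * u 0 1); lra.
apply: vecP; rewrite ?mxE//; move: h3; rewrite u1 u2 !mulr0 !addr0 => /eqP.
by rewrite oppr_eq0 mulf_eq0 orbb => /eqP.
Qed.

(** Positivity of the projection of [y] to the tangent space at [x] shows that [mink x y] has
    absolute value at least 1; its sign comes from the Euclidean Cauchy inequality on the last two
    coordinates. *)
Lemma hyp_mink_le x y : hyp x -> hyp y -> mink x y <= -1.
Proof.
move=> [hx x0] [hy y0].
have := @mink_tangent_ge0 x (y + mink x y *: x) hx.
rewrite !minkE hx hy (minkC y x) => /(_ _)h; have {h}h : 1 <= mink x y ^+ 2.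
  by rewrite -subr_ge0; apply: le_trans (h _) _; [ring|rewrite le_eqVlt; apply/orP; left; apply/eqP; ring].
have neg : mink x y <= 0.
  have cs : (x 0 1 * y 0 1 + x 0 2 * y 0 2) ^+ 2 <= (x 0 0 * y 0 0) ^+ 2.
    have -> : (x 0 0 * y 0 0) ^+ 2 = (x 0 0 * x 0 0) * (y 0 0 * y 0 0) by ring.
    have -> : x 0 0 * x 0 0 = 1 + x 0 1 ^+ 2 + x 0 2 ^+ 2 by move: hx; rewrite /mink; lra.
    have -> : y 0 0 * y 0 0 = 1 + y 0 1 ^+ 2 + y 0 2 ^+ 2 by move: hy; rewrite /mink; lra.
    have := sqr_ge0 (x 0 1 * y 0 2 - x 0 2 * y 0 1).
    have := sqr_ge0 (x 0 1); have := sqr_ge0 (x 0 2).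
    have := sqr_ge0 (y 0 1); have := sqr_ge0 (y 0 2); lra.
  have : x 0 1 * y 0 1 + x 0 2 * y 0 2 <= x 0 0 * y 0 0.
    have p0 : 0 <= x 0 0 * y 0 0 by exact/ltW/mulr_gt0.
    apply: le_trans (ler_norm _) _; rewrite -ler_sqr ?nnegrE//.
    by rewrite real_normK ?num_real.
  by rewrite /mink; lra.
have : 1 <= - mink x y by rewrite -ler_sqr ?nnegrE ?ler01 ?oppr_ge0// sqrrN expr1n.
lra.
Qed.

Lemma hyp_mink_eq x y : hyp x -> hyp y -> mink x y = -1 -> x = y.
Proof.
move=> hx hy xy; have [hx1 _] := hx; have [hy1 _] := hy.
have := @mink_tangent_eq0 x (y - x) hx1.
rewrite !minkE hx1 hy1 (minkC y x) xy => /(_ _ _)h.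
by apply/esym/eqP; rewrite -subr_eq0; apply/eqP/h; ring.
Qed.

Lemma hyp_neq_mink x y : hyp x -> hyp y -> x <> y -> mink x y < -1.
Proof.
move=> hx hy xy; rewrite lt_neqAle hyp_mink_le// andbT; apply/eqP => e; apply: xy.
exact: hyp_mink_eq.
Qed.

Definition future y := mink y y < 0 /\ 0 < y 0 0.

Definition normalize y : vec := (Num.sqrt (- mink y y))^-1 *: y.

Lemma normalizeE y : future y -> exists2 k, 0 < k & normalize y = k *: y.
Proof.
move=> [h _]; exists (Num.sqrt (- mink y y))^-1 => //.
by rewrite invr_gt0 sqrtr_gt0 oppr_gt0.
Qed.

Lemma hyp_normalize y : future y -> hyp (normalize y).
Proof.
move=> [h y0]; have s0 : 0 < Num.sqrt (- mink y y) by rewrite sqrtr_gt0 oppr_gt0.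
have sn : Num.sqrt (- mink y y) != 0 by rewrite gt_eqF.
split; last by rewrite !mxE mulr_gt0 ?invr_gt0.
rewrite !minkE; have : Num.sqrt (- mink y y) ^+ 2 = - mink y y by rewrite sqr_sqrtr// oppr_ge0 ltW.
move: sn; set k := Num.sqrt _ => kn kE; rewrite (_ : mink y y = - k ^+ 2); last by rewrite kE opprK.
by field.
Qed.

Lemma future_comb x y k l : hyp x -> hyp y -> 0 <= k -> 0 <= l -> 0 < k + l ->
  future (k *: x + l *: y).
Proof.
move=> hx hy k0 l0 kl; have xy := hyp_mink_le hx hy.
have [hx1 x0] := hx; have [hy1 y0] := hy; split.
  rewrite !minkE hx1 hy1 (minkC y x).
  have h : k * l * (- mink x y) >= 0 by rewrite mulr_ge0 ?mulr_ge0//; lra.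
  have : 0 < (k + l) * (k + l) by exact: mulr_gt0.
  have : k * l * (- mink x y) >= k * l by rewrite ler_peMr ?mulr_ge0//; lra.
  by nra.
rewrite !mxE; have [k1|k1] := eqVneq k 0; first by rewrite k1 mul0r add0r mulr_gt0//; lra.
apply: ltr_pwDl; last by rewrite mulr_ge0// ltW.
by rewrite mulr_gt0// lt_neqAle eq_sym k1.
Qed.

(* If [n] separates [x] from [y] then [y] is at least as far from [x] as the
   geodesic orthogonal to [n]. *)
Lemma mink_separated n x y : hyp x -> hyp y -> 0 <= mink n x -> mink n y <= 0 ->
  mink n x ^+ 2 + mink n n <= mink n n * mink x y ^+ 2.
Proof.
move=> hx hy nx ny; have [hx1 x0] := hx; have [hy1 y0] := hy.
have D1 := hyp_mink_le hx hy.
set f := mink n x in nx *; set g := mink n y in ny *; set d := mink x y in D1 *.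
have cx : mink x (n + f *: x) = 0 by rewrite !minkE hx1 (minkC x n) -/f; ring.
have cy : mink x (y + d *: x) = 0 by rewrite !minkE hx1 -/d; ring.
have := mink_cauchy hx1 cx cy; rewrite !minkE hx1 hy1 (minkC x n) (minkC y x) -/f -/g -/d.
have : d * f <= 0 by rewrite mulr_le0_ge0//; lra.
nra.
Qed.

End Minkowski.

Section Frames.
Local Open Scope ring_scope.
Variable R : realType.
Local Notation vec := 'rV[R]_3.
Implicit Types (x y z u c e f : vec).

Definition frame c e f : Prop :=
  [/\ hyp c, unit_tangent c e, unit_tangent c f, mink e f = 0 & det3 c e f = 1].

Lemma frame_of c e f : hyp c -> unit_tangent c e -> unit_tangent c f ->
  mink e f = 0 -> 0 < det3 c e f -> frame c e f.
Proof.
move=> hc he hf ef d0; split=> //; have [hc1 _] := hc; have [ce ee] := he; have [cf ff] := hf.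
have := det3_sq c e f; rewrite hc1 ce ee cf ff ef => h.
have : (det3 c e f - 1) * (det3 c e f + 1) = 0 by rewrite -subr_sqr h; ring.
by move/eqP; rewrite mulf_eq0 => /orP[]; [rewrite subr_eq0 => /eqP|move/eqP; lra].
Qed.

Definition fr c e f (a b d : R) : vec := a *: c + b *: e + d *: f.

Lemma mink_fr c e f a b d a' b' d' : frame c e f ->
  mink (fr c e f a b d) (fr c e f a' b' d') = - (a * a') + b * b' + d * d'.
Proof.
move=> [[hc _] [ce ee] [cf ff] ef _]; rewrite !minkE hc ce ee cf ff ef.
by rewrite (minkC e c) (minkC f c) (minkC f e) ce cf ef; ring.
Qed.

Lemma det3_fr c e f a b d a' b' d' a2 b2 d2 : frame c e f ->
  det3 (fr c e f a b d) (fr c e f a' b' d') (fr c e f a2 b2 d2) =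
  a * (b' * d2 - d' * b2) - b * (a' * d2 - d' * a2) + d * (a' * b2 - b' * a2).
Proof.
move=> [_ _ _ _ h]; rewrite -[RHS]mulr1 -h !det3E !mxE; ring.
Qed.

Lemma fr100 c e f : fr c e f 1 0 0 = c.
Proof. by rewrite /fr scale1r !scale0r !addr0. Qed.

Lemma frame_decomp c e f z : frame c e f ->
  z = fr c e f (- mink c z) (mink e z) (mink f z).
Proof.
move=> F; have [[hc _] [ce ee] [cf ff] ef h] := F.
have := det3_cramer c e f z; rewrite h scale1r -/(fr c e f _ _ _).
set a := det3 _ _ _; set b := det3 _ _ _; set d := det3 _ _ _ => ->.
have m1 x (k l : R) : mink x (fr c e f k l d) = k * mink x c + l * mink x e + d * mink x f.
  by rewrite /fr !minkE.
rewrite !m1 hc ee ff ef ce cf (minkC e c) (minkC f c) (minkC f e) ce cf ef.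
by rewrite !(mulr0, mulr1, addr0, add0r, mulrN1) opprK.
Qed.

Lemma frame_exists x : hyp x -> exists e f, frame x e f.
Proof.
move=> hx; have [h x0] := hx.
set a := x 0 0 in x0; set b := x 0 1; set d := x 0 2.
have k0 : 1 + a != 0 by rewrite gt_eqF// addr_gt0.
have h2 : a * a = 1 + b * b + d * d by move: h; rewrite /mink -/a -/b -/d; lra.
(* The images of the two spatial basis vectors under the Lorentz boost that carries (1, 0, 0) to
   [x]. *)
pose e := vec3 b (1 + b * b / (1 + a)) (b * d / (1 + a)).
pose f := vec3 d (b * d / (1 + a)) (1 + d * d / (1 + a)).
have bb : b * b = a * a - 1 - d * d by lra.
have aa : a * a - 1 = (a - 1) * (1 + a) by ring.
have E1 : b * b / (1 + a) + d * d / (1 + a) = a - 1.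
  by rewrite -mulrDl (_ : b * b + d * d = (a - 1) * (1 + a)) ?mulfK//; rewrite -aa; lra.
set p := b * b / (1 + a) in e E1; set r := d * d / (1 + a) in f E1; set t := b * d / (1 + a) in e f.
have tb : t * b = p * d by rewrite /t /p; ring.
have td : t * d = r * b by rewrite /t /r; ring.
have tt : t * t = p * r by rewrite /t /p /r; ring.
have pa : p * (1 + a) = b * b by rewrite /p divfK.
have ra : r * (1 + a) = d * d by rewrite /r divfK.
have ta : t * (1 + a) = b * d by rewrite /t divfK.
exists e, f; apply: frame_of => //.
- split; rewrite /mink /e !vec3E -/a -/b -/d.
    have -> : - (a * b) + b * (1 + p) + d * t = b * (1 - a + p) + t * d by ring.
    rewrite td; have -> : r = a - 1 - p by lra.
    ring.
  have -> : - (b * b) + (1 + p) * (1 + p) + t * t = 1 - b * b + p * (2 + p + r) by rewrite tt; ring.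
  by rewrite (_ : 2 + p + r = 1 + a) ?pa; lra.
- split; rewrite /mink /f !vec3E -/a -/b -/d.
    have -> : - (a * d) + b * t + d * (1 + r) = d * (1 - a + r) + t * b by ring.
    rewrite tb; have -> : r = a - 1 - p by lra.
    ring.
  have -> : - (d * d) + t * t + (1 + r) * (1 + r) = 1 - d * d + r * (2 + p + r) by rewrite tt; ring.
  by rewrite (_ : 2 + p + r = 1 + a) ?ra; lra.
- rewrite /mink /e /f !vec3E.
  have -> : - (b * d) + (1 + p) * t + t * (1 + r) = t * (2 + p + r) - b * d by ring.
  by rewrite (_ : 2 + p + r = 1 + a) ?ta; lra.
- rewrite det3E /e /f !vec3E -/a -/b -/d.
  have -> : a * ((1 + p) * (1 + r) - t * t) - b * (b * (1 + r) - t * d) + d * (b * t - (1 + p) * d) =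
     a * (1 + p + r + p * r - t * t) - b * b - d * d - (b * b) * r - (d * d) * p + b * (t * d) + d * (t * b) by ring.
  rewrite tt td tb; have -> : 1 + p + r = a by lra.
  by have : a * a = 1 + b * b + d * d by []; lra.
Qed.

End Frames.

(** * Metric relations in a regular polygon *)

Section RegularPolygon.
Local Open Scope ring_scope.
Variables (R : realType) (p : nat).
Hypothesis p5 : (5 <= p)%N.
Local Notation vec := 'rV[R]_3.
Implicit Types (c e f : vec) (v : nat -> vec) (S : R).

(* [S] is the hyperbolic sine of the circumradius. *)
Definition regular_of v S : Prop := exists c e f, [/\ frame c e f, 0 < S &
  forall k, v k = fr c e f (Num.sqrt (1 + S ^+ 2))
    (S * cos (2 * pi * k%:R / p%:R)) (S * sin (2 * pi * k%:R / p%:R))].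

Lemma regular_ofP v : regular_vertices p v -> exists S, regular_of v S.
Proof.
move=> [c [e [f [r [[hc he hf [ef d0] r0] vE]]]]]; exists (sinhR r), c, e, f.
have F := frame_of hc he hf ef d0; split=> //.
  by rewrite /sinhR divr_gt0// subr_gt0 ltr_expR; lra.
move=> k; rewrite vE /geod /fr scalerDr !scalerA addrA; congr (_ *: _ + _ + _).
have -> : 1 + sinhR r ^+ 2 = coshR r ^+ 2.
  have : expR r * expR (- r) = 1 by rewrite -expRD subrr expR0.
  rewrite /sinhR /coshR; set a := expR r; set b := expR (- r) => ab.
  have -> : ((a + b) / 2) ^+ 2 = ((a - b) / 2) ^+ 2 + a * b by field.
  by rewrite ab addrC.
by rewrite sqrtr_sqr ger0_norm// /coshR divr_ge0// addr_ge0// expR_ge0.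
Qed.

(** The sine of half the central angle between two vertices [m] steps apart. *)
Definition sk (m : nat) : R := sin (pi * m%:R / p%:R).

Let p0 : (0 : R) < p%:R. Proof. by rewrite ltr0n; lia. Qed.
Let pn : p%:R != 0 :> R. Proof. by rewrite gt_eqF. Qed.

Lemma sk0 : sk 0 = 0. Proof. by rewrite /sk mulr0 mul0r sin0. Qed.

Lemma sk_gt0 m : (0 < m < p)%N -> 0 < sk m.
Proof.
move=> /andP[m0 mp]; apply: sin_gt0_pi; apply/andP; split.
  by rewrite divr_gt0// mulr_gt0 ?pi_gt0 ?ltr0n.
by rewrite ltr_pdivrMr// ltr_pM2l ?pi_gt0// ltr_nat.
Qed.

Lemma sk_rev m : (m <= p)%N -> sk (p - m) = sk m.
Proof.
move=> mp; rewrite /sk natrB// mulrBr mulrBl mulfK//.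
by rewrite sinB sinpi cospi mul0r sub0r mulN1r opprK.
Qed.

Let sk_lt_half m : (2 <= m)%N -> (m.*2 <= p)%N -> sk 1 < sk m.
Proof.
move=> m2 mp; have ipi := pi_gt0 R.
have half k : (k.*2 <= p)%N -> - (pi / 2) <= (pi * k%:R / p%:R : R) <= pi / 2.
  move=> kp; apply/andP; split.
    apply: (@le_trans _ _ 0); first by rewrite oppr_le0 divr_ge0// ltW.
    by rewrite divr_ge0// ?mulr_ge0 ?ler0n// ltW.
  rewrite ler_pdivrMr// mulrAC ler_pdivlMr// -mulrA ler_pM2l// -natrM ler_nat; lia.
rewrite /sk ltr_sin ?in_itv/= ?half//; last by lia.
rewrite ltr_pM2r ?invr_gt0// ltr_pM2l// ltr_nat; lia.
Qed.

Lemma sk1_lt m : (2 <= m)%N -> (m.+2 <= p)%N -> sk 1 < sk m.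
Proof.
move=> m2 mp; have [h|h] := leqP m.*2 p; first exact: sk_lt_half.
rewrite -(sk_rev (m := m)); last lia.
by apply: sk_lt_half; lia.
Qed.

Lemma sk1_le m : (0 < m < p)%N -> sk 1 <= sk m.
Proof.
move=> /andP[m0 mp]; have [->//|m1] := eqVneq m 1%N.
have [mp1|mp1] := eqVneq m.+1 p; last by apply/ltW/sk1_lt; lia.
rewrite -(sk_rev (m := m)); last lia.
by rewrite (_ : (p - m = 1)%N)//; lia.
Qed.

Lemma sk_le1 m : sk m <= 1. Proof. exact: sin_le1. Qed.

Lemma sk1_gt0 : 0 < sk 1. Proof. by apply: sk_gt0; lia. Qed.

Lemma sk1_lt1 : sk 1 < 1.
Proof. by apply: lt_le_trans (sk1_lt (m := 2) isT _) (sk_le1 2); lia. Qed.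

Section Fixed.
Variables (v : nat -> vec) (S : R).
Hypothesis vS : regular_of v S.
Let C := Num.sqrt (1 + S ^+ 2).

Let C2 : C ^+ 2 = 1 + S ^+ 2.
Proof. by rewrite sqr_sqrtr// addr_ge0// sqr_ge0. Qed.

Let C0 : 0 < C.
Proof. by rewrite sqrtr_gt0 ltr_pwDl// sqr_ge0. Qed.

Lemma reg_S_gt0 : 0 < S. Proof. by have [c [e [f []]]] := vS. Qed.

Let t (k : nat) : R := 2 * pi * k%:R / p%:R.

Let tD i m : t (i + m) = t i + (pi * m%:R / p%:R) *+ 2.
Proof. by rewrite /t natrD mulr2n; field. Qed.

Lemma reg_per k : v (k + p) = v k.
Proof.
have [c [e [f [F S0 vE]]]] := vS; rewrite !vE -!/(t _).
have -> : t (k + p) = t k + pi *+ 2 by rewrite tD mulfK.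
by rewrite cosD2pi sinD2pi.
Qed.

Lemma reg_perM k n : v (k + n * p) = v k.
Proof. by elim: n => [|n IH]; rewrite ?mul0n ?addn0// mulSnr addnA reg_per. Qed.

Lemma reg_mod_shift i j : exists2 m, (m < p)%N & forall l, v (j + l) = v (i + m + l).
Proof.
have p0n : (0 < p)%N by lia.
exists ((j + (i * p - i)) %% p)%N; first by rewrite ltn_mod.
have := divn_eq (j + (i * p - i)) p; set a := (_ %/ _)%N; set m := (_ %% _)%N => h l.
rewrite -(reg_perM (j + l) i) -(reg_perM (i + m + l) a); congr v.
have : (i <= i * p)%N by rewrite leq_pmulr.
lia.
Qed.

Lemma reg_mod i j : exists2 m, (m < p)%N & v j = v (i + m).
Proof.
have [m mp h] := reg_mod_shift i j; exists m => //.
by have := h 0%N; rewrite !addn0.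
Qed.

(** With [d] the distance of the two vertices, this is [sinh (d/2) = S sk m] squared. *)
Lemma reg_mink i m : mink (v i) (v (i + m)) = - (1 + 2 * S ^+ 2 * sk m ^+ 2).
Proof.
have [c [e [f [F S0 vE]]]] := vS; rewrite !vE mink_fr// -!/(t _) tD -/C -expr2 C2.
rewrite cosD sinD cos_mulr2n sin_mulr2n -/(sk m).
set x := pi * m%:R / p%:R; have := cos2Dsin2 x; have := cos2Dsin2 (t i); rewrite -[sin x]/(sk m).
set a := cos (t i); set b := sin (t i); set k := cos x; set l := sk m => h1 h2.
have -> : - (1 + S ^+ 2) + S * a * (S * (a * (k ^+ 2 *+ 2 - 1) - b * ((k * l) *+ 2))) +
   S * b * (S * (b * (k ^+ 2 *+ 2 - 1) + a * ((k * l) *+ 2))) =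
   - (1 + S ^+ 2) + S ^+ 2 * (a ^+ 2 + b ^+ 2) * (2 * k ^+ 2 - 1) by ring.
by rewrite h1 (_ : k ^+ 2 = 1 - l ^+ 2); [ring|lra].
Qed.

Lemma reg_hyp k : hyp (v k).
Proof.
split; first by have := reg_mink k 0; rewrite addn0 sk0 => ->; rewrite expr0n/= mulr0 addr0.
have [c [e [f [F S0 vE]]]] := vS; rewrite vE.
have [hc [ce ee] [cf ff] ef _] := F; have [hc1 c00] := hc.
pose u := S * cos (t k); pose w := S * sin (t k).
have : mink (fr c e f C u w) (fr c e f C u w) = -1.
  rewrite mink_fr// -expr2 C2 /u /w; have := cos2Dsin2 (t k); nra.
have m1 : mink c (fr c e f C u w) = - C.
  by rewrite /fr !minkE hc1 ce cf; ring.
rewrite -/(t k) -/C -/u -/w; set z := fr _ _ _ _ _ _ in m1 * => z1.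
apply: contrapT => /negP; rewrite -leNgt => z0.
have zn : hyp (- z) \/ z 0 0 = 0.
  have [->|zz] := eqVneq (z 0 0) 0; [by right|left; split; first by rewrite minkNl minkNr z1; ring].
  by rewrite mxE oppr_gt0 lt_neqAle zz.
case: zn => [zn|z00].
  have := hyp_mink_le hc zn; rewrite minkNr m1 opprK => h.
  by have := lt_le_trans C0 h; rewrite oppr_gt0 ltr10.
by have := z1; rewrite /mink z00; have := sqr_ge0 (z 0 1); have := sqr_ge0 (z 0 2); nra.
Qed.

Let det_pt c e f (x y z : R) : frame c e f ->
  det3 (fr c e f C (S * cos x) (S * sin x))
       (fr c e f C (S * cos (x + y *+ 2)) (S * sin (x + y *+ 2)))
       (fr c e f C (S * cos (x + (y + z) *+ 2)) (S * sin (x + (y + z) *+ 2))) =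
  4 * C * S ^+ 2 * sin y * sin z * sin (y + z).
Proof.
have dbl (y' : R) : cos (y' *+ 2) = cos y' ^+ 2 - sin y' ^+ 2.
  by rewrite cos_mulr2n; have := cos2Dsin2 y'; lra.
move=> F; rewrite det3_fr// !(cosD x) !(sinD x) !dbl !sin_mulr2n (cosD y z) (sinD y z).
have := cos2Dsin2 x; have := cos2Dsin2 y; have := cos2Dsin2 z.
set a := cos x; set b := sin x; set k := cos y; set l := sin y; set m := cos z; set n := sin z.
move=> hz hy hx.
transitivity (C * S ^+ 2 * (a ^+ 2 + b ^+ 2) * ((k ^+ 2 + l ^+ 2) ^+ 2 * (2 * m * n)
   - 2 * (k * m - l * n) * (l * m + k * n) + 2 * k * l)); first by ring.
rewrite hx hy; apply/eqP; rewrite -subr_eq0; apply/eqP.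
transitivity (C * S ^+ 2 * (2 * m * n * (1 - (k ^+ 2 + l ^+ 2))
   + 2 * k * l * (1 - (m ^+ 2 + n ^+ 2)))); first by ring.
by rewrite hy hz; ring.
Qed.

(** This product formula reduces the orientation of vertices, and their height over the line of a
    side, to signs and bounds for sines of multiples of [pi/p]. *)
Lemma reg_det i m :
  det3 (v i) (v i.+1) (v (i + m.+1)) = 4 * C * S ^+ 2 * sk 1 * sk m * sk m.+1.
Proof.
have [c [e [f [F S0 vE]]]] := vS.
have e1 : pi * 1%:R / p%:R + pi * m%:R / p%:R = pi * m.+1%:R / p%:R :> R.
  by rewrite -mulrDl -mulrDr -natrD add1n.
have := det_pt (t i) (pi * 1%:R / p%:R) (pi * m%:R / p%:R) F; rewrite e1 => h.
by rewrite !vE -!/(t _) -(addn1 i) !tD.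
Qed.

Let K0 : 0 < 4 * C * S ^+ 2 * sk 1.
Proof.
apply: mulr_gt0; last exact: sk1_gt0.
apply: mulr_gt0; last exact/exprn_gt0/reg_S_gt0.
by apply: mulr_gt0; last exact: C0.
Qed.

Lemma reg_det_ge0 i j : 0 <= det3 (v i) (v i.+1) (v j).
Proof.
have [m mp ->] := reg_mod i j; case: m mp => [_|m mp].
  by rewrite addn0 det3xyx.
rewrite reg_det; have S0 := reg_S_gt0.
case: m mp => [_|m mp]; first by rewrite sk0 mulr0 mul0r.
have k1 : 0 < sk m.+1 by apply: sk_gt0; lia.
have k2 : 0 < sk m.+2 by apply: sk_gt0; lia.
by apply: mulr_ge0 (ltW k2); apply: mulr_ge0 (ltW k1); exact/ltW.
Qed.

Lemma reg_det_ge i j : v j = v i \/ v j = v i.+1 \/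
  4 * C * S ^+ 2 * sk 1 ^+ 3 <= det3 (v i) (v i.+1) (v j).
Proof.
have [m mp ->] := reg_mod i j; case: m mp => [_|[_|m mp]].
- by left; rewrite addn0.
- by right; left; rewrite addn1.
right; right; rewrite reg_det; have k0 := ltW K0.
rewrite (_ : 4 * C * S ^+ 2 * sk 1 ^+ 3 = 4 * C * S ^+ 2 * sk 1 * sk 1 * sk 1); last by ring.
have s1 : sk 1 <= sk m.+1 by apply: sk1_le; lia.
have s2 : sk 1 <= sk m.+2 by apply: sk1_le; lia.
apply: ler_pM s2; [|exact/ltW/sk1_gt0|exact: ler_wpM2l].
by apply: mulr_ge0 => //; exact/ltW/sk1_gt0.
Qed.

Lemma reg_det_gt0 i j : v j = v i \/ v j = v i.+1 \/ 0 < det3 (v i) (v i.+1) (v j).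
Proof.
case: (reg_det_ge i j) => [|[|h]]; [by left|by right; left|right; right].
apply: lt_le_trans h; rewrite (_ : sk 1 ^+ 3 = sk 1 * sk 1 ^+ 2); last by ring.
by rewrite mulrA; apply: mulr_gt0 => //; exact/exprn_gt0/sk1_gt0.
Qed.

Lemma reg_pred i : (0 < i)%N -> 0 < det3 (v i) (v i.+1) (v i.-1).
Proof.
move=> i0; have -> : v i.-1 = v (i + (p.-2).+1).
  by rewrite -[LHS]reg_per; congr v; lia.
rewrite reg_det; have S0 := reg_S_gt0.
have k1 : 0 < sk p.-2 by apply: sk_gt0; lia.
have k2 : 0 < sk p.-2.+1 by apply: sk_gt0; lia.
by apply: mulr_gt0 k2; apply: mulr_gt0 k1.
Qed.

Lemma reg_mink_adj i : mink (v i) (v i.+1) = - (1 + 2 * S ^+ 2 * sk 1 ^+ 2).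
Proof. by rewrite -(addn1 i) reg_mink. Qed.

Lemma reg_mink_le i j : v i = v j \/ mink (v i) (v j) <= - (1 + 2 * S ^+ 2 * sk 1 ^+ 2).
Proof.
have [m mp ->] := reg_mod i j; case: m mp => [_|m mp]; first by left; rewrite addn0.
have s1 : sk 1 <= sk m.+1 by exact: sk1_le.
right; rewrite reg_mink lerN2 lerD2l; apply: ler_wpM2l.
  by apply: mulr_ge0 => //; exact: sqr_ge0.
by rewrite ler_sqr ?nnegrE ?(le_trans _ s1) ?(ltW sk1_gt0).
Qed.

Lemma reg_neq i : v i <> v i.+1.
Proof.
move=> e; have [h _] := reg_hyp i; move: (reg_mink_adj i); rewrite -e h.
have := reg_S_gt0; have := sk1_gt0 => k0 S0; have : 0 < S ^+ 2 * sk 1 ^+ 2.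
  by rewrite mulr_gt0// exprn_gt0.
lra.
Qed.

(** The last clause puts the polygon inside its circumscribed disc: a point that satisfies the
    inequality of the side it faces cannot be farther from the centre than a vertex. *)
Lemma reg_center : exists c, [/\ hyp c, forall k, mink c (v k) = - C,
  forall k, 0 < det3 (v k) (v k.+1) c &
  forall z, polygon v z -> - mink c z <= C].
Proof.
have [c [e [f [F S0 vE]]]] := vS; have [hc [ce ee] [cf ff] ef _] := F.
have [hc1 _] := hc; pose th : R := pi * 1%:R / p%:R.
have st : 0 < sin th by exact: sk1_gt0.
have ct : 0 < cos th.
  apply: cos_gt0_pihalf; have := pi_gt0 R => ipi; apply/andP; split.
    by apply: (@lt_trans _ _ 0); rewrite ?oppr_lt0 /th ?divr_gt0 ?mulr_gt0.
  rewrite /th mulr1 ltr_pM2l// ltf_pV2 ?posrE//.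
  by rewrite ltr_nat; lia.
have tS k : t k.+1 = t k + th *+ 2 by rewrite -(addn1 k) tD.
have dbl (y' : R) : cos (y' *+ 2) = cos y' ^+ 2 - sin y' ^+ 2.
  by rewrite cos_mulr2n; have := cos2Dsin2 y'; lra.
have cs := cos2Dsin2 th.
have detE k z : det3 (v k) (v k.+1) z = 2 * S * sin th *
   ((- mink c z) * S * cos th - C * (mink e z * cos (t k + th) + mink f z * sin (t k + th))).
  rewrite {1}(frame_decomp z F) !vE -!/(t _) tS det3_fr// -/C.
  set z0 := - mink c z; set z1 := mink e z; set z2 := mink f z.
  rewrite !(cosD (t k)) !(sinD (t k)) dbl sin_mulr2n; have := cos2Dsin2 (t k).
  move: cs; set a := cos (t k); set b := sin (t k); set x := cos th; set y := sin th => h1 h2.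
  apply/eqP; rewrite -subr_eq0; apply/eqP.
  transitivity (2 * S ^+ 2 * z0 * x * y * (a ^+ 2 + b ^+ 2 - 1) +
     C * S * (a * z2 - b * z1) * (x ^+ 2 + y ^+ 2 - 1)); first by ring.
  by rewrite h1 h2; ring.
have cc k : mink c (v k) = - C.
  by rewrite vE /fr !minkE hc1 ce cf; rewrite -/C; ring.
exists c; split=> // [k|z [hz Pz]].
  by rewrite detE hc1 (minkC e c) (minkC f c) ce cf !mul0r addr0 mulr0 subr0 !mulr_gt0 ?opprK.
have [hz1 _] := hz.
set z0 := - mink c z; pose z1 := mink e z; pose z2 := mink f z.
have z01 : z0 ^+ 2 = 1 + z1 ^+ 2 + z2 ^+ 2.
  have := mink_fr z0 z1 z2 z0 z1 z2 F.
  by rewrite -(frame_decomp z F) hz1 => h; rewrite !expr2; lra.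
have z0ge : 1 <= z0 by rewrite /z0; have := hyp_mink_le hc hz; lra.
pose g k := z1 * cos (t k + th) + z2 * sin (t k + th).
pose g' k := - z1 * sin (t k + th) + z2 * cos (t k + th).
have gle k : C * g k <= z0 * S * cos th.
  have := Pz k; rewrite detE -/z0 -/z1 -/z2 -/(g k) pmulr_rge0 ?subr_ge0//.
  by rewrite !mulr_gt0.
(* The side faced by [z]: [g k] is the component of [z] towards its midpoint and [g' k] the
   transverse one. Comparison with both adjacent sides shows that [z] deviates from that midpoint
   direction by at most half a central angle. *)
have [k kmax] : exists k, forall j, g j <= g k.
  have p0n : (0 < p)%N by lia.
  have [k _ kmax] := @arg_maxP _ _ 'I_p (Ordinal p0n) xpredT (fun i : 'I_p => g i) isT.
  exists k => j.
  have per i n : g (i + n * p)%N = g i.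
    elim: n => [|n IH]; first by rewrite mul0n addn0.
    rewrite mulSnr addnA -IH /g; set l := (i + n * p)%N.
    have -> : t (l + p) + th = t l + th + pi *+ 2 by rewrite tD mulfK//; ring.
    by rewrite cosD2pi sinD2pi.
  by rewrite (divn_eq j p) addnC per; apply: (kmax (Ordinal (ltn_pmod j p0n))).
have gn j : g j.+1 = g j * cos (th *+ 2) + g' j * sin (th *+ 2).
  rewrite /g /g' tS (_ : t j + th *+ 2 + th = (t j + th) + th *+ 2); last by ring.
  by rewrite (cosD (t j + th)) (sinD (t j + th)); ring.
have gp : g (k + p.-1)%N = g k * cos (th *+ 2) - g' k * sin (th *+ 2).
  have -> : g (k + p.-1)%N = z1 * cos (t k + th - th *+ 2) + z2 * sin (t k + th - th *+ 2).
    have et : t (k + p.-1) + th = t k + th - th *+ 2 + pi *+ 2.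
      rewrite tD (_ : p.-1 = p - 1)%N; last by lia.
      rewrite natrB; last by lia.
      by rewrite /th; field.
    by rewrite /g et cosD2pi sinD2pi.
  by rewrite (cosB (t k + th)) (sinB (t k + th)) /g /g'; ring.
have h1 := kmax k.+1; have h2 := kmax (k + p.-1)%N.
rewrite gn in h1; rewrite gp in h2; rewrite dbl sin_mulr2n in h1 h2.
have sum2 : g k ^+ 2 + g' k ^+ 2 = z1 ^+ 2 + z2 ^+ 2.
  have := cos2Dsin2 (t k + th); rewrite /g /g'.
  set a := cos _; set b := sin _ => ab.
  transitivity ((z1 ^+ 2 + z2 ^+ 2) * (a ^+ 2 + b ^+ 2)); first by ring.
  by rewrite ab mulr1.
move: (gle k) h1 h2 sum2 cs st ct; set f0 := g k; set f1 := g' k.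
set x := cos th; set y := sin th => h0 h1 h2 h3 h4 h5 h6.
have x2 : x ^+ 2 = 1 - y ^+ 2 by lra.
have yy : 0 < y ^+ 2 by exact: exprn_gt0.
have f00 : 0 <= f0.
  have : 0 <= 4 * y ^+ 2 * f0 by move: h1 h2; rewrite x2; lra.
  by rewrite pmulr_rge0// mulr_gt0.
have k1 : f1 * x <= f0 * y.
  have : 0 <= 2 * y * (f0 * y - f1 * x) by move: h1; rewrite x2; lra.
  by rewrite pmulr_rge0 ?subr_ge0// mulr_gt0.
have k2 : - (f1 * x) <= f0 * y.
  have : 0 <= 2 * y * (f0 * y + f1 * x) by move: h2; rewrite x2; lra.
  by rewrite pmulr_rge0 ?mulr_gt0//; lra.
have k3 : (f1 * x) ^+ 2 <= (f0 * y) ^+ 2.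
  have p1 : 0 <= f0 * y - f1 * x by lra.
  have p2 : 0 <= f0 * y + f1 * x by lra.
  by have := mulr_ge0 p1 p2; lra.
have k4 : (C * f0) ^+ 2 <= (z0 * S * x) ^+ 2.
  by rewrite ler_sqr ?nnegrE// ?mulr_ge0 ?(ltW C0)//; [lra|exact/ltW/reg_S_gt0|exact: ltW].
have k5 : (z0 ^+ 2 - 1) * x ^+ 2 <= f0 ^+ 2.
  have -> : z0 ^+ 2 - 1 = f0 ^+ 2 + f1 ^+ 2 by lra.
  have : f0 ^+ 2 * y ^+ 2 = f0 ^+ 2 - f0 ^+ 2 * x ^+ 2 by rewrite x2; ring.
  move: k3; rewrite !exprMn; lra.
have k6 : C ^+ 2 * (z0 ^+ 2 - 1) <= z0 ^+ 2 * S ^+ 2.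
  have xx : 0 < x ^+ 2 by exact: exprn_gt0.
  rewrite -(ler_pM2r xx); apply: le_trans (_ : C ^+ 2 * f0 ^+ 2 <= _).
    by rewrite -mulrA ler_pM2l// exprn_gt0// C0.
  by move: k4; rewrite !exprMn.
rewrite -(@ler_sqr _ z0) ?nnegrE ?(ltW C0)//; last by lra.
by move: k6; rewrite C2; lra.
Qed.

End Fixed.
End RegularPolygon.

(** * Tilings by regular polygons *)

Section Polygons.
Local Open Scope ring_scope.
Variables (R : realType) (p : nat).
Hypothesis p5 : (5 <= p)%N.
Local Notation vec := 'rV[R]_3.
Implicit Types (x y z u c : vec) (v w : nat -> vec) (S : R).

Lemma hyp_scale x y k : hyp x -> hyp y -> y = k *: x -> y = x.
Proof.
move=> [hx x0] [hy y0] e; have k0 : 0 < k by move: y0; rewrite e mxE pmulr_lgt0.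
move: hy; rewrite e !minkE hx => h.
have : (k - 1) * (k + 1) = 0 by lra.
move/eqP; rewrite mulf_eq0 subr_eq0 => /orP[/eqP->|]; first by rewrite scale1r.
by rewrite gt_eqF// addr_gt0.
Qed.

Lemma future_near m u : hyp m ->
  exists2 d, 0 < d & forall e, 0 < e <= d -> future (m + e *: u).
Proof.
move=> [hm m0].
have ge0 (x : R) : 0 <= `|x| by [].
set a := mink m u; set b := mink u u; set k := u 0 0 / m 0 0.
have D1 : 1 <= 1 + 2 * `|a| + `|b| + `|k|.
  by have := ge0 a; have := ge0 b; have := ge0 k; lra.
exists (1 + 2 * `|a| + `|b| + `|k|)^-1; first by rewrite invr_gt0 (lt_le_trans _ D1).
move=> e /andP[e0 ed].
have h : e * (1 + 2 * `|a| + `|b| + `|k|) <= 1.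
  by rewrite -ler_pdivlMr ?mul1r// (lt_le_trans _ D1).
have e1 : e <= 1 by apply: le_trans h; rewrite ler_peMr// ltW.
have ha : e * a <= e * `|a| by rewrite ler_pM2l// ler_norm.
have hb : e * e * b <= e * `|b|.
  apply: (@le_trans _ _ (e * e * `|b|)).
    by rewrite ler_pM2l ?mulr_gt0// ler_norm.
  by apply: ler_wpM2r => //; rewrite ler_piMr// ltW.
have hk : - (e * k) <= e * `|k| by rewrite -mulrN ler_pM2l// -normrN ler_norm.
have := ge0 a; have := ge0 b; have := ge0 k => k1 b1 a1.
have p1 : 0 <= e * `|a| by rewrite mulr_ge0// ltW.
have p2 : 0 <= e * `|b| by rewrite mulr_ge0// ltW.
have p3 : 0 <= e * `|k| by rewrite mulr_ge0// ltW.
split; first by rewrite !minkE hm (minkC u m) -/a -/b; lra.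
have -> : (m + e *: u) 0 0 = m 0 0 * (1 + e * k).
  by rewrite !mxE /k; field; rewrite gt_eqF.
by rewrite mulr_gt0//; lra.
Qed.

Lemma polygon_normalize v y : future y ->
  polygon v (normalize y) <-> forall k, 0 <= det3 (v k) (v k.+1) y.
Proof.
move=> fy; have [k k0 e] := normalizeE fy; split.
  by move=> [_ h] i; have := h i; rewrite e det3Z pmulr_rge0.
by move=> h; split; [exact: hyp_normalize|move=> i; rewrite e det3Z pmulr_rge0].
Qed.

Section Fixed.
Variables (v : nat -> vec) (S : R).
Hypothesis vS : regular_of p v S.

Lemma reg_vertex_in j : polygon v (v j).
Proof. by split; [exact: reg_hyp vS j|move=> k; exact: (reg_det_ge0 p5 vS)]. Qed.

(** Indices are natural numbers, so a predecessor of 0 has to be looked for one period later; this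
    lets any vertex be written with a successor index. *)
Lemma reg_succ i : exists k, forall l, v (i + l)%N = v (k.+1 + l)%N.
Proof.
exists (i + p.-1)%N => l; rewrite -(reg_per p5 vS (i + l)); congr v; lia.
Qed.

Lemma reg_det_succ k : 0 < det3 (v k) (v k.+1) (v k.+2).
Proof.
have := reg_pred p5 vS (i := k.+1) isT; rewrite /= => h.
have [|[h2|//]] := reg_det_gt0 p5 vS k k.+2.
  by move=> e; move: h; rewrite e det3xyy ltxx.
by move: h; rewrite h2 det3_rot det3xyx ltxx.
Qed.

Lemma reg_plane x k : det3 (v k) (v k.+1) x = 0 ->
  exists s t, x = s *: v k + t *: v k.+1.
Proof.
move=> e; have d0 := reg_det_succ k.
have := det3_cramer (v k) (v k.+1) (v k.+2) x; rewrite e scale0r addr0 => h.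
exists ((det3 (v k) (v k.+1) (v k.+2))^-1 * det3 x (v k.+1) (v k.+2)),
  ((det3 (v k) (v k.+1) (v k.+2))^-1 * det3 (v k) x (v k.+2)).
by rewrite -!scalerA -scalerDr -h scalerA mulVf ?scale1r// gt_eqF.
Qed.

Lemma reg_boundary x k : polygon v x -> det3 (v k) (v k.+1) x = 0 ->
  segment (v k) (v k.+1) x.
Proof.
move=> [hx Px] e; have [s [t xE]] := reg_plane e; split=> //; exists s, t.
have [k' k'E] := reg_succ k; split=> //.
  have := Px k.+1; rewrite xE !det3r det3xyx mulr0 addr0 (det3_rot (v k.+1)).
  rewrite (det3_rot (v k.+2)) pmulr_lge0//; exact: reg_det_succ.
have e0 := k'E 0%N; have e1 := k'E 1%N; rewrite !addn0 in e0; rewrite !addn1 in e1.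
have := Px k'; rewrite xE !det3r e0 e1 det3xyy mulr0 add0r pmulr_lge0//.
exact: reg_det_succ.
Qed.

Lemma reg_corner y k : hyp y -> det3 (v k) (v k.+1) y = 0 ->
  det3 (v k.+1) (v k.+2) y = 0 -> y = v k.+1.
Proof.
move=> hy e1 e2; have [s [t yE]] := reg_plane e1.
apply: (hyp_scale (k := t) (reg_hyp p5 vS k.+1)) => //.
move: e2; rewrite yE !det3r det3xyx mulr0 addr0 (det3_rot (v k.+1)) (det3_rot (v k.+2)) => /eqP.
by rewrite mulf_eq0 (gt_eqF (reg_det_succ k)) orbF => /eqP->; rewrite scale0r add0r.
Qed.

(** The functionals of the two sides at the vertex vanish there and are nonnegative on the polygon,
    so they vanish at [y] and at [z]; their lines meet at the vertex only. *)
Lemma reg_extreme i y z s t : polygon v y -> polygon v z -> 0 < s -> 0 < t ->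
  v i = s *: y + t *: z -> y = z.
Proof.
move=> [hy Py] [hz Pz] s0 t0.
have [k kE] := reg_succ i; have -> : v i = v k.+1 by have := kE 0%N; rewrite !addn0.
move=> e.
have key j : det3 (v j) (v j.+1) (v k.+1) = 0 ->
    det3 (v j) (v j.+1) y = 0 /\ det3 (v j) (v j.+1) z = 0.
  rewrite e !det3r => /eqP; rewrite paddr_eq0 ?mulr_ge0 ?(ltW s0) ?(ltW t0)//.
  by rewrite !mulf_eq0 (gt_eqF s0) (gt_eqF t0) /= => /andP[/eqP-> /eqP->].
have [a1 a2] := key k (det3xyy _ _); have [b1 b2] := key k.+1 (det3xyx _ _).
by rewrite (reg_corner hy a1 b1) (reg_corner hz a2 b2).
Qed.

Lemma reg_edge_vertex i j : det3 (v i) (v i.+1) (v j) = 0 -> v j = v i \/ v j = v i.+1.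
Proof.
by move=> e; have [|[|]] := reg_det_gt0 p5 vS i j; [left|right|rewrite e ltxx].
Qed.

Lemma segment_det i x : segment (v i) (v i.+1) x -> det3 (v i) (v i.+1) x = 0.
Proof. by move=> [_ [s [t [_ _ ->]]]]; rewrite !det3r det3xyx det3xyy !mulr0 addr0. Qed.

End Fixed.

Lemma segment_endl x y : hyp x -> segment x y x.
Proof. by move=> hx; split=> //; exists 1, 0; rewrite scale1r scale0r addr0 ler01 lexx. Qed.

Lemma segment_endr x y : hyp y -> segment x y y.
Proof. by move=> hx; split=> //; exists 0, 1; rewrite scale1r scale0r add0r ler01 lexx. Qed.

(** A segment determines its end points as its extreme points, but not their order. *)
Lemma segment_vertex v S w U i j : regular_of p v S -> regular_of p w U ->
  segment (v i) (v i.+1) = segment (w j) (w j.+1) ->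
  (v i = w j /\ v i.+1 = w j.+1) \/ (v i = w j.+1 /\ v i.+1 = w j).
Proof.
move=> vS wU e.
have subP (w' : nat -> vec) U' k x : regular_of p w' U' -> segment (w' k) (w' k.+1) x -> polygon w' x.
  move=> wU' [hx [s [t [s0 t0 xE]]]]; split=> // l; rewrite xE !det3r.
  by rewrite addr_ge0// mulr_ge0// (reg_det_ge0 p5 wU').
have key x : hyp x -> segment (w j) (w j.+1) x -> (forall y z s t, segment (v i) (v i.+1) y ->
    segment (v i) (v i.+1) z -> 0 < s -> 0 < t -> x = s *: y + t *: z -> y = z) ->
    x = w j \/ x = w j.+1.
  move=> hx [_ [s [t [s0 t0 xE]]]] ext; have [s1|s1] := eqVneq s 0.
    right; apply: (hyp_scale (k := t) (reg_hyp p5 wU _)) => //; by rewrite xE s1 scale0r add0r.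
  have [t1|t1] := eqVneq t 0.
    left; apply: (hyp_scale (k := s) (reg_hyp p5 wU _)) => //; by rewrite xE t1 scale0r addr0.
  exfalso; apply: (reg_neq p5 wU (i := j)); apply: (ext _ _ s t); rewrite ?e.
  - exact/segment_endl/(reg_hyp p5 wU).
  - exact/segment_endr/(reg_hyp p5 wU).
  - by rewrite lt_neqAle eq_sym s1.
  - by rewrite lt_neqAle eq_sym t1.
  - by [].
have k1 : v i = w j \/ v i = w j.+1.
  apply: key; first exact: (reg_hyp p5 vS).
    by rewrite -e; apply/segment_endl/(reg_hyp p5 vS).
  by move=> y z s t /(subP _ _ _ _ vS)Py /(subP _ _ _ _ vS)Pz; exact: (reg_extreme vS).
have k2 : v i.+1 = w j \/ v i.+1 = w j.+1.
  apply: key; first exact: (reg_hyp p5 vS).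
    by rewrite -e; apply/segment_endr/(reg_hyp p5 vS).
  by move=> y z s t /(subP _ _ _ _ vS)Py /(subP _ _ _ _ vS)Pz; exact: (reg_extreme vS).
have n := reg_neq p5 vS (i := i).
case: k1 k2 => [a|a] [b|b]; [|by left|by right|]; by case: n; rewrite a b.
Qed.

(* If [m] were on the [k]-th side of [v], moving it slightly away from an interior
   point would leave [polygon v] while staying in [polygon w]. *)
Lemma strict_interior w U v S m k : regular_of p w U -> regular_of p v S ->
  polygon w `<=` polygon v -> hyp m -> (forall j, 0 < det3 (w j) (w j.+1) m) ->
  0 < det3 (v k) (v k.+1) m.
Proof.
move=> wU vS PQ hm hw; rewrite lt_neqAle; apply/andP; split; last first.
  by have [_ /(_ k)] : polygon v m by apply: PQ; split=> // j; exact/ltW.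
apply/eqP => /esym m0; have [c [hc _ hcv _]] := reg_center p5 vS.
have [e e0 he] : exists2 e : R, 0 < e & forall j, 0 < det3 (w j) (w j.+1) (m - e *: c).
  pose B (j : 'I_p) := `|det3 (w j) (w j.+1) c| / det3 (w j) (w j.+1) m.
  have B0 j : 0 <= B j by rewrite divr_ge0// ltW.
  exists (1 + \sum_j B j)^-1; first by rewrite invr_gt0 ltr_pwDl// sumr_ge0.
  have p0n : (0 < p)%N by lia.
  move=> j; rewrite det3D det3N det3Z subr_gt0.
  have -> : w j = w (Ordinal (ltn_pmod j p0n)) by rewrite {1}(divn_eq j p) addnC (reg_perM p5 wU).
  have -> : w j.+1 = w (Ordinal (ltn_pmod j p0n)).+1.
    by rewrite {1}(divn_eq j p) -addnS addnC (reg_perM p5 wU).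
  set l := Ordinal _; rewrite ltr_pdivrMl ?ltr_pwDl ?sumr_ge0//.
  apply: le_lt_trans (ler_norm _) _.
  rewrite -ltr_pdivrMr//; apply: (@le_lt_trans _ _ (\sum_i B i)).
    by rewrite (bigD1 l)//= lerDl sumr_ge0.
  by rewrite ltrDr.
have [d d0 /(_ (Num.min e d))] := future_near (- c) hm.
rewrite lt_min e0 d0 ge_min lexx orbT scalerN => /(_ isT).
set e' := Num.min e d => fut; have e'e : e' <= e by rewrite ge_min lexx.
have e'0 : 0 < e' by rewrite lt_min e0 d0.
have Pn : polygon v (normalize (m - e' *: c)).
  apply: PQ; apply/polygon_normalize => // j; have h1 := he j; have h2 := hw j.
  move: h1; rewrite !det3D !det3N !det3Z => h1.
  have [dc|dc] := leP 0 (det3 (w j) (w j.+1) c).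
    apply: ltW; apply: lt_le_trans h1 _; rewrite lerD2l lerN2.
    exact: ler_wpM2r.
  have : e' * det3 (w j) (w j.+1) c <= 0 by rewrite pmulr_rle0// ltW.
  lra.
have := (polygon_normalize v fut).1 Pn k.
rewrite det3D det3N det3Z m0 add0r oppr_ge0 pmulr_rle0// => h.
by have := hcv k; rewrite ltNge h.
Qed.

(** The same set may be enumerated in two ways. A vertex of one enumeration is not strictly inside
    the other, hence lies on one of its sides, and extremality excludes the relative interior of
    that side. *)
Lemma same_polygon_vertex v S w U i : regular_of p v S -> regular_of p w U ->
  polygon v = polygon w -> exists j, v i = w j.
Proof.
move=> vS wU e; have hx := reg_hyp p5 vS i.
have Px : polygon w (v i) by rewrite -e; exact: (reg_vertex_in vS).
have [j j0] : exists j, det3 (w j) (w j.+1) (v i) = 0.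
  apply: contrapT => /forallNP h.
  have sub : polygon w `<=` polygon v by rewrite e.
  suff : 0 < det3 (v i) (v i.+1) (v i) by rewrite det3xyx ltxx.
  apply: (strict_interior i wU vS sub hx) => j.
  by rewrite lt_neqAle eq_sym (Px.2 j) andbT; apply/eqP.
have [_ [s [t [s0 t0 xE]]]] := reg_boundary wU Px j0.
have [s1|s1] := eqVneq s 0.
  by exists j.+1; apply: (hyp_scale (k := t) (reg_hyp p5 wU _)) => //; rewrite xE s1 scale0r add0r.
have [t1|t1] := eqVneq t 0.
  by exists j; apply: (hyp_scale (k := s) (reg_hyp p5 wU _)) => //; rewrite xE t1 scale0r addr0.
exfalso; apply: (reg_neq p5 wU (i := j)); apply: (reg_extreme vS (i := i) (s := s) (t := t)).
- by rewrite e; exact: (reg_vertex_in wU).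
- by rewrite e; exact: (reg_vertex_in wU).
- by rewrite lt_neqAle eq_sym s1.
- by rewrite lt_neqAle eq_sym t1.
- by [].
Qed.

End Polygons.

Section Tiling.
Local Open Scope ring_scope.
Variables (R : realType) (p q : nat) (T : set (set 'rV[R]_3)).
Hypothesis p5 : (5 <= p)%N.
Hypothesis hT : regular_tiling p T q.
Local Notation vec := 'rV[R]_3.
Implicit Types (x y z u m : vec) (v w : nat -> vec) (S U : R) (P Q : set vec).

Definition tile P w S := [/\ T P, regular_polygon p w P & regular_of p w S].

Lemma tile_exists P : T P -> exists w S, tile P w S.
Proof.
move=> TP; have [h _ _ _ _] := hT; have [w hw] := h _ TP.
by have [S hS] := regular_ofP hw.1; exists w, S.
Qed.

Lemma tile_of P w : T P -> regular_polygon p w P -> exists S, tile P w S.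
Proof. by move=> TP hw; have [S hS] := regular_ofP hw.1; exists S. Qed.

Lemma tileE P w S z : tile P w S -> P z <-> polygon w z.
Proof. by move=> [_ [_ ->] _]. Qed.

Lemma tile_reg P w S : tile P w S -> regular_of p w S. Proof. by case. Qed.

Lemma tile_vertex_in P w S j : tile P w S -> P (w j).
Proof. by move=> t; apply/(tileE _ t)/(reg_vertex_in p5 (tile_reg t)). Qed.

Lemma tile_normalize P w S y : tile P w S -> future y ->
  P (normalize y) <-> forall k, 0 <= det3 (w k) (w k.+1) y.
Proof. by move=> t fy; rewrite (tileE _ t); exact: polygon_normalize. Qed.

Lemma tile_cases P Q v w S U x : tile P v S -> tile Q w U -> P <> Q -> P x -> Q x ->
  (exists i j, v i = w j /\ x = v i) \/
  (exists i j, [/\ segment (v i) (v i.+1) x, segment (w j) (w j.+1) x,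
    segment (v i) (v i.+1) = segment (w j) (w j.+1) &
    (v i = w j /\ v i.+1 = w j.+1) \/ (v i = w j.+1 /\ v i.+1 = w j)]).
Proof.
move=> [TP hP vS] [TQ hQ wU] PQ Px Qx; have [_ _ h _ _] := hT.
have PQx : (P `&` Q) x by [].
case: (h _ _ _ _ TP TQ PQ hP hQ) => [e|[i [j [e1 e2]]]|[i [j [e1 e2]]]].
- by move: PQx; rewrite e.
- by left; exists i, j; split=> //; move: PQx; rewrite e2.
right; exists i, j; split; [by rewrite -e1|by rewrite -e2|by rewrite -e1|].
by apply: (segment_vertex p5 vS wU); rewrite -e1.
Qed.

Lemma vertex_in_tile P Q v w S U i : tile P v S -> tile Q w U -> Q (v i) ->
  exists j, v i = w j.
Proof.
move=> tP tQ Qx; have Px := tile_vertex_in i tP.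
have [PQ|/eqP PQ] := pselect (P = Q).
  apply: (same_polygon_vertex p5 i (tile_reg tP) (tile_reg tQ)).
  by case: tP => _ [_ <-] _; case: tQ => _ [_ <-] _.
case: (tile_cases tP tQ (elimN eqP PQ) Px Qx) => [[k [j [e1 e2]]]|[k [j [sP sQ e e']]]].
  by exists j; rewrite e2.
have := reg_edge_vertex p5 (tile_reg tP) (segment_det sP).
by case: e' => -[e1 e2] [->|->]; rewrite ?e1 ?e2; [exists j|exists j.+1|exists j.+1|exists j].
Qed.

(** Distinct tiles share at most a vertex or a side, and no point of these is strictly inside. *)
Lemma interior_unique P Q v w S U m : tile P v S -> tile Q w U -> P m ->
  (forall k, 0 < det3 (w k) (w k.+1) m) -> P = Q /\ forall k, 0 < det3 (v k) (v k.+1) m.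
Proof.
move=> tP tQ Pm hm; have hy : hyp m by have [] := (tileE m tP).1 Pm.
have Qm : Q m by apply/(tileE m tQ); split=> // k; exact/ltW.
have PQ : P = Q.
  apply: contrapT => PQ.
  case: (tile_cases tP tQ PQ Pm Qm) => [[k [j [e1 e2]]]|[k [j [sP sQ e e']]]].
    by have := hm j; rewrite e2 e1 det3xyx ltxx.
  by have := hm j; rewrite (segment_det sQ) ltxx.
split=> // k; apply: (strict_interior p5 k (tile_reg tQ) (tile_reg tP) _ hy hm).
by move=> z /(tileE z tQ); rewrite -PQ => /(tileE z tP).
Qed.

Lemma future_hball x u r : hyp x -> 0 < r -> exists2 d, 0 < d &
  forall e, 0 < e <= d -> future (x + e *: u) /\ hball x r (normalize (x + e *: u)).
Proof.
move=> hx r0; have [d d0 fd] := future_near u hx; have [hx1 x0] := hx.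
have c1 : 1 < coshR r.
  have h : expR r * expR (- r) = 1 by rewrite -expRD subrr expR0.
  have h2 : 1 < expR r by rewrite -expR0 ltr_expR.
  have h3 := expR_gt0 (- r); rewrite /coshR; move: h h2 h3.
  set a := expR r; set b := expR (- r) => ab a1 b0.
  by rewrite ltr_pdivlMr// mul1r; nra.
set C := coshR r in c1.
set a := mink x u; set b := mink u u.
have C2 : 0 < C ^+ 2 - 1 by nra.
(* [B] bounds the coefficients of the perturbation in [C^2 (1 - 2ea - e^2 b) - (1 - ea)^2], whose
   value at [e = 0] is [C^2 - 1 > 0]. *)
pose B := 1 + 2 * (C ^+ 2 + 1) * `|a| + C ^+ 2 * `|b| + a ^+ 2.
have B0 : 1 <= B.
  have n1 : 0 <= (C ^+ 2 + 1) * `|a| by rewrite mulr_ge0// addr_ge0// sqr_ge0.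
  have n2 : 0 <= C ^+ 2 * `|b| by rewrite mulr_ge0// sqr_ge0.
  by have := sqr_ge0 a; rewrite /B; lra.
have Bp : 0 < B by exact: lt_le_trans B0.
exists (Num.min d (Num.min 1 ((C ^+ 2 - 1) / (2 * B)))).
  by rewrite !lt_min d0 ltr01 divr_gt0// mulr_gt0.
move=> e /andP[e0]; rewrite !le_min => /and3P[ed e1 eB].
have f : future (x + e *: u) by apply: fd; rewrite e0.
split=> //; split; first exact: hyp_normalize.
have [f1 f2] := f; rewrite /normalize !minkE -/a -/b hx1 minkC -/a.
have eB2 : e * (2 * B) <= C ^+ 2 - 1 by rewrite -ler_pdivlMr// mulr_gt0.
set y := - (_ + _); have y0 : 0 < y by move: f1; rewrite !minkE -/a -/b hx1 minkC -/a /y; lra.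
have sy : 0 < Num.sqrt y by rewrite sqrtr_gt0.
rewrite mulrC -mulNr ltr_pdivrMr//.
have z0 : 0 < C * Num.sqrt y by rewrite mulr_gt0//; lra.
have [neg|pos] := leP (- (-1 + e * a)) 0; first exact: le_lt_trans neg z0.
rewrite -ltr_sqr ?nnegrE ?(ltW pos) ?(ltW z0)// exprMn sqr_sqrtr ?(ltW y0)//.
have ea : `|e * a| = e * `|a| by rewrite normrM gtr0_norm.
have h1 := ler_norm (e * a); have h2 := ler_norm (- (e * a)).
rewrite normrN ea in h2; rewrite ea in h1.
have h3 : e * e * b <= e * `|b|.
  apply: (@le_trans _ _ (e * e * `|b|)); first by rewrite ler_pM2l ?mulr_gt0// ler_norm.
  by apply: ler_wpM2r => //; rewrite ler_piMr// ltW.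
have h7 : (e * a) ^+ 2 <= e * a ^+ 2.
  by rewrite exprMn ler_wpM2r ?sqr_ge0// expr2 ler_piMr// ltW.
rewrite /y.
have h4 : C ^+ 2 * (e * e * b) <= C ^+ 2 * (e * `|b|) by apply: ler_wpM2l => //; exact: sqr_ge0.
have h5 : (C ^+ 2 - 1) * (e * a) <= (C ^+ 2 - 1) * (e * `|a|) by rewrite ler_wpM2l ?(ltW C2).
have h8 : 0 <= e * `|a| by rewrite mulr_ge0// ltW.
have eB3 : 2 * (e * B) <= C ^+ 2 - 1 by lra.
have eB4 : 0 < e * B by exact: mulr_gt0.
have eB5 : e * B = e + 2 * (C ^+ 2 * (e * `|a|)) + 2 * (e * `|a|) + C ^+ 2 * (e * `|b|) + e * a ^+ 2.
  by rewrite /B; ring.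
rewrite -/C; lra.
Qed.

(* Only finitely many tiles meet a neighbourhood of [x], so one of them is visited
   for arbitrarily small [e]. *)
Lemma curve_tile x u : hyp x -> exists2 Q, T Q & forall d, 0 < d ->
  exists2 e, 0 < e < d & future (x + e *: u) /\ Q (normalize (x + e *: u)).
Proof.
move=> hx; apply: contrapT => no; have [_ cov _ lf _] := hT.
have [r r0 /finite_seqP[s sE]] := lf _ hx.
have [d0 d00 hd] := future_hball u hx r0.
have nQ Q : T Q -> exists2 d, 0 < d & forall e, 0 < e < d -> future (x + e *: u) ->
    ~ Q (normalize (x + e *: u)).
  move=> TQ; apply: contrapT => nQ; apply: no; exists Q => // d d1; apply: contrapT => nd.
  by apply: nQ; exists d => // e ed fe Qe; apply: nd; exists e.
have [d d1 nd] : exists2 d, 0 < d & forall Q, Q \in s -> forall e, 0 < e < d ->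
    future (x + e *: u) -> ~ Q (normalize (x + e *: u)).
  have : forall Q, Q \in s -> T Q.
    move=> Q Qs; suff : [set P | T P /\ P `&` hball x r !=set0] Q by case.
    by rewrite sE.
  move: {sE} s; elim=> [_|Q s IH sT]; first by exists 1.
  have [|d d1 nd] := IH; first by move=> Q' Q's; apply: sT; rewrite inE Q's orbT.
  have [|d' d'1 nd'] := nQ Q; first by apply: sT; rewrite inE eqxx.
  exists (Num.min d d'); first by rewrite lt_min d1 d'1.
  move=> Q'; rewrite inE => /orP[/eqP->|Q's] e /andP[e0]; rewrite lt_min => /andP[e1 e2].
    by apply: nd'; rewrite e0.
  by apply: nd; rewrite ?e0.
pose e := Num.min d0 (d / 2).
have e0 : 0 < e by rewrite lt_min d00 divr_gt0.
have ed : e < d by rewrite gt_min ltr_pdivrMr// mulr_natr mulr2n ltrDl d1 orbT.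
have [|fe be] := hd e; first by rewrite e0 ge_min lexx.
have [Q TQ Qe] := cov _ (hyp_normalize fe).
apply: (nd Q _ e _ fe Qe); rewrite ?e0//.
suff : [set` s] Q by [].
by rewrite -sE; split=> //; exists (normalize (x + e *: u)).
Qed.

(** A tile visited by the curve arbitrarily close to [x] contains [x], being closed; on each of its
    side lines through [x] the inequality must then hold to first order, that is, for [u]. *)
Lemma curve_tileP x u : hyp x -> exists Q w S, [/\ tile Q w S, Q x &
  forall v U k, tile Q v U -> det3 (v k) (v k.+1) x = 0 -> 0 <= det3 (v k) (v k.+1) u].
Proof.
move=> hx; have [Q TQ hQ] := curve_tile u hx; have [w [S tQ]] := tile_exists TQ.
exists Q, w, S; split=> //; last first.
  move=> v U k tv e0; have [e /andP[ep _] [fe]] := hQ 1 ltr01.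
  by move=> /(tile_normalize tv fe)/(_ k); rewrite det3D det3Z e0 add0r pmulr_rge0.
apply/(tileE x tQ); split=> // k; rewrite leNgt; apply/negP => neg.
set a := det3 _ _ x in neg *; pose b := `|det3 (w k) (w k.+1) u|.
have b0 : 0 <= b by rewrite /b.
have [|e /andP[ep ed] [fe]] := hQ (- a / (b + 1)).
  by rewrite divr_gt0 ?oppr_gt0// ltr_pwDr.
move=> /(tile_normalize tQ fe)/(_ k); rewrite det3D det3Z -/a.
move: ed; rewrite ltr_pdivlMr ?ltr_pwDr// => ed.
have : e * det3 (w k) (w k.+1) u <= e * b by rewrite ler_pM2l// ler_norm.
lra.
Qed.

Lemma tile_hyp P w S j : tile P w S -> hyp (w j).
Proof. by move=> t; exact: (reg_hyp p5 (tile_reg t)). Qed.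

(* The other tile is the one entered by a curve leaving [P] through the midpoint
   of the side. *)
Lemma tile_across P v S k : tile P v S -> exists Q w U j, [/\ tile Q w U,
  v k = w j.+1 & v k.+1 = w j].
Proof.
move=> tP; have vS := tile_reg tP.
have [c [hc _ hcv _]] := reg_center p5 vS.
have fm : future (1 *: v k + 1 *: v k.+1).
  by apply: future_comb; rewrite ?ler01 ?addr_gt0//; exact: tile_hyp tP.
have [l l0 mE] := normalizeE fm.
have hm := hyp_normalize fm; set m := normalize _ in mE hm; rewrite !scale1r in mE.
have [Q [w [U [tQ Qm hQ]]]] := curve_tileP (- c) hm.
have dm : det3 (v k) (v k.+1) m = 0 by rewrite mE !det3r det3xyx det3xyy addr0 mulr0.
have PQ : P <> Q.
  move=> e; move: tP; rewrite e => tP'; have := hQ _ _ k tP' dm.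
  by rewrite det3N oppr_ge0 leNgt hcv.
have Pm : P m.
  apply/(tileE m tP); split=> // j; rewrite mE !det3r mulr_ge0 ?(ltW l0)// addr_ge0//;
  exact: (reg_det_ge0 p5 vS).
have mne i : m <> v i.
  move=> mi; apply: (reg_neq p5 vS (i := k)).
  apply: (reg_extreme p5 vS (i := i) (s := l) (t := l)) => //.
  - exact: (reg_vertex_in p5 vS).
  - exact: (reg_vertex_in p5 vS).
  - by rewrite -mi mE scalerDr.
case: (tile_cases tP tQ PQ Pm Qm) => [[i [j [_ e]]]|[i [j [sP sQ e e']]]].
  by case: (mne i).
have key : det3 (v i) (v i.+1) (v k) = 0 /\ det3 (v i) (v i.+1) (v k.+1) = 0.
  have := segment_det sP; rewrite mE !det3r => /eqP; rewrite mulf_eq0 gt_eqF//=.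
  rewrite paddr_eq0 ?(reg_det_ge0 p5 vS)//.
  by move=> /andP[/eqP-> /eqP->].
have [k1 k2] := key.
have {}key : (v k = v i /\ v k.+1 = v i.+1) \/ (v k = v i.+1 /\ v k.+1 = v i).
  have n := reg_neq p5 vS (i := k).
  case: (reg_edge_vertex p5 vS k1) (reg_edge_vertex p5 vS k2) => [a|a] [b|b];
    [|by left|by right|]; by case: n; rewrite a b.
have not_same j' : v k = w j' -> v k.+1 = w j'.+1 -> False.
  move=> e1 e2; have := hQ _ _ j' tQ; rewrite -e1 -e2 => /(_ dm).
  by rewrite det3N oppr_ge0 leNgt hcv.
have nsw : v k = v i.+1 -> v k.+1 = v i -> False.
  move=> a b; have := hcv i; have := hcv k; rewrite a b det3_swap.
  by move=> x1 x2; have := addr_gt0 x1 x2; rewrite addNr ltxx.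
exists Q, w, U, j.
case: key => -[a b]; last by case: (nsw a b).
case: e' => -[a' b']; last by rewrite a b a' b'.
by case: (not_same j); rewrite ?a ?b.
Qed.

End Tiling.

(** * The neighbours of a vertex as an orbit of a rotation *)

Section Polar.
Local Open Scope ring_scope.
Variable R : realType.

Lemma polar (a b r t0 : R) : 0 < r -> a ^+ 2 + b ^+ 2 = r ^+ 2 ->
  exists t, [/\ t0 <= t, t < t0 + 2 * pi, a = r * cos t & b = r * sin t].
Proof.
move=> r0 h; have ipi := pi_gt0 R; have rn : r != 0 by rewrite gt_eqF.
pose c := a / r * cos t0 + b / r * sin t0; pose d := b / r * cos t0 - a / r * sin t0.
have cs := cos2Dsin2 t0.
have cd : c ^+ 2 + d ^+ 2 = 1.
  rewrite [LHS](_ : _ = (a ^+ 2 + b ^+ 2) * (cos t0 ^+ 2 + sin t0 ^+ 2) / r ^+ 2).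
    by rewrite cs mulr1 h divff// expf_neq0.
  by rewrite /c /d; field.
have c1 : -1 <= c <= 1.
  rewrite -ler_norml -(@ler_sqr _ `|c|) ?nnegrE// real_normK ?num_real// expr1n.
  by have := sqr_ge0 d; lra.
have [u [u0 u2 cu du]] : exists u, [/\ 0 <= u, u < 2 * pi, c = cos u & d = sin u].
  have c1' : c \in `[-1, 1] by rewrite in_itv.
  have l0 := acos_ge0 c1'; have l1 := acos_lepi c1'.
  have sE : sin (acos c) = `|d|.
    by rewrite sin_acos// (_ : 1 - c ^+ 2 = d ^+ 2) ?sqrtr_sqr//; lra.
  have [d0|d0] := leP 0 d.
    by exists (acos c); rewrite acosK// sE ger0_norm//; split=> //; lra.
  exists (- acos c + pi *+ 2); rewrite cosD2pi sinD2pi cosN sinN acosK// sE ltr0_norm// opprK.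
  split=> //; first by lra.
  suff : acos c != 0 by rewrite neq_lt ltNge l0/= => h'; lra.
  by apply/eqP => e0; move: sE; rewrite e0 sin0 ltr0_norm//; lra.
exists (t0 + u); split; [by rewrite lerDl|by rewrite ltrD2l| |].
  rewrite cosD -cu -du /c /d.
  transitivity (a * (cos t0 ^+ 2 + sin t0 ^+ 2)); first by rewrite cs mulr1.
  by field.
rewrite sinD -cu -du /c /d.
transitivity (b * (cos t0 ^+ 2 + sin t0 ^+ 2)); first by rewrite cs mulr1.
by field.
Qed.

Lemma cos_eq1 (t : R) : cos t = 1 -> 0 < t -> 2 * pi <= t.
Proof.
move=> ct t0; rewrite leNgt; apply/negP => t2.
have : 0 < sin (t / 2).
  by apply: sin_gt0_pi; rewrite divr_gt0//= ltr_pdivrMr// mulrC.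
have : cos ((t / 2) *+ 2) = 1 by rewrite -mulr_natr divfK.
rewrite cos_mulr2n cos2sin2; set s := sin _ => h s0.
have : 0 < s ^+ 2 by exact: exprn_gt0.
lra.
Qed.

Lemma small_comb n (a b : 'I_n -> R) :
  (forall i, 0 < a i \/ (a i = 0 /\ 0 < b i)) ->
  exists2 e, 0 < e & forall i, 0 < a i + e * b i.
Proof.
move=> h; have a0 i : 0 <= a i by case: (h i) => [/ltW//|[->]].
(* Where [a i] is 0 the quotient is 0 by convention, and such an index does not restrict the choice
   of [e]. *)
pose B i := `|b i| / a i; have B0 i : 0 <= B i by rewrite divr_ge0.
have s0 : 0 < 1 + \sum_i B i by rewrite ltr_pwDl// sumr_ge0.
exists (1 + \sum_i B i)^-1; rewrite ?invr_gt0// => i.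
case: (h i) => [ai|[-> bi]]; last by rewrite add0r mulr_gt0// invr_gt0.
rewrite -[X in 0 < _ + X]opprK subr_gt0 -mulrN ltr_pdivrMl//.
apply: le_lt_trans (ler_norm _) _; rewrite normrN.
rewrite -ltr_pdivrMr//; apply: (@le_lt_trans _ _ (\sum_i B i)); last by rewrite ltrDr.
by rewrite (bigD1 i)//= lerDl sumr_ge0.
Qed.

Lemma sqrt_sqr1_gt0 (A : R) : 1 < A -> 0 < Num.sqrt (A ^+ 2 - 1).
Proof. by move=> h; rewrite sqrtr_gt0 subr_gt0 expr_gt1// (le_trans _ (ltW h)). Qed.

End Polar.

Section Star.
Local Open Scope ring_scope.
Variables (R : realType) (p q : nat) (T : set (set 'rV[R]_3)).
Hypothesis p5 : (5 <= p)%N.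
Hypothesis hT : regular_tiling p T q.
Local Notation vec := 'rV[R]_3.
Local Notation tile := (tile p T).
Local Notation adjacent := (Defs.adjacent p T).
Local Notation s := (sk R p 1).
Implicit Types (x y z u m : vec) (v w : nat -> vec) (S U : R) (P Q : set vec).

(** The tile on the left of the side from [x] to [y]; if the side is known only with the opposite
    orientation, [tile_across] provides it. The index [k.+1] leaves room for the vertex preceding
    [x]. *)
Lemma adjacent_tile x y : adjacent x y ->
  exists Q w U k, [/\ tile Q w U, x = w k.+1 & y = w k.+2].
Proof.
have sc Q w U k : tile Q w U -> exists k', w k = w k'.+1 /\ w k.+1 = w k'.+2.
  move=> t; have [k' kE] := reg_succ p5 (tile_reg t) k; exists k'.
  by have := kE 0%N; have := kE 1%N; rewrite !addn0 !addn1.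
move=> [P [v [k [TP hP]]]]; have [S tP] := tile_of TP hP.
case=> -[-> ->].
  by have [k' [-> ->]] := sc _ _ _ k tP; exists P, v, S, k'.
have [Q [w [U [j [tQ -> ->]]]]] := tile_across p5 hT k tP.
by have [k' [-> ->]] := sc _ _ _ j tQ; exists Q, w, U, k'.
Qed.

Lemma tile_adjacent Q w U k : tile Q w U -> adjacent (w k) (w k.+1).
Proof. by move=> [TQ hQ _]; exists Q, w, k; split=> //; left. Qed.

Lemma adjacentC x y : adjacent x y -> adjacent y x.
Proof. by move=> [P [v [k [TP hP e]]]]; exists P, v, k; split=> //; case: e; [right|left]. Qed.

Lemma adjacent_vertex x y : adjacent x y -> tile_vertices p T x.
Proof. by move=> [P [v [k [TP hP [[-> _]|[_ ->]]]]]]; [exists P, v, k|exists P, v, k.+1]. Qed.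

Lemma vertex_tile x : tile_vertices p T x -> exists P v S k, tile P v S /\ x = v k.
Proof.
move=> [P [v [k [TP hP ->]]]]; have [S tP] := tile_of TP hP.
by exists P, v, S, k.
Qed.

Lemma vertex_hyp x : tile_vertices p T x -> hyp x.
Proof. by move=> /vertex_tile[P [v [S [k [t ->]]]]]; exact: tile_hyp t. Qed.

(** The point [z] lies on the segment from [x] to [y], hence in a tile having this side; being a
    vertex, it is a vertex of that tile on the line of the side. *)
Lemma adjacent_same_ray x y z a b : adjacent x y -> adjacent x z -> 0 <= a -> 0 <= b ->
  z = a *: x + b *: y -> z = y.
Proof.
move=> /adjacent_tile[Q [w [U [k [tQ xE yE]]]]] xz a0 b0 zE.
have [P [v [S [i [tP xv zv]]]]] := adjacent_tile xz.
have hz : hyp z by rewrite zv; exact: tile_hyp tP.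
have zx : z <> x by move=> e; apply: (reg_neq p5 (tile_reg tP) (i := i.+1)); rewrite -xv -zv.
have Qz : Q z.
  apply/(tileE z tQ); split=> // j; rewrite zE !det3r xE yE.
  by rewrite addr_ge0// mulr_ge0// (reg_det_ge0 p5 (tile_reg tQ)).
have [j zj] : exists j, z = w j by rewrite zv; apply: (vertex_in_tile p5 hT tP tQ); rewrite -zv.
have : det3 (w k.+1) (w k.+2) (w j) = 0.
  by rewrite -zj zE !det3r xE yE det3xyx det3xyy !mulr0 addr0.
move=> /(reg_edge_vertex p5 (tile_reg tQ)); rewrite -zj -xE -yE => -[] //.
Qed.

Lemma reg_index_eq w U i j : regular_of p w U -> w i = w j -> forall l, w (i + l)%N = w (j + l)%N.
Proof.
move=> wU e l; have [m mp h] := reg_mod_shift p5 wU i j; rewrite h.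
have := h 0%N; rewrite !addn0 => hm.
have [->|m0] := posnP m; first by rewrite addn0.
have := reg_mink p5 wU i m; rewrite -hm -e; have [-> _] := reg_hyp p5 wU i.
have sm : 0 < sk R p m by apply: sk_gt0 => //; rewrite m0.
have : 0 < U ^+ 2 * sk R p m ^+ 2 by rewrite mulr_gt0// exprn_gt0// (reg_S_gt0 wU).
by move=> h1 h2; exfalso; clear -h1 h2; lra.
Qed.

Lemma reg_index_pred w U i j : regular_of p w U -> w i.+1 = w j.+1 -> w i = w j.
Proof.
move=> wU e; have := reg_index_eq wU e p.-1.
rewrite (_ : i.+1 + p.-1 = i + p)%N; last by lia.
rewrite (_ : j.+1 + p.-1 = j + p)%N; last by lia.
by rewrite !(reg_per p5 wU).
Qed.

Section AtVertex.
Variables (x e f : vec).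
Hypothesis F : frame x e f.

(* The point at distance [arccosh A] from [x] in the direction [t]. *)
Definition ray A t : vec := fr x e f A (Num.sqrt (A ^+ 2 - 1) * cos t) (Num.sqrt (A ^+ 2 - 1) * sin t).

(* The interior angle of the regular [p]-gon whose sides [a] satisfy [cosh a = A]. *)
Definition angle A : R := acos (1 - 4 * (1 - s ^+ 2) / (A + 1)).

Lemma ray_exists y t0 : hyp y -> mink x y < -1 ->
  exists t, [/\ t0 <= t, t < t0 + 2 * pi & y = ray (- mink x y) t].
Proof.
move=> [hy _] xy; set A := - mink x y.
have A1 : 1 < A ^+ 2 by rewrite /A; nra.
have B0 : 0 < Num.sqrt (A ^+ 2 - 1) by rewrite sqrtr_gt0 subr_gt0.
have h : mink e y ^+ 2 + mink f y ^+ 2 = Num.sqrt (A ^+ 2 - 1) ^+ 2.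
  rewrite sqr_sqrtr ?subr_ge0 ?(ltW A1)//.
  have := mink_fr A (mink e y) (mink f y) A (mink e y) (mink f y) F.
  by rewrite -(frame_decomp y F) hy => h; rewrite !expr2; lra.
have [t [h1 h2 h3 h4]] := polar t0 B0 h; exists t; split=> //.
by rewrite {1}(frame_decomp y F) h3 h4.
Qed.

Lemma mink_ray A t : mink x (ray A t) = - A.
Proof.
have [[hx _] [xe _] [xf _] _ _] := F.
by rewrite /ray /fr !minkE hx xe xf; ring.
Qed.

Lemma det_ray A t A' t' : det3 x (ray A t) (ray A' t') =
  Num.sqrt (A ^+ 2 - 1) * Num.sqrt (A' ^+ 2 - 1) * sin (t' - t).
Proof. by rewrite -{1}(fr100 x e f) /ray det3_fr// sinB; ring. Qed.

Lemma sk2 : sk R p 2 ^+ 2 = 4 * s ^+ 2 * (1 - s ^+ 2).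
Proof.
have -> : sk R p 2 = sin ((pi * 1%:R / p%:R) *+ 2).
  by rewrite /sk; congr sin; rewrite -[in RHS]mulr_natr; ring.
rewrite sin_mulr2n -/(s); have := cos2Dsin2 (pi * 1%:R / p%:R : R); rewrite -/(s) => h.
rewrite (_ : 1 - s ^+ 2 = cos (pi * 1%:R / p%:R) ^+ 2); last lra.
by rewrite -mulr_natr; ring.
Qed.

(** In the tile on the left of the side, the vertex before [x] is again at distance arccosh [A]. Its
    distance to the vertex after [x] gives the cosine of the angle at [x], and the orientation of
    the tile the sign of the sine. *)
Lemma adjacent_step A t : 1 < A -> adjacent x (ray A t) ->
  exists Q w U k, [/\ tile Q w U, x = w k.+1, ray A t = w k.+2 & ray A (t + angle A) = w k].
Proof.
move=> A1 /adjacent_tile[Q [w [U [k [tQ xE yE]]]]]; exists Q, w, U, k; split=> //.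
have wU := tile_reg tQ.
have AE : A = 1 + 2 * U ^+ 2 * s ^+ 2.
  by have := reg_mink_adj p5 wU k.+1; rewrite -xE -yE mink_ray => /oppr_inj.
have mx : mink x (w k) = - A.
  by rewrite minkC xE (reg_mink_adj p5 wU) -AE.
have [|t' [_ _ zE]] := ray_exists t (tile_hyp p5 k tQ); first by rewrite mx; lra.
rewrite mx opprK in zE; rewrite zE.
have B0 : 0 < Num.sqrt (A ^+ 2 - 1) by rewrite sqrtr_gt0; nra.
have B2 : Num.sqrt (A ^+ 2 - 1) ^+ 2 = A ^+ 2 - 1 by rewrite sqr_sqrtr//; nra.
have := reg_mink p5 wU k 2; rewrite addn2 -yE zE /ray mink_fr// sk2.
set B := Num.sqrt _ in B0 B2 * => h.
have cE : cos (t' - t) = 1 - 4 * (1 - s ^+ 2) / (A + 1).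
  have Ap : A + 1 != 0 by rewrite gt_eqF//; lra.
  have Bn : B ^+ 2 != 0 by rewrite gt_eqF// exprn_gt0.
  apply: (mulfI Bn); rewrite cosB.
  have -> : B ^+ 2 * (1 - 4 * (1 - s ^+ 2) / (A + 1)) = A ^+ 2 - 1 - 4 * (1 - s ^+ 2) * (A - 1).
    by rewrite B2; field.
  have -> : 4 * (1 - s ^+ 2) * (A - 1) = 2 * U ^+ 2 * (4 * s ^+ 2 * (1 - s ^+ 2)) by rewrite AE; ring.
  move: h; set u := 2 * _ * _; lra.
have s0 : 0 < sin (t' - t).
  have := reg_pred p5 wU (i := k.+1) isT; rewrite /= -xE -yE zE det_ray.
  by rewrite pmulr_rgt0// mulr_gt0.
have d1 : 1 - 4 * (1 - s ^+ 2) / (A + 1) \in `[-1, 1].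
  by rewrite -cE in_itv/= cos_geN1 cos_le1.
have ca : cos (angle A) = cos (t' - t) by rewrite /angle acosK.
have sa : sin (angle A) = sin (t' - t).
  rewrite /angle sin_acos// -cE (_ : 1 - _ = sin (t' - t) ^+ 2).
    by rewrite sqrtr_sqr gtr0_norm.
  by have := cos2Dsin2 (t' - t); lra.
have -> : t' = t + (t' - t) by ring.
by rewrite /ray !(cosD t) !(sinD t) ca sa.
Qed.

Lemma angle_bounds A : 1 < A -> 0 < angle A < pi /\ cos (angle A) = 1 - 4 * (1 - s ^+ 2) / (A + 1).
Proof.
move=> A1; have s0 : 0 < s := sk1_gt0 R p5.
have s1 : s < 1 by exact: sk1_lt1.
have s2 : s ^+ 2 < 1 by rewrite expr_lt1// ltW.
have s2' : 0 < s ^+ 2 by exact: exprn_gt0.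
have d0 : 0 < 4 * (1 - s ^+ 2) / (A + 1) by rewrite divr_gt0//; lra.
have d2 : 4 * (1 - s ^+ 2) / (A + 1) < 2 by rewrite ltr_pdivrMr; lra.
set d := _ / _ in d0 d2; have di : 1 - d \in `[-1, 1] by rewrite in_itv/=; apply/andP; split; lra.
have ca : cos (angle A) = 1 - d by rewrite /angle -/d acosK.
have l0 : 0 <= angle A := acos_ge0 di; have l1 : angle A <= pi := acos_lepi di.
split=> //; apply/andP; split; rewrite lt_neqAle ?l0 ?l1 andbT; apply/eqP => h.
  by move: ca; rewrite -h cos0; lra.
by move: ca; rewrite h cospi; lra.
Qed.

(** A side starting at [x] strictly inside the angle of a tile would contain, near [x], points
    strictly inside that tile that lie on the boundary of another. *)
Lemma adjacent_gap A t A' t' : 1 < A -> 1 < A' -> adjacent x (ray A t) -> adjacent x (ray A' t') ->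
  t < t' -> t' < t + angle A -> False.
Proof.
move=> A1 A'1 xy xz tt' t't; have [/andP[al0 alpi] _] := angle_bounds A1.
have [Q [w [U [k [tQ xE yE zE]]]]] := adjacent_step A1 xy.
have [P [v [S [i [tP xv zv]]]]] := adjacent_tile xz.
have wU := tile_reg tQ.
set z := ray A' t' in xz zv; have B1 := sqrt_sqr1_gt0 A1; have B2 := sqrt_sqr1_gt0 A'1.
have d1 : 0 < det3 (w k.+1) (w k.+2) z.
  rewrite -xE -yE det_ray mulr_gt0 ?mulr_gt0//; apply: sin_gt0_pi; apply/andP; split; lra.
have d2 : 0 < det3 (w k) (w k.+1) z.
  rewrite -xE -zE det3_rot det_ray mulr_gt0 ?mulr_gt0//.
  by apply: sin_gt0_pi; apply/andP; split; lra.
have key l : 0 < det3 (w l) (w l.+1) x \/ (det3 (w l) (w l.+1) x = 0 /\ 0 < det3 (w l) (w l.+1) z).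
  rewrite xE; case: (reg_det_gt0 p5 wU l k.+1) => [a|[a|a]]; [right|right|by left].
    have := reg_index_eq wU a 1; rewrite !addn1 => b; rewrite -a -b det3xyx; split=> //.
  by rewrite -a -(reg_index_pred wU a) det3xyy.
have [h h0 hh] := small_comb (fun l : 'I_p => key l).
have hx : hyp x by rewrite xE; exact: tile_hyp tQ.
have hz : hyp z by rewrite zv; exact: tile_hyp tP.
have fm : future (1 *: x + h *: z) by apply: future_comb => //; [exact: ltW|exact: addr_gt0].
have [l l0 mE] := normalizeE fm; rewrite scale1r in fm mE.
have Pm : P (normalize (x + h *: z)).
  apply/(tile_normalize tP fm) => j; rewrite det3D det3Z xv zv addr_ge0//.
    exact: (reg_det_ge0 p5 (tile_reg tP)).
  by rewrite mulr_ge0 ?(ltW h0)//; exact: (reg_det_ge0 p5 (tile_reg tP)).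
have Qm j : 0 < det3 (w j) (w j.+1) (normalize (x + h *: z)).
  rewrite mE det3Z pmulr_rgt0// det3D det3Z.
  have p0n : (0 < p)%N by exact: leq_trans p5.
  have := hh (Ordinal (ltn_pmod j p0n)); rewrite /=.
  have -> : w (j %% p)%N = w j by rewrite [in RHS](divn_eq j p) addnC (reg_perM p5 wU).
  have -> // : w (j %% p).+1 = w j.+1.
  by rewrite [in RHS](divn_eq j p) -addnS addnC (reg_perM p5 wU).
have [_ /(_ i.+1)] := interior_unique p5 hT tP tQ Pm Qm.
by rewrite mE det3Z det3D det3Z xv zv det3xyx det3xyy mulr0 addr0 mulr0 ltxx.
Qed.

Lemma adjacent_orbit A t (i : nat) : 1 < A -> adjacent x (ray A t) ->
  adjacent x (ray A (t + i%:R * angle A)).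
Proof.
move=> A1 xy; elim: i => [|i IH]; first by rewrite mul0r addr0.
have [Q [w [U [k [tQ xE yE]]]]] := adjacent_step A1 IH.
rewrite -natr1 mulrDl mul1r addrA => ->.
by rewrite xE; apply: adjacentC; exact: tile_adjacent tQ.
Qed.

Lemma adjacent_mink y : adjacent x y -> mink x y < -1.
Proof.
move=> /adjacent_tile[Q [w [U [k [tQ -> ->]]]]]; apply: hyp_neq_mink.
- exact: tile_hyp tQ.
- exact: tile_hyp tQ.
- exact: (reg_neq p5 (tile_reg tQ)).
Qed.

Lemma adjacent_hyp y : adjacent x y -> hyp y.
Proof. by move=> /adjacentC/adjacent_vertex/vertex_hyp. Qed.

Lemma adjacent_same_angle A A' t : 1 < A -> A <= A' -> adjacent x (ray A t) ->
  adjacent x (ray A' t) -> A = A'.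
Proof.
move=> A1 AA' xy xz.
have A'1 : 1 < A' by exact: lt_le_trans AA'.
have B1 := sqrt_sqr1_gt0 A1; have B2 := sqrt_sqr1_gt0 A'1.
suff h : ray A t = ray A' t.
  by have := mink_ray A t; rewrite h mink_ray => /oppr_inj.
pose b := Num.sqrt (A ^+ 2 - 1) / Num.sqrt (A' ^+ 2 - 1).
have b0 : 0 <= b by rewrite divr_ge0// ltW.
apply: (@adjacent_same_ray x (ray A' t) (ray A t) (A - b * A') b) => //; last first.
  by rewrite /ray /fr !scalerDr !scalerA scalerBl addrA addrA subrK !mulrA /b divfK// gt_eqF.
rewrite subr_ge0 /b mulrAC ler_pdivrMr//.
rewrite -ler_sqr ?nnegrE ?mulr_ge0 ?(ltW B1) ?(ltW B2)//; try lra.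
by rewrite !exprMn !sqr_sqrtr; nra.
Qed.

(** Divide the angle from the first neighbour by [angle A]: a nonzero remainder is excluded by
    [adjacent_gap]. *)
Lemma adjacent_orbit_all A t z : 1 < A -> adjacent x (ray A t) -> adjacent x z ->
  exists2 i : nat, i%:R * angle A < 2 * pi & z = ray A (t + i%:R * angle A).
Proof.
move=> A1 xy xz; have [/andP[al0 _] _] := angle_bounds A1.
have [t' [t1 t2 zE]] := ray_exists t (adjacent_hyp xz) (adjacent_mink xz).
have A'1 : 1 < - mink x z by have := adjacent_mink xz; lra.
move: A'1 zE; set A' := - mink x z => A'1 zE.
have b0 : 0 <= (t' - t) / angle A by rewrite divr_ge0 ?subr_ge0// ltW.
pose i := Num.truncn ((t' - t) / angle A).
have /andP[i1 i2] : i%:R <= (t' - t) / angle A < i.+1%:R by exact: truncn_itv.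
rewrite ler_pdivlMr// in i1; rewrite ltr_pdivrMr// -natr1 in i2.
exists i; first by lra.
have xy' := adjacent_orbit i A1 xy; rewrite zE in xz *.
have [e'|ne] := eqVneq t' (t + i%:R * angle A); last first.
  exfalso; apply: (adjacent_gap A1 A'1 xy' xz); last by lra.
  by rewrite lt_neqAle eq_sym ne; lra.
rewrite -e' in xy' *; have [AA'|A'A] := leP A A'.
  by rewrite (adjacent_same_angle A1 AA' xy' xz).
by rewrite -(adjacent_same_angle A'1 (ltW A'A) xz xy').
Qed.

End AtVertex.

Lemma vertex_neighbour x : tile_vertices p T x -> exists y, adjacent x y.
Proof. by move=> /vertex_tile[P [v [S [k [tP ->]]]]]; exists (v k.+1); exact: tile_adjacent tP. Qed.

(* The neighbours of a vertex are the orbit of one of them under rotation by the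
   interior angle of the tiles, which is therefore about [2 pi / q]. *)
Lemma star x : tile_vertices p T x -> exists A, [/\ 1 < A,
  (q%:R - 1) * angle A <= 2 * pi, 2 * pi <= q%:R * angle A &
  forall e f, frame x e f -> exists t, forall y,
    adjacent x y <-> exists i : nat, y = ray x e f A (t + i%:R * angle A)].
Proof.
move=> Vx; have hx := vertex_hyp Vx; have [y xy] := vertex_neighbour Vx.
have A1 : 1 < - mink x y by have := adjacent_mink xy; lra.
exists (- mink x y); move: A1 (erefl (- mink x y)); set A := {1 2 4 5 6 8}(- mink x y) => A1 AE.
have [/andP[al0 alpi] _] := angle_bounds A1.
have orb e f : frame x e f -> exists t,
    (forall z, adjacent x z -> exists2 i : nat, i%:R * angle A < 2 * pi &
       z = ray x e f A (t + i%:R * angle A)) /\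
    forall i : nat, adjacent x (ray x e f A (t + i%:R * angle A)).
  move=> F; have [t [_ _ yE]] := ray_exists F 0 (adjacent_hyp xy) (adjacent_mink xy).
  rewrite -AE in yE; have xy' := xy; rewrite yE in xy'.
  exists t; split=> [z|i]; first exact: adjacent_orbit_all.
  exact: adjacent_orbit.
have [_ _ _ _ /(_ x Vx) card] := hT.
have [e [f F]] := frame_exists hx; have [t [tE tA]] := orb e f F.
have ipi := pi_gt0 R.
split=> //.
(* All [q] neighbours have an index [i] with [i angle A < 2 pi], which bounds [q] by the number of
   such indices. *)
- have [->|q0] := posnP q; first by rewrite sub0r; nra.
  have d0 : 0 <= 2 * pi / angle A by rewrite divr_ge0 ?mulr_ge0 ?ltW.
  pose n := (Num.truncn (2 * pi / angle A)).+1.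
  have : (`I_q #<= `I_n)%card.
    rewrite -(card_le_eql card).
    apply: (@card_le_trans _ _ _ [set ray x e f A (t + i%:R * angle A) | i in `I_n]);
      last exact: card_image_le.
    apply: subset_card_le => z /= /tE[i i2 ->]; exists i => //=.
    by rewrite /n ltnS truncn_ge_nat// ler_pdivlMr// ltW.
  rewrite card_le_II => qn.
  have : (q.-1)%:R <= 2 * pi / angle A by rewrite -truncn_ge_nat//; lia.
  by rewrite ler_pdivlMr// -subn1 natrB.
(* If [q] rotations did not complete a turn, the indices from 0 to [q] would give [q+1] distinct
   neighbours. *)
- rewrite leNgt; apply/negP => lt2.
  suff : (`I_q.+1 #<= `I_q)%card by rewrite card_le_II ltnn.
  rewrite -(card_le_eqr card).
  have : ([set ray x e f A (t + i%:R * angle A) | i in `I_q.+1] #<= [set y | adjacent x y])%card.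
    by apply: subset_card_le => _ [i _ <-]; exact: tA.
  rewrite (card_le_eql (inj_card_eq _))// => i j; rewrite !inE /= => iq jq.
  have B0 := sqrt_sqr1_gt0 A1.
  have key (k l : nat) : (k <= l)%N -> (l < q.+1)%N ->
      ray x e f A (t + k%:R * angle A) = ray x e f A (t + l%:R * angle A) -> k = l.
    move=> kl lq ekl; apply/eqP; rewrite eqn_leq kl leqNgt /=; apply/negP => kl'.
    have m : mink (ray x e f A (t + k%:R * angle A)) (ray x e f A (t + l%:R * angle A)) = -1.
      rewrite -ekl; exact: (adjacent_hyp (tA k)).1.
    move: m; rewrite /ray mink_fr//; set B := Num.sqrt _ in B0 *.
    have B2 : B ^+ 2 = A ^+ 2 - 1 by rewrite sqr_sqrtr//; nra.
    move=> m; have : cos ((l - k)%:R * angle A) = 1.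
      have -> : (l - k)%:R * angle A = (t + l%:R * angle A) - (t + k%:R * angle A).
        by rewrite natrB//; ring.
      rewrite cosB; have Bn : B ^+ 2 != 0 by rewrite gt_eqF// exprn_gt0.
      by apply: (mulfI Bn); rewrite mulr1; lra.
    move=> /cos_eq1; rewrite mulr_gt0 ?ltr0n ?subn_gt0// => /(_ isT).
    apply/negP; rewrite -ltNge; apply: le_lt_trans lt2.
    by rewrite ler_pM2r// ler_nat; lia.
  by case: (leqP i j) => [ij|/ltnW ij] h; [exact: key|apply/esym/key].
move=> e' f' /orb[t' [t'E t'A]]; exists t' => z; split; first by move=> /t'E[i _ ->]; exists i.
by move=> [i ->]; exact: t'A.
Qed.

End Star.

(** * Sparseness of the vertices and cones of neighbours *)

Section Trigonometry.
Local Open Scope ring_scope.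
Variable R : realType.
Implicit Types t u : R.

Lemma sin_le_id t : 0 <= t -> sin t <= t.
Proof.
rewrite le_eqVlt => /orP[/eqP<-|t0]; first by rewrite sin0.
have [|c _] := @MVT R sin cos 0 t t0 (fun x _ => is_derive_sin x).
  by apply: continuous_subspaceT => x; exact: continuous_sin.
rewrite sin0 !subr0 => ->; rewrite -[leRHS]mul1r ler_pM2r//; exact: cos_le1.
Qed.

Lemma cos_ge_sqr t : 0 <= t <= pi -> 1 - cos t <= t ^+ 2 / 2.
Proof.
move=> /andP[t0 tp]; have e : cos t = cos ((t / 2) *+ 2) by rewrite -mulr_natr divfK.
rewrite e cos_mulr2n cos2sin2; have ipi := pi_gt0 R.
have s0 : 0 <= sin (t / 2) by apply: sin_ge0_pi; apply/andP; split; lra.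
have s1 : sin (t / 2) <= t / 2 by apply: sin_le_id; lra.
have := ler_pM s0 s0 s1 s1; rewrite -!expr2; lra.
Qed.

Lemma cos_pi3 : cos (pi / 3) = 2^-1 :> R.
Proof.
have ipi := pi_gt0 R; set c := cos _.
have c0 : 0 < c by apply: cos_gt0_pihalf; apply/andP; split; lra.
have h : cos (pi / 3 *+ 2) = - c.
  by rewrite /c -[in RHS]cosN -(cosDpi (- (pi / 3))); congr cos; field.
move: h; rewrite cos_mulr2n -/c => h.
have : (2 * c - 1) * (c + 1) = 0 by lra.
by move/eqP; rewrite mulf_eq0 (gt_eqF (_ : 0 < c + 1)) ?orbF//; [move/eqP; lra|lra].
Qed.

Lemma cos_le_half t : pi / 3 <= t <= 5 * pi / 3 -> cos t <= 2^-1.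
Proof.
move=> /andP[t1 t2]; have ipi := pi_gt0 R; rewrite -cos_pi3.
have h u : pi / 3 <= u <= pi -> cos u <= cos (pi / 3).
  by move=> /andP[u1 u2]; rewrite leNgt ltr_cos -?leNgt// in_itv/=; apply/andP; split; lra.
have [tp|tp] := leP t pi; first by apply: h; rewrite t1.
rewrite -[t]opprK cosN -cosD2pi; apply: h; apply/andP; split; lra.
Qed.

(** Two directions whose cosines with an axis are at least 9/10 enclose an angle of cosine at least
    [2 (81/100) - 1], which exceeds 1/2. *)
Lemma cos_far u v d : 9 / 10 <= cos u -> 9 / 10 <= cos v -> cos v = cos (u + d) ->
  sin v = sin (u + d) -> cos d <= 2^-1 -> False.
Proof.
move=> cu cv c1 s1 cd.
have e : cos d = cos v * cos u + sin v * sin u by rewrite c1 s1 -cosB; congr cos; ring.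
have hu := cos2Dsin2 u; have hv := cos2Dsin2 v.
have := sqr_ge0 (sin u + sin v); have : 81 / 100 <= cos u * cos v.
  by apply: le_trans (ler_pM _ _ cu cv); lra.
have : 81 / 100 <= cos u ^+ 2 by rewrite expr2; apply: le_trans (ler_pM _ _ cu cu); lra.
have : 81 / 100 <= cos v ^+ 2 by rewrite expr2; apply: le_trans (ler_pM _ _ cv cv); lra.
lra.
Qed.

Lemma five_images (K : choiceType) (N C : {fset K}) (g : nat -> K -> K) :
  {subset C <= N} -> (forall k x, x \in C -> g k x \in N) ->
  (forall k l x y, (k < 5)%N -> (l < 5)%N -> x \in C -> y \in C -> g k x = g l y -> k = l /\ x = y) ->
  (5 * #|`C| <= #|`N|)%N.
Proof.
move=> CN gN ginj.
pose G (a : 'I_5 * C) : N := [` gN a.1 _ (valP a.2)].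
have Ginj : injective G.
  move=> [k x] [l y] /(congr1 val)/= e.
  have [kl xy] := ginj _ _ _ _ (ltn_ord k) (ltn_ord l) (valP x) (valP y) e.
  by congr pair; apply: val_inj.
by have := leq_card G Ginj; rewrite card_prod card_ord -!cardfE.
Qed.

End Trigonometry.

Section Separation.
Local Open Scope ring_scope.
Variables (R : realType) (p q : nat) (T : set (set 'rV[R]_3)).
Hypothesis p5 : (5 <= p)%N.
Hypothesis hT : regular_tiling p T q.
Local Notation vec := 'rV[R]_3.
Local Notation tile := (tile p T).
Local Notation adjacent := (Defs.adjacent p T).
Local Notation s := (sk R p 1).
Implicit Types (x y z u m : vec) (v w : nat -> vec) (S U : R) (P Q : set vec).

Let s0 : 0 < s. Proof. exact: sk1_gt0. Qed.

(** From [1 - cos t <= t^2 / 2] and [(q - 1) angle A <= 2 pi < 8], the hyperbolic cosine [A] of the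
    side grows like [q^2]. The bound 31 on [q] gives the angle [2 pi / 30], the precision used in
    [cone_card]. *)
Lemma angle_large A : 1 < A -> (31 <= q)%N -> (q%:R - 1) * angle p A <= 2 * pi ->
  (1 - s ^+ 2) * (q%:R - 1) ^+ 2 <= 8 * (A + 1) /\ angle p A <= pi / 15.
Proof.
move=> A1 q31 h; have [/andP[al0 alpi] ca] := angle_bounds p5 A1.
have q1 : 30 <= q%:R - 1 :> R by rewrite lerBrDr natr1 ler_nat.
have ipi := pi_gt0 R; split; last first.
  have : 30 * angle p A <= (q%:R - 1) * angle p A by rewrite ler_pM2r.
  lra.
have h1 : 4 * (1 - s ^+ 2) <= (A + 1) * (angle p A ^+ 2 / 2).
  have -> : 4 * (1 - s ^+ 2) = (A + 1) * (1 - cos (angle p A)).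
    by rewrite ca; field; rewrite gt_eqF//; lra.
  by rewrite ler_pM2l ?cos_ge_sqr ?(ltW al0) ?(ltW alpi)//; lra.
have h2 : ((q%:R - 1) * angle p A) ^+ 2 <= 64.
  have [/andP[_ p4] _] := pihalf_02_cos_pihalf R.
  apply: (@le_trans _ _ (8 ^+ 2)); last by lra.
  by rewrite ler_sqr ?nnegrE ?mulr_ge0 ?(ltW al0)//; lra.
have h3 : (A + 1) * ((q%:R - 1) * angle p A) ^+ 2 <= (A + 1) * 64 by rewrite ler_pM2l//; lra.
have h4 : 4 * (1 - s ^+ 2) * (q%:R - 1) ^+ 2 <= (A + 1) * (angle p A ^+ 2 / 2) * (q%:R - 1) ^+ 2.
  by rewrite ler_wpM2r// sqr_ge0.
by move: h3; rewrite exprMn; lra.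
Qed.

Lemma tile_vertex P w U k : tile P w U -> tile_vertices p T (w k).
Proof. by move=> [TP hP _]; exists P, w, k. Qed.

(** Selects the tile at [x] into which a curve towards [y] starts, so that [y] is on the inner side
    of both its sides at [x]. *)
Lemma vertex_curve x y : tile_vertices p T x -> exists Q w U k, [/\ tile Q w U, x = w k.+1,
  0 <= det3 (w k) (w k.+1) y & 0 <= det3 (w k.+1) (w k.+2) y].
Proof.
move=> Vx; have [P [v [S [i [tP xv]]]]] := vertex_tile Vx.
have [Q [w [U [tQ Qx sg]]]] := curve_tileP hT y (vertex_hyp p5 Vx).
have [j xw] : exists j, x = w j.
  by rewrite xv; apply: (vertex_in_tile p5 hT tP tQ); rewrite -xv.
have [k kE] := reg_succ p5 (tile_reg tQ) j.
have {kE}kE : x = w k.+1 by have := kE 0%N; rewrite !addn0 xw.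
by exists Q, w, U, k; split=> //; apply: (sg _ _ _ tQ); rewrite kE ?det3xyy ?det3xyx.
Qed.

Variable N : R.
Hypothesis adjN : forall x y, adjacent x y -> N <= - mink x y.

(* Apart from the vertices of the tile of [x] facing [y], the point [y] is beyond a
   side of that tile not containing [x]. *)
Lemma vertex_separation K x y : tile_vertices p T x -> tile_vertices p T y -> x <> y ->
  K <= N -> K ^+ 2 <= 2 * (N - 1) * s ^+ 2 -> K <= - mink x y.
Proof.
move=> Vx Vy xy KN K2; have [Q [w [U [k [tQ xw y1 y2]]]]] := vertex_curve y Vx.
have hx := vertex_hyp p5 Vx; have hy := vertex_hyp p5 Vy.
have wU := tile_reg tQ; have U0 := reg_S_gt0 wU.
have NU : N <= 1 + 2 * U ^+ 2 * s ^+ 2.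
  by have := adjN (tile_adjacent k tQ); rewrite (reg_mink_adj p5 wU) opprK.
have [Qy|Qy] := pselect (Q y).
  have [P [v [S [i [tP yv]]]]] := vertex_tile Vy.
  have [j yw] : exists j, y = w j.
    by rewrite yv; apply: (vertex_in_tile p5 hT tP tQ); rewrite -yv.
  case: (reg_mink_le p5 wU k.+1 j) => [e|]; first by case: xy; rewrite xw yw.
  by rewrite -xw -yw; lra.
have [l yl] : exists l, det3 (w l) (w l.+1) y < 0.
  apply: contrapT => /forallNP h; apply: Qy; apply/(tileE y tQ); split=> // l.
  by rewrite leNgt; apply/negP/h.
(* A side that excludes [y] does not end at [x], by the choice of the tile, so [x] has a definite
   height over its line. *)
have dl : 4 * Num.sqrt (1 + U ^+ 2) * U ^+ 2 * s ^+ 3 <= det3 (w l) (w l.+1) x.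
  rewrite xw; case: (reg_det_ge p5 wU l k.+1) => [e|[e|//]].
    have := reg_index_eq p5 wU e 1; rewrite !addn1 => e1.
    by move: y2; rewrite e e1 leNgt yl.
  by move: y1; rewrite e (reg_index_pred p5 wU e) leNgt yl.
have sepn := @mink_separated R (cross (w l) (w l.+1)) x y hx hy.
move: sepn; rewrite mink_cross2 !mink_cross (reg_mink_adj p5 wU) => sepn.
have [[hl _] [hl1 _]] := (reg_hyp p5 wU l, reg_hyp p5 wU l.+1); rewrite hl hl1 in sepn.
have C2 : Num.sqrt (1 + U ^+ 2) ^+ 2 = 1 + U ^+ 2.
  by rewrite sqr_sqrtr// addr_ge0// sqr_ge0.
have C0 : 0 <= Num.sqrt (1 + U ^+ 2) by exact: sqrtr_ge0.
set C := Num.sqrt _ in C2 C0 dl *; set d := det3 _ _ x in sepn dl; set M := mink x y in sepn *.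
have d0 : 0 <= 4 * C * U ^+ 2 * s ^+ 3.
  by apply: mulr_ge0 (exprn_ge0 _ (ltW s0)); apply: mulr_ge0 (exprn_ge0 _ (ltW U0)); lra.
have {}sepn := sepn (le_trans d0 dl) (ltW yl).
have u2 : 0 < U ^+ 2 by exact: exprn_gt0.
have s2 : 0 < s ^+ 2 by exact: exprn_gt0.
have s1 : s <= 1 by exact: sk_le1.
have s21 : s ^+ 2 <= 1 by rewrite expr_le1// ltW.
set nn := (- _) ^+ 2 - _ in sepn.
have nnE : nn = 4 * (U ^+ 2 * s ^+ 2) * (1 + U ^+ 2 * s ^+ 2) by rewrite /nn; ring.
have us : 0 < U ^+ 2 * s ^+ 2 by exact: mulr_gt0.
have nn0 : 0 < nn by rewrite nnE !mulr_gt0//; lra.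
have d2 : (4 * C * U ^+ 2 * s ^+ 3) ^+ 2 <= d ^+ 2.
  by rewrite ler_sqr ?nnegrE// (le_trans d0).
have e1 : nn * (4 * U ^+ 2 * s ^+ 2 * s ^+ 2) <= d ^+ 2.
  apply: le_trans d2; rewrite [leRHS](_ : _ = 16 * (U ^+ 2) ^+ 2 * (s ^+ 2) ^+ 3 * C ^+ 2); last by ring.
  rewrite nnE C2.
  rewrite [leLHS](_ : _ = 16 * (U ^+ 2) ^+ 2 * (s ^+ 2) ^+ 3 * (1 + U ^+ 2 * s ^+ 2)); last by ring.
  apply: ler_wpM2l; last by rewrite lerD2l ler_piMr// ltW.
  by apply: mulr_ge0 (exprn_ge0 _ (ltW s2)); apply: mulr_ge0 (exprn_ge0 _ (ltW u2)).
have e2 : 4 * U ^+ 2 * s ^+ 2 * s ^+ 2 <= M ^+ 2.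
  by rewrite -(ler_pM2l nn0); lra.
have e3 : 2 * (N - 1) * s ^+ 2 <= 4 * U ^+ 2 * s ^+ 2 * s ^+ 2 by rewrite ler_pM2r//; lra.
have M0 : 0 <= - M by have := hyp_mink_le hx hy; rewrite -/M; lra.
have [K0|/ltW K0] := leP K 0; first exact: le_trans M0.
rewrite -ler_sqr ?nnegrE// sqrrN; lra.
Qed.

End Separation.

Section Cone.
Local Open Scope ring_scope.
Variables (R : realType) (p q : nat) (T : set (set 'rV[R]_3)).
Hypothesis p5 : (5 <= p)%N.
Hypothesis hT : regular_tiling p T q.
Local Notation vec := 'rV[R]_3.
Local Notation tile := (tile p T).
Local Notation adjacent := (Defs.adjacent p T).
Local Notation s := (sk R p 1).
Implicit Types (x y z u m : vec) (v w : nat -> vec) (S U : R) (P Q : set vec).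

(** The triangle inequality in the form [cosh (a + b) <= 2 cosh a cosh b]. *)
Lemma mink_triangle c x y : hyp c -> hyp x -> hyp y -> - mink x y <= 2 * (mink c x * mink c y).
Proof.
move=> hc hx hy; have [[hc1 _] [hx1 _] [hy1 _]] := And3 hc hx hy.
have a1 := hyp_mink_le hc hx; have b1 := hyp_mink_le hc hy.
set a := mink c x in a1 *; set b := mink c y in b1 *.
have cx : mink c (x + a *: c) = 0 by rewrite !minkE hc1 -/a; ring.
have cy : mink c (y + b *: c) = 0 by rewrite !minkE hc1 -/b; ring.
have := mink_cauchy hc1 cx cy; rewrite !minkE hx1 hy1 hc1 (minkC x c) (minkC y c) -/a -/b.
have ab : 0 <= a * b by rewrite -mulrNN mulr_ge0//; lra.
move=> h; have h2 : (mink x y + a * b) ^+ 2 <= (a * b) ^+ 2.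
  apply: (@le_trans _ _ ((a ^+ 2 - 1) * (b ^+ 2 - 1))); last by rewrite exprMn; nra.
  by apply: le_trans (le_trans h _); rewrite le_eqVlt; apply/orP; left; apply/eqP; ring.
have : `|mink x y + a * b| <= `|a * b| by rewrite -ler_sqr ?nnegrE// !real_normK ?num_real.
rewrite (ger0_norm ab) => h3; have := ler_norm (- (mink x y + a * b)).
by rewrite normrN; lra.
Qed.

(* Five rotations of the cone, by multiples of an angle between [pi / 3] and
   [2 pi / 5] preserving the neighbours of [x], are disjoint. *)
Lemma cone_card x m (C : {fset vec}) : (31 <= q)%N -> tile_vertices p T x -> unit_tangent x m ->
  (forall y, y \in C -> adjacent x y /\ 9 / 10 * Num.sqrt (mink x y ^+ 2 - 1) <= mink y m) ->
  (5 * #|`C| <= q)%N.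
Proof.
move=> q31 Vx [xm mm] hC; have [A [A1 qa _ orb]] := star p5 hT Vx.
have [/andP[al0 _] _] := angle_bounds p5 A1.
have [_ al15] := angle_large p5 A1 q31 qa; set al := angle p A in al0 al15 orb qa *.
have hx := vertex_hyp p5 Vx; have [e [f F]] := frame_exists hx.
have [t tE] := orb e f F; have ipi := pi_gt0 R.
have B0 := sqrt_sqr1_gt0 A1; set B := Num.sqrt (A ^+ 2 - 1) in B0.
have [psi [_ _ mc ms]] : exists t, [/\ 0 <= t, t < 0 + 2 * pi, mink e m = 1 * cos t & mink f m = 1 * sin t].
  apply: polar => //; have := mink_fr 0 (mink e m) (mink f m) 0 (mink e m) (mink f m) F.
  have -> : fr x e f 0 (mink e m) (mink f m) = m by rewrite [RHS](frame_decomp m F) xm oppr0.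
  by rewrite mm expr1n !expr2 => ->; rewrite mul0r oppr0 add0r.
rewrite !mul1r in mc ms.
have rayE (u : R) : mink (ray x e f A u) m = B * cos (u - psi).
  by rewrite {1}(frame_decomp m F) /ray mink_fr// xm mc ms cosB -/B; ring.
have /choice[idx idxE] : forall y, exists i : nat, y \in C -> y = ray x e f A (t + i%:R * al).
  move=> y; have [yC|yC] := boolP (y \in C); last by exists 0%N.
  by have [/tE[i yE] _] := hC _ yC; exists i.
have cosC y : y \in C -> 9 / 10 <= cos (t + (idx y)%:R * al - psi).
  move=> yC; have [_] := hC _ yC; rewrite {2}(idxE _ yC) rayE.
  rewrite {1}(idxE _ yC) mink_ray// sqrrN -/B mulrC ler_pM2l//.
(* The rotation by [ph = j al] exceeds [2 pi/5 - al], hence is at least [2 pi/5 - pi/15 = pi/3]. Its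
   multiples up to the fourth stay below [8 pi/5], thus at least [pi/3] away from a full turn. *)
pose j := Num.truncn (2 * pi / 5 / al).
have /andP[j1 j2] : j%:R <= 2 * pi / 5 / al < j.+1%:R.
  by apply: truncn_itv; rewrite ltW// !divr_gt0// mulr_gt0.
rewrite ler_pdivlMr// in j1; rewrite ltr_pdivrMr// [j.+1%:R * al](_ : _ = j%:R * al + al) in j2; last by rewrite -natr1 mulrDl mul1r.
set ph := j%:R * al in j1 j2.
have ph1 : pi / 3 <= ph by clear -j2 al15; lra.
have ph4 : 4 * ph <= 5 * pi / 3 by clear -j1 ipi; lra.
have [_ _ _ _ /(_ x Vx) card] := hT.
pose N := fset_set [set y | adjacent x y].
have fN : finite_set [set y | adjacent x y] by exists q.
have <- : #|`N| = q by exact: card_fset_set.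
have inN y : (y \in N) <-> adjacent x y by rewrite in_fset_set//; split; rewrite inE.
pose g (k : nat) y := ray x e f A (t + (idx y + k * j)%:R * al).
have gE k y : g k y = ray x e f A (t + (idx y)%:R * al + k%:R * ph).
  by rewrite /g natrD natrM /ph; congr ray; ring.
apply: (@five_images _ N C g) => [y yC|k y yC|k l y z k5 l5 yC zC].
- by apply/inN; have [] := hC _ yC.
- by apply/inN/tE; eexists.
rewrite !gE => eg.
have [cE sE] : cos (t + (idx y)%:R * al + k%:R * ph) = cos (t + (idx z)%:R * al + l%:R * ph) /\
    sin (t + (idx y)%:R * al + k%:R * ph) = sin (t + (idx z)%:R * al + l%:R * ph).
  have [_ [xe ee] [xf ff] ef _] := F.
  have Bn : B != 0 by rewrite gt_eqF.
  have me (u : R) : mink e (ray x e f A u) = B * cos u.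
    by rewrite /ray /fr !minkE (minkC e x) xe ee ef -/B; ring.
  have mf (u : R) : mink f (ray x e f A u) = B * sin u.
    by rewrite /ray /fr !minkE (minkC f x) (minkC f e) xf ff ef -/B; ring.
  by split; apply: (mulfI Bn); [rewrite -!me eg|rewrite -!mf eg].
have shift (u v d : R) : cos u = cos v -> sin u = sin v ->
    cos (u - d) = cos (v - d) /\ sin (u - d) = sin (v - d).
  by move=> h1 h2; rewrite !cosB !sinB h1 h2.
have far (k' l' : nat) y' z' : (k' < l')%N -> (l' < 5)%N -> y' \in C -> z' \in C ->
    cos (t + (idx y')%:R * al + k'%:R * ph) = cos (t + (idx z')%:R * al + l'%:R * ph) ->
    sin (t + (idx y')%:R * al + k'%:R * ph) = sin (t + (idx z')%:R * al + l'%:R * ph) -> False.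
  move=> kl l'5 y'C z'C cE' sE'.
  have [c1 s1] := shift _ _ (psi + k'%:R * ph) cE' sE'.
  apply: (cos_far (cosC _ z'C) (cosC _ y'C) (d := (l' - k')%:R * ph)).
  - have -> : t + (idx y')%:R * al - psi = t + (idx y')%:R * al + k'%:R * ph - (psi + k'%:R * ph) by ring.
    by rewrite c1; congr cos; rewrite natrB ?(ltnW kl)//; ring.
  - have -> : t + (idx y')%:R * al - psi = t + (idx y')%:R * al + k'%:R * ph - (psi + k'%:R * ph) by ring.
    by rewrite s1; congr sin; rewrite natrB ?(ltnW kl)//; ring.
  apply: cos_le_half; have d1 : 1 <= (l' - k')%:R :> R by rewrite ler1n subn_gt0.
  have d4 : (l' - k')%:R <= 4 :> R by rewrite ler_nat -ltnS (leq_ltn_trans (leq_subr _ _)).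
  have ph0 : 0 <= ph by apply: le_trans ph1; rewrite divr_ge0// ltW.
  have m1 : ph <= (l' - k')%:R * ph by rewrite ler_peMl.
  have m4 : (l' - k')%:R * ph <= 4 * ph by rewrite ler_wpM2r.
  by rewrite (le_trans ph1 m1) (le_trans m4 ph4).
have kl : k = l.
  have [kl|lk|//] := ltngtP k l; first by case: (far _ _ _ _ kl l5 yC zC cE sE).
  by case: (far _ _ _ _ lk k5 zC yC (esym cE) (esym sE)).
split=> //; rewrite kl in cE sE; have [c1 s1] := shift _ _ (l%:R * ph) cE sE.
by rewrite !addrK in c1 s1; rewrite (idxE _ yC) (idxE _ zC) /ray c1 s1.
Qed.

(** The tile angle is at least [2 pi / q], which bounds the sides, hence the circumradius uniformly
    over the tiles; a point and a vertex of its tile are then compared through the centre. *)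
Lemma vertex_near : exists M, forall z, hyp z -> exists2 x, tile_vertices p T x & - mink z x <= M.
Proof.
have s0 : 0 < s := sk1_gt0 R p5; have ipi := pi_gt0 R.
pose D := 4 * (1 - s ^+ 2) / (1 - cos (2 * pi / q%:R)).
exists (2 * (1 + D / (2 * s ^+ 2))) => z hz.
have [_ cov _ _ _] := hT; have [P TP Pz] := cov _ hz.
have [w [U tP]] := tile_exists hT TP; have wU := tile_reg tP.
exists (w 0%N); first exact: tile_vertex tP.
have [c [hc cw _ cz]] := reg_center p5 wU.
have hw := tile_hyp p5 0 tP.
apply: le_trans (mink_triangle hc hz hw) _.
rewrite ler_pM2l// cw; have {}cz := cz z ((tileE z tP).1 Pz).
have U0 := reg_S_gt0 wU.
set C := Num.sqrt _ in cz; have C0 : 0 <= C by exact: sqrtr_ge0.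
have C2 : C ^+ 2 = 1 + U ^+ 2 by rewrite sqr_sqrtr// addr_ge0// sqr_ge0.
rewrite mulrN -mulNr; apply: (@le_trans _ _ (C ^+ 2)); first by rewrite expr2 ler_wpM2r.
rewrite C2 lerD2l ler_pdivlMr ?mulr_gt0 ?exprn_gt0//.
have Vw := tile_vertex 0 tP.
have [A [A1 _ qa orb]] := star p5 hT Vw.
have [/andP[al0 alpi] ca] := angle_bounds p5 A1.
have [e [f F]] := frame_exists hw; have [t tE] := orb e f F.
have /tE[i iE] := tile_adjacent 0 tP.
have AE : A = 1 + 2 * U ^+ 2 * s ^+ 2.
  by have := reg_mink_adj p5 wU 0; rewrite iE mink_ray// => /oppr_inj.
have q0 : (0 < q)%N by rewrite lt0n; apply/eqP => q0; move: qa; rewrite q0; nra.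
have q0' : 0 < q%:R :> R by rewrite ltr0n.
have q2 : 2 * pi / q%:R <= angle p A by rewrite ler_pdivrMr// [leRHS]mulrC.
have c1 : cos (angle p A) <= cos (2 * pi / q%:R).
  rewrite leNgt ltr_cos -?leNgt// in_itv/= ?(ltW al0) ?(ltW alpi)//.
  by rewrite divr_ge0 ?mulr_ge0 ?(ltW ipi)//= (le_trans q2 (ltW alpi)).
have s1 : s < 1 by exact: sk1_lt1.
have s2 : s ^+ 2 < 1 by rewrite expr_lt1// ltW.
have k1 : 1 - cos (2 * pi / q%:R) <= 4 * (1 - s ^+ 2) / (A + 1) by move: c1; rewrite ca; lra.
have k2 : 0 < 1 - cos (2 * pi / q%:R : R).
  rewrite subr_gt0 lt_neqAle cos_le1 andbT; apply/eqP => h.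
  have := cos_eq1 h; rewrite divr_gt0 ?mulr_gt0// => /(_ isT) h2; have := le_trans h2 (le_trans q2 (ltW alpi)); lra.
rewrite ler_pdivlMr in k1; last by lra.
have : A + 1 <= D by rewrite /D ler_pdivlMr// mulrC.
by rewrite AE; lra.
Qed.

End Cone.

(** * The isoperimetric inequality *)

Section Isoperimetry.
Local Open Scope fset_scope.
Local Open Scope ring_scope.
Variables (R : realType) (V : choiceType) (nb : V -> {fset V}).
Implicit Types (A B C D : {fset V}) (b : pred V).

Lemma sum_ind_card A b : \sum_(y <- A) (b y)%:R = #|` [fset y in A | b y]|%:R :> R.
Proof.
rewrite card_fset_sum1 natr_sum -[RHS]big_fset_condE [RHS]big_mkcond /=.
by apply: eq_bigr => y _; case: (b y).
Qed.

Lemma sum_ind_mem A B : \sum_(y <- A) (y \in B)%:R = \sum_(y <- B) (y \in A)%:R :> R.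
Proof.
rewrite !sum_ind_card; congr (#|` _|%:R).
by apply/fsetP => y; rewrite !inE andbC.
Qed.

(* Orienting the edges inside [D] by the height [h], each vertex of [D] carries
   at most [q / 5] of them, and at most [q / 5] of the boundary edges at a vertex
   are frustrated. *)
Lemma isoperimetry (s : V -> bool) (h : V -> R) (q : nat) : (5 <= q)%N ->
  (forall x y, (y \in nb x) = (x \in nb y)) -> (forall x, #|` nb x| = q) ->
  (forall x, 5 * #|` [fset y in nb x | s y != s x]| <= q)%N ->
  (forall x, 5 * #|` [fset y in nb x | (h y <= h x)%R]| <= q)%N ->
  forall D, #|` D|%:R <= excess R nb s D.
Proof.
move=> q5 nb_sym nbq fs fh D.
have c A (k : R) : \sum_(x <- A) k = #|` A|%:R * k.
  by rewrite card_fset_sum1 natr_sum mulr_suml; apply: eq_bigr => x _; rewrite mul1r.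
pose I x : R := \sum_(y <- nb x) (y \in D)%:R.
pose B x : R := \sum_(y <- nb x) (s y != s x)%:R.
pose L x : R := \sum_(y <- nb x) ((h y <= h x)%R)%:R.
have small A : (5 * #|` A| <= q)%N -> #|` A|%:R <= q%:R / 5 :> R.
  by move=> hA; rewrite ler_pdivlMr// -natrM ler_nat mulnC.
have Bq x : B x <= q%:R / 5 by rewrite /B sum_ind_card; exact/small/fs.
have Lq x : L x <= q%:R / 5 by rewrite /L sum_ind_card; exact/small/fh.
have inner x : q%:R - I x - 2 * B x <= \sum_(y <- nb x `\` D) spin R (s x) * spin R (s y).
  have -> : \sum_(y <- nb x `\` D) spin R (s x) * spin R (s y) =
      \sum_(y <- nb x | y \notin D) spin R (s x) * spin R (s y).
    by rewrite [RHS]big_fset_condE; apply: eq_fbigl => y; rewrite !inE andbC.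
  have -> : q%:R - I x - 2 * B x =
      \sum_(y <- nb x) (1 - (y \in D)%:R - 2 * (s y != s x)%:R).
    by rewrite !sumrB -mulr_sumr -/(I x) -/(B x) c mulr1 nbq.
  rewrite [leRHS]big_mkcond /=; apply: ler_sum => y _.
  by rewrite /spin; case: (y \in D); case: (s x); case: (s y) => /=; lra.
have inside : \sum_(x <- D) I x <= 2 * \sum_(x <- D) L x.
  (* An edge inside [D] is charged to its higher end, and to both ends in case of a tie; hence the
     weak inequality in the hypothesis on [h]. *)
  pose a x y : R := ((y \in nb x) && (h y <= h x)%R)%:R.
  have aL x : \sum_(y <- D) a x y <= L x.
    rewrite /L /a sum_ind_card sum_ind_card ler_nat; apply: fsubset_leq_card.
    by apply/fsubsetP => y; rewrite !inE => /andP[_].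
  have -> : \sum_(x <- D) I x = \sum_(x <- D) \sum_(y <- D) (y \in nb x)%:R.
    by apply: eq_bigr => x _; rewrite /I sum_ind_mem.
  apply: (@le_trans _ _ (\sum_(x <- D) \sum_(y <- D) (a x y + a y x))).
    apply: ler_sum => x _; apply: ler_sum => y _; rewrite /a (nb_sym y x).
    by case: (y \in nb x); rewrite /= ?addr0//; case/orP: (le_total (h y) (h x)) => ->; rewrite /= ?lerDl ?lerDr.
  have -> : \sum_(x <- D) \sum_(y <- D) (a x y + a y x) = 2 * \sum_(x <- D) \sum_(y <- D) a x y.
    under eq_bigr do rewrite big_split.
    by rewrite big_split /= [X in _ + X]exchange_big /=; ring.
  by rewrite ler_pM2l//; apply: ler_sum => x _.
apply: (@le_trans _ _ (\sum_(x <- D) (q%:R - I x - 2 * B x))); last first.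
  by apply: ler_sum => x _; exact: inner.
rewrite !sumrB -mulr_sumr.
have LD : \sum_(x <- D) L x <= #|` D|%:R * (q%:R / 5) by rewrite -c; apply: ler_sum.
have BD : \sum_(x <- D) B x <= #|` D|%:R * (q%:R / 5) by rewrite -c; apply: ler_sum.
have D5 : #|` D|%:R <= #|` D|%:R * (q%:R / 5) :> R.
  by rewrite ler_peMr// ler_pdivlMr// mul1r ler_nat.
rewrite c; move: LD BD D5 inside; lra.
Qed.

End Isoperimetry.

Section Stability.
Local Open Scope ring_scope.
Variables (R : realType) (p q : nat) (T : set (set 'rV[R]_3)).
Hypothesis p5 : (5 <= p)%N.
Hypothesis hT : regular_tiling p T q.
Hypothesis q31 : (31 <= q)%N.
Local Notation vec := 'rV[R]_3.
Local Notation adjacent := (Defs.adjacent p T).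
Hypothesis adj10 : forall x y : vec, adjacent x y -> 10 <= - mink x y.
Implicit Types (x y z u m o : vec).

(** For [A = cosh a], the quotient of [A - 1] by the square root is [tanh (a/2)], which is at least
    9/10 from [A = 10] on. *)
Lemma tanh_half (A : R) : 10 <= A -> 9 / 10 * Num.sqrt (A ^+ 2 - 1) <= A - 1.
Proof.
move=> A10; have h : 0 <= A - 1 by lra.
have h2 : 0 <= A ^+ 2 - 1 by nra.
have h3 : 0 <= 9 / 10 * Num.sqrt (A ^+ 2 - 1) by rewrite mulr_ge0 ?sqrtr_ge0//; lra.
rewrite -ler_sqr ?nnegrE// exprMn sqr_sqrtr//.
have : 0 <= (A - 1) * (19 / 100 * A - 181 / 100) by rewrite mulr_ge0//; lra.
lra.
Qed.

(** The axis of the cone is the direction from [x] to [o]. A neighbour no farther from [o] than [x]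
    makes with it an angle of cosine at least [tanh (a/2)], where [a] is the length of the side. *)
Lemma closer_card x o (C : {fset vec}) : tile_vertices p T x -> hyp o ->
  (forall y, y \in C -> adjacent x y /\ - mink o y <= - mink o x) -> (5 * #|`C| <= q)%N.
Proof.
move=> Vx ho hC; have hx := vertex_hyp p5 Vx; have [hx1 _] := hx; have [ho1 _] := ho.
set H := - mink o x in hC; have oE : mink o x = - H by rewrite opprK.
have [H1|H1] := eqVneq H 1.
  have ox : o = x by apply: hyp_mink_eq => //; rewrite oE H1.
  suff -> : C = fset0 by rewrite cardfs0 muln0.
  apply/fsetP => y; rewrite inE; apply/negP => /hC[/adj10 a].
  by rewrite ox H1; lra.
have H2 : 1 < H.
  by rewrite lt_neqAle eq_sym H1 /=; have := hyp_mink_le ho hx; rewrite /H; lra.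
have B0 := sqrt_sqr1_gt0 H2; set B := Num.sqrt _ in B0.
have B2 : B ^+ 2 = H ^+ 2 - 1 by rewrite sqr_sqrtr//; nra.
have BH : B < H by rewrite -ltr_sqr ?nnegrE ?(ltW B0)//; lra.
have Bn : B != 0 by rewrite gt_eqF.
apply: (@cone_card _ _ _ _ p5 hT x (B^-1 *: (o - H *: x)) C q31 Vx).
  split; rewrite !minkE ?hx1 ?ho1 ?(minkC x o) ?oE; first by ring.
  transitivity ((H ^+ 2 - 1) / B ^+ 2); first by field.
  by rewrite -B2 divff// expf_neq0.
move=> y yC; have [xy hy] := hC y yC; split=> //.
have A10 := adj10 xy; set A := - mink x y in A10; have xyE : mink x y = - A by rewrite opprK.
rewrite xyE sqrrN; apply: le_trans (tanh_half A10) _.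
rewrite !minkE (minkC y o) (minkC y x) xyE mulrC ler_pdivlMr//.
have : (A - 1) * B <= (A - 1) * H by rewrite ler_wpM2l ?(ltW BH)//; lra.
lra.
Qed.

(** The axis of the cone is the perpendicular from [x] to the geodesic with normal [n]. Neighbours
    beyond the geodesic have cosine at least [f / sqrt (1 + f^2)], and [f = 3] already gives more
    than 9/10. *)
Lemma across_card x n (C : {fset vec}) : tile_vertices p T x -> mink n n = 1 -> 3 <= mink n x ->
  (forall y, y \in C -> adjacent x y /\ mink n y <= 0) -> (5 * #|`C| <= q)%N.
Proof.
move=> Vx nn nx hC; have hx := vertex_hyp p5 Vx; have [hx1 _] := hx.
set f := mink n x in nx.
have f2 : 0 < 1 + f ^+ 2 by rewrite ltr_pwDl// sqr_ge0.
have G0 : 0 < Num.sqrt (1 + f ^+ 2) by rewrite sqrtr_gt0.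
set G := Num.sqrt _ in G0; have G2 : G ^+ 2 = 1 + f ^+ 2 by rewrite sqr_sqrtr// ltW.
have Gn : G != 0 by rewrite gt_eqF.
have fG : 9 / 10 * G <= f.
  have h3 : 0 <= 9 / 10 * G by rewrite mulr_ge0 ?(ltW G0)//; lra.
  have f0 : 0 <= f by lra.
  rewrite -ler_sqr ?nnegrE// exprMn G2.
  have : 9 <= f ^+ 2 by rewrite (_ : 9 = 3 ^+ 2) ?ler_sqr ?nnegrE//; ring.
  lra.
apply: (@cone_card _ _ _ _ p5 hT x (- (G^-1 *: (n + f *: x))) C q31 Vx).
  split; rewrite !minkE ?hx1 ?nn ?(minkC x n) -/f; first by ring.
  transitivity ((1 + f ^+ 2) / G ^+ 2); first by field.
  by rewrite -G2 divff// expf_neq0.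
move=> y yC; have [xy hy] := hC y yC; split=> //.
have A10 := adj10 xy; set A := - mink x y in A10; have xyE : mink x y = - A by rewrite opprK.
rewrite xyE sqrrN !minkE (minkC y n) (minkC y x) xyE.
have A2 : 0 <= A ^+ 2 - 1 by nra.
have BA : Num.sqrt (A ^+ 2 - 1) <= A.
  by rewrite -ler_sqr ?nnegrE ?sqrtr_ge0 ?sqr_sqrtr//; lra.
apply: (@le_trans _ _ (9 / 10 * A)); first by rewrite ler_pM2l//; lra.
rewrite -mulrN [leRHS]mulrC ler_pdivlMr//.
have : 9 / 10 * G * A <= f * A by rewrite ler_wpM2r//; lra.
lra.
Qed.

Let V := set_type (tile_vertices p T).

Definition neighbours (x : V) : {fset V} := fset_set [set y : V | adjacent (val x) (val y)].

Lemma card_neighbours_set (x : V) : ([set y : V | adjacent (val x) (val y)] #= `I_q)%card.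
Proof.
have [_ _ _ _ /(_ (val x) (set_valP x)) card] := hT.
rewrite -(card_eqr card); apply/card_esym.
have -> : [set y | adjacent (val x) y] = [set val y | y in [set y : V | adjacent (val x) (val y)]].
  rewrite eqEsubset; split => [y /= xy|_ [y xy <-]//].
  have Vy : tile_vertices p T y := adjacent_vertex (adjacentC xy).
  by exists (SigSub (mem_set Vy)).
by apply: inj_card_eq => a b _ _; exact: val_inj.
Qed.

Lemma finite_neighbours (x : V) : finite_set [set y : V | adjacent (val x) (val y)].
Proof. by exists q; exact: card_neighbours_set. Qed.

Lemma neighboursE (x y : V) : (y \in neighbours x) <-> adjacent (val x) (val y).
Proof. by rewrite in_fset_set; [split; rewrite inE|exact: finite_neighbours]. Qed.

Lemma card_neighbours (x : V) : #|` neighbours x| = q.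
Proof. exact/card_fset_set/card_neighbours_set. Qed.

Lemma neighbours_sym (x y : V) : (y \in neighbours x) = (x \in neighbours y).
Proof. by apply/idP/idP => /neighboursE/adjacentC/neighboursE. Qed.

Lemma neighbours_irr (x : V) : x \notin neighbours x.
Proof.
apply/negP => /neighboursE/adj10; have [-> _] := vertex_hyp p5 (set_valP x); lra.
Qed.

(** The spin is the sign of the product with the unit normal [n]; vertices on the right are treated
    with [- n]. The height function is the distance to the base point, through its hyperbolic
    cosine. *)
Lemma geodesic_isoperimetry (g : geodesic R) :
  (forall x, tile_vertices p T x -> 3 <= `|det3 (gpt g) (gdir g) x|) ->
  forall D, #|` D|%:R <= excess R neighbours (@eta_geodesic R p T g) D.
Proof.
move=> far; set n := cross (gpt g) (gdir g).
have nE z : det3 (gpt g) (gdir g) z = mink n z by rewrite mink_cross.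
have nn : mink n n = 1.
  rewrite mink_cross2; have [-> _] := gpt_hyp g; have [-> ->] := gdir_unit g; ring.
have cardE (A : {fset V}) : #|` [fset (val y : vec) | y in A]| = #|` A|.
  by rewrite card_imfset//; exact: val_inj.
apply: (@isoperimetry R _ neighbours (@eta_geodesic R p T g) (fun x : V => - mink (gpt g) (val x)) q).
- by lia.
- exact: neighbours_sym.
- exact: card_neighbours.
- move=> x; have Vx := set_valP x.
  rewrite -cardE.
  have [sx|sx] := boolP (@eta_geodesic R p T g x).
    have fx : 0 <= mink n (val x) by have /asboolP := sx; rewrite /left_or_on nE.
    apply: (@across_card (val x) n) => //.
      by have := far _ Vx; rewrite nE ger0_norm.
    move=> z /imfsetP[y /= +] ->; rewrite !inE => /andP[/neighboursE xy sy]; split=> //.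
    have : ~~ @eta_geodesic R p T g y by move: sy; rewrite eqb_id.
    by move=> /asboolPn/negP; rewrite /left_or_on nE -ltNge => /ltW.
  have fx : mink n (val x) < 0.
    by have /asboolPn/negP := sx; rewrite /left_or_on nE -ltNge.
  apply: (@across_card (val x) (- n)) => //.
  - by rewrite minkNl minkNr opprK.
  - by have := far _ Vx; rewrite nE ltr0_norm// minkNl.
  move=> z /imfsetP[y /= +] ->; rewrite !inE => /andP[/neighboursE xy sy]; split=> //.
  have : @eta_geodesic R p T g y by move: sy; rewrite eqbF_neg negbK.
  by move=> /asboolP; rewrite /left_or_on nE minkNl oppr_le0.
- move=> x; have Vx := set_valP x.
  rewrite -cardE.
  apply: (@closer_card (val x) (gpt g)) => //; first exact: gpt_hyp.
  by move=> z /imfsetP[y /= +] ->; rewrite !inE => /andP[/neighboursE xy sy].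
Qed.

End Stability.

(** * A Cantor set of geodesics *)

(** The numerical end of [bad_unique], and the origin of the bound on [K]: the hypotheses give
    [K/4 <= 81 E^2 + 64 + 1]. *)
Lemma bad_arith (R : realType) (l m u v E K : R) : 4 * (81 * E ^+ 2 + 66) <= K ->
  l * l <= 8 * 8 -> 8^-1 * K <= m -> u <= v -> v <= (9 * E) ^+ 2 ->
  u = - l ^+ 2 - 1 + 2 * m -> False.
Proof. by have := sqr_ge0 E; move=> h1 h2 h3 h4 h5 h6; lra. Qed.

Section CantorSlopes.
Local Open Scope ring_scope.
Variable R : realType.
Local Notation vec := 'rV[R]_3.
Implicit Types (x y z o e f : vec) (a t : R) (i j n : nat) (b : nat -> bool).

Lemma hyp_of_mink c z : hyp c -> mink z z = -1 -> mink c z < 0 -> hyp z.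
Proof.
move=> hc z1 cz; split=> //; rewrite ltNge le_eqVlt; apply/negP => /orP[/eqP z0|z0].
  by move: z1; rewrite /mink z0; have := sqr_ge0 (z 0 1); have := sqr_ge0 (z 0 2); lra.
have hz : hyp (- z) by split; rewrite ?minkNl ?minkNr ?opprK// mxE oppr_gt0.
by have := hyp_mink_le hc hz; rewrite minkNr; lra.
Qed.

Variables (Z : set vec) (o e f : vec) (E K : R).
Hypothesis hE : 805 <= E.
Hypothesis hK : 4 * (81 * E ^+ 2 + 66) <= K.
Hypothesis F : frame o e f.
Hypothesis Zhyp : forall z, Z z -> hyp z.
Hypothesis Zsep : forall y z, Z y -> Z z -> y <> z -> K <= - mink y z.
Hypothesis Zfar : forall z, Z z -> 300 <= - mink o z.

Local Notation z1 z := (mink e z).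
Local Notation z2 z := (mink f z).
Local Notation w n := ((8 ^+ n)^-1 : R).

Let pow0 n : 0 < 8 ^+ n :> R. Proof. exact: exprn_gt0. Qed.
Let w0 n : 0 < w n. Proof. by rewrite invr_gt0. Qed.
Let wS n : w n = 8 * w n.+1.
Proof. by rewrite exprS invfM mulrA divff ?mul1r. Qed.
Let wpow n : w n * 8 ^+ n = 1. Proof. by rewrite mulVf// gt_eqF. Qed.

(* At stage [n] the interval of slopes has length [8 ^ -n], and only the points with
   first coordinate of order [8 ^ n] can come close to some but not all of them. *)
Definition level n z : Prop := 100 * 8 ^+ n <= `|z1 z| < 800 * 8 ^+ n.

(** The quantity [z2 - t z1] is the height of [z] over the geodesic of slope [t] up to a factor
    [sqrt (1 + t^2) <= 5/3], so that the threshold 5 secures the distance arcsinh 3. *)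
Definition bad n a : Prop := exists z t,
  [/\ Z z, level n z, a <= t <= a + w n.+1 & `|z2 z - t * z1 z| < 5].

(** Replacing [t] by the left end [a] costs at most the interval length times [800 8^n]; hence
    [E >= 5 + 800]. *)
Lemma near_slope n a z t : level n z -> a <= t <= a + w n -> `|z2 z - t * z1 z| < 5 ->
  `|z2 z - a * z1 z| <= E.
Proof.
move=> /andP[_ h] /andP[t1 t2] h5.
have -> : z2 z - a * z1 z = (z2 z - t * z1 z) + (t - a) * z1 z by ring.
apply: le_trans (ler_normD _ _) _.
have : `|(t - a) * z1 z| <= 800.
  rewrite normrM (ger0_norm (_ : 0 <= t - a)); last by lra.
  apply: (@le_trans _ _ (w n * (800 * 8 ^+ n))).
    by apply: ler_pM; [lra|exact: normr_ge0|lra|exact: ltW].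
  by rewrite mulrCA wpow mulr1.
move: hE; lra.
Qed.

(* Rescaling [z] to the same first coordinate as [z'] makes the two vectors
   nearly equal, so two distinct points of [Z] cannot both be bad. *)
Lemma bad_unique n a z z' : Z z -> Z z' -> level n z -> level n z' -> 0 < z1 z * z1 z' ->
  `|z2 z - a * z1 z| <= E -> `|z2 z' - a * z1 z'| <= E -> z = z'.
Proof.
move=> Zz Zz' /andP[l1 l2] /andP[l3 l4] s h h'; apply: contrapT => zz'.
have [hz _] := Zhyp Zz; have [hz' _] := Zhyp Zz'.
have z1n : z1 z != 0 by apply/eqP => e0; move: s; rewrite e0 mul0r ltxx.
have p0 : 0 < 8 ^+ n :> R by [].
have n0 : 0 < `|z1 z| by rewrite normr_gt0.
set l := z1 z' / z1 z.
have l0 : 0 < l.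
  have z2p : 0 < z1 z ^+ 2 by rewrite exprn_even_gt0.
  by rewrite -(pmulr_rgt0 _ z2p) (_ : _ * l = z1 z * z1 z')// /l; field.
have ln : l = `|z1 z'| / `|z1 z| by rewrite -[LHS](gtr0_norm l0) normrM normfV.
have l8 : l <= 8 by rewrite ln ler_pdivrMr//; lra.
have l18 : 8^-1 <= l by rewrite ln ler_pdivlMr//; lra.
pose u := l *: z - z'.
have u1 : mink e u = 0 by rewrite !minkE /l divfK// subrr.
have u2 : `|mink f u| <= 9 * E.
  have -> : mink f u = l * (z2 z - a * z1 z) - (z2 z' - a * z1 z').
    by rewrite !minkE /l; field.
  apply: le_trans (ler_normB _ _) _; rewrite normrM (gtr0_norm l0).
  have : l * `|z2 z - a * z1 z| <= 8 * E by apply: ler_pM => //; exact: ltW.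
  lra.
have u22 : mink f u ^+ 2 <= (9 * E) ^+ 2.
  by rewrite -[leLHS]real_normK ?num_real// ler_sqr ?nnegrE// (le_trans _ u2).
have uu : mink u u <= mink f u ^+ 2.
  have := mink_fr (- mink o u) (mink e u) (mink f u) (- mink o u) (mink e u) (mink f u) F.
  by rewrite -(frame_decomp u F) u1 => ->; have := sqr_ge0 (- mink o u); lra.
have : mink u u = - l ^+ 2 - 1 + 2 * (l * (- mink z z')).
  by rewrite /u !minkE hz hz' (minkC z' z); ring.
have : l * l <= 8 * 8 by apply: ler_pM => //; exact: ltW.
have E0 : 0 <= E ^+ 2 by exact: sqr_ge0.
have : 8^-1 * K <= l * (- mink z z').
  apply: ler_pM => //; last exact: (Zsep Zz Zz' zz').
  by apply: le_trans hK; rewrite mulr_ge0// addr_ge0// mulr_ge0.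
by move=> m1 m2 m3; exact: (bad_arith hK m2 m1 uu u22 m3).
Qed.

(** The four candidates are every other eighth, so distinct ones are an eighth apart. For each sign
    of the first coordinate only one point can be bad, and crossing such a gap moves its height by
    at least [100/8], more than the [5 + 5] it may vary while bad. So at most two candidates are
    lost, one per sign. *)
Lemma good_subintervals n a : exists ij : nat * nat, [/\ (ij.1 < ij.2)%N, (ij.2 < 4)%N,
  ~ bad n (a + ij.1.*2%:R * w n.+1) & ~ bad n (a + ij.2.*2%:R * w n.+1)].
Proof.
pose badS (sg : bool) i := (i < 4)%N /\ exists z t, [/\ Z z, level n z, (0 < z1 z) = sg,
  a + i.*2%:R * w n.+1 <= t <= a + i.*2%:R * w n.+1 + w n.+1 & `|z2 z - t * z1 z| < 5].
have w' := w0 n.+1.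
have uniq sg i j : badS sg i -> badS sg j -> (i < j)%N -> False.
  move=> [i4 [z [t [Zz lz sz tz bz]]]] [j4 [z' [t' [Zz' lz' sz' tz' bz']]]] ij.
  have inJ k u : (k < 4)%N ->
      a + k.*2%:R * w n.+1 <= u <= a + k.*2%:R * w n.+1 + w n.+1 -> a <= u <= a + w n.
    move=> k4 /andP[u1 u2]; rewrite wS.
    have : 0 <= k.*2%:R * w n.+1 by rewrite mulr_ge0// ltW.
    have : k.*2%:R * w n.+1 <= 6 * w n.+1 by rewrite ler_pM2r// ler_nat -[6%N]/(3.*2) leq_double -ltnS.
    by move=> h1 h2; apply/andP; split; lra.
  have nz y : level n y -> z1 y != 0.
    move=> /andP[h _]; rewrite -normr_gt0; apply: lt_le_trans h.
    by rewrite mulr_gt0// exprn_gt0.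
  have s0 : 0 < z1 z * z1 z'.
    have [p|np] := ltP 0 (z1 z).
      by rewrite mulr_gt0// sz' -sz p.
    have np' : z1 z' <= 0 by rewrite leNgt sz' -sz -leNgt.
    have n1 : z1 z < 0 by rewrite lt_neqAle np nz.
    have n2 : z1 z' < 0 by rewrite lt_neqAle np' nz.
    by rewrite nmulr_rgt0.
  have zz' : z = z'.
    apply: (bad_unique Zz Zz' lz lz' s0 (a := a)).
      exact: near_slope lz (inJ _ _ i4 tz) bz.
    exact: near_slope lz' (inJ _ _ j4 tz') bz'.
  rewrite -zz' in bz'; move/andP: tz => [t1 t2]; move/andP: tz' => [t'1 t'2].
  have tt : w n.+1 <= t' - t.
    have : (i.*2.+2)%:R * w n.+1 <= j.*2%:R * w n.+1 by rewrite ler_pM2r// ler_nat -doubleS leq_double.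
    by rewrite -natr1 -natr1 => h; lra.
  have : `|(t' - t) * z1 z| < 10.
    have -> : (t' - t) * z1 z = (z2 z - t * z1 z) - (z2 z - t' * z1 z) by ring.
    by apply: le_lt_trans (ler_normB _ _) _; lra.
  have : w n.+1 * (100 * 8 ^+ n) <= `|(t' - t) * z1 z|.
    rewrite normrM (ger0_norm (_ : 0 <= t' - t)); last by lra.
    by apply: ler_pM => //; case/andP: lz.
  have -> : w n.+1 * (100 * 8 ^+ n) = 100 / 8.
    by have := wpow n; rewrite wS => h; lra.
  lra.
have one sg : exists c, forall i, badS sg i -> i = c.
  have [[c hc]|no] := pselect (exists c, badS sg c); last first.
    by exists 0%N => i hi; case: no; exists i.
  exists c => i hi; have [ic|ci|//] := ltngtP i c; first by case: (uniq _ _ _ hi hc ic).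
  by case: (uniq _ _ _ hc hi ci).
have [c hc] := one true; have [c' hc'] := one false.
have badE i : (i < 4)%N -> bad n (a + i.*2%:R * w n.+1) -> i = c \/ i = c'.
  move=> i4 [z [t [Zz lz tz bz]]]; case sg : (0 < z1 z).
    by left; apply: hc; split=> //; exists z, t.
  by right; apply: hc'; split=> //; exists z, t.
have [i [j [ij j4 ic [ic' [jc jc']]]]] : exists i j, [/\ (i < j)%N, (j < 4)%N, i <> c &
    i <> c' /\ j <> c /\ j <> c'].
  clear; case: c c' => [|[|[|c]]] [|[|[|c']]];
  first [by exists 0%N, 1%N|by exists 0%N, 2|by exists 0%N, 3|by exists 1%N, 2
        |by exists 1%N, 3|by exists 2, 3].
exists (i, j); split=> //= /badE; first by case/(_ (ltn_trans ij j4)).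
by case/(_ j4).
Qed.

(** A sequence of bits selects nested intervals; the slope is their common point, realized as the
    supremum of the left ends. *)
Lemma slopes_exist : exists t : (nat -> bool) -> R, injective t /\
  forall b, 0 <= t b <= 1 /\ forall z, Z z -> 5 <= `|z2 z - t b * z1 z|.
Proof.
have /choice[G hG] : forall na : nat * R, exists ij : nat * nat, [/\ (ij.1 < ij.2)%N, (ij.2 < 4)%N,
    ~ bad na.1 (na.2 + ij.1.*2%:R * w na.1.+1) & ~ bad na.1 (na.2 + ij.2.*2%:R * w na.1.+1)].
  by move=> [n a]; exact: good_subintervals.
pose g n a (c : bool) : nat := if c then (G (n, a)).2 else (G (n, a)).1.
have g4 n a c : (g n a c < 4)%N.
  by have [h1 h2 _ _] := hG (n, a); rewrite /g; case: c => //; exact: ltn_trans h1 h2.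
have gbad n a c : ~ bad n (a + (g n a c).*2%:R * w n.+1).
  by have [_ _ h1 h2] := hG (n, a); rewrite /g; case: c.
pose A b := fix A n : R := if n is m.+1 then A m + (g m (A m) (b m)).*2%:R * w m.+1 else 0.
have AS b n : A b n.+1 = A b n + (g n (A b n) (b n)).*2%:R * w n.+1 by [].
have step b n : A b n <= A b n.+1 /\ A b n.+1 + w n.+1 <= A b n + w n.
  have w' := w0 n.+1.
  have h0 : 0 <= (g n (A b n) (b n)).*2%:R * w n.+1 by rewrite mulr_ge0// ltW.
  have h1 : (g n (A b n) (b n)).*2%:R * w n.+1 <= 6 * w n.+1.
    by rewrite ler_pM2r// ler_nat -[6%N]/(3.*2) leq_double -ltnS.
  by rewrite AS (wS n); split; lra.
have mono b n k : A b n <= A b (n + k)%N /\ A b (n + k)%N + w (n + k)%N <= A b n + w n.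
  elim: k => [|k [IH1 IH2]]; first by rewrite addn0.
  have [s1 s2] := step b (n + k)%N; rewrite addnS; split.
    exact: le_trans IH1 s1.
  exact: le_trans s2 IH2.
pose t b := sup (range (A b)).
have Aub b n m : A b m <= A b n + w n.
  have wn := w0 n; have wm := w0 m.
  have [nm|/ltnW mn] := leqP n m.
    by have [_ h] := mono b n (m - n)%N; rewrite subnKC// in h; lra.
  by have [h _] := mono b m (n - m)%N; rewrite subnKC// in h; lra.
have hs b : has_sup (range (A b)).
  split; first by exists (A b 0%N); exists 0%N.
  by exists (A b 0%N + w 0) => _ [m _ <-].
have tlo b n : A b n <= t b by apply: ub_le_sup; [exact: (hs b).2|exists n].
have tup b n : t b <= A b n + w n.
  by apply: ge_sup; [exact: (hs b).1|move=> _ [m _ <-]].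
exists t; split.
  move=> b b' tE; suff h : forall n, A b n = A b' n /\ b n = b' n by apply/funext => n; have [] := h n.
  have key n : A b n = A b' n -> b n = b' n.
    move=> An; have [lt12 _ _ _] := hG (n, A b n).
    (* At the first stage where two sequences differ, the chosen subintervals are separated by a
       gap, which makes the inequality between the slopes strict. *)
    have contra b1 b2 : A b1 n = A b n -> A b2 n = A b n -> b1 n = false -> b2 n = true -> t b1 < t b2.
      move=> e1 e2 f1 f2; apply: le_lt_trans (tup b1 n.+1) (lt_le_trans _ (tlo b2 n.+1)).
      rewrite !AS e1 e2 f1 f2 /g /= -addrA ltrD2l -[X in _ + X]mul1r -mulrDl ltr_pM2r//.
      by rewrite natr1 ltr_nat -(leq_double (_.+1)) doubleS in lt12 *.
    case e1 : (b n); case e2 : (b' n) => //.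
      by have := contra b' b (esym An) erefl e2 e1; rewrite tE ltxx.
    by have := contra b b' erefl (esym An) e1 e2; rewrite tE ltxx.
  elim=> [|n [IH1 IH2]]; first by split=> //; exact: key.
  have An : A b n.+1 = A b' n.+1 by rewrite !AS IH1 IH2.
  by split=> //; exact: key.
move=> b; have t01 : 0 <= t b <= 1.
  have := tlo b 0%N; have := tup b 0%N; rewrite /= expr0 invr1 add0r => -> ->//.
split=> // z Zz; rewrite leNgt; apply/negP => zb.
have [hz _] := Zhyp Zz.
(* Points of small first coordinate belong to no level. They would have a second coordinate below
   [100 + 5], too close to [o] given that [cosh] of their distance is at least 300. *)
have [small|large] := ltP `|z1 z| 100.
  have c : z1 z ^+ 2 + z2 z ^+ 2 = mink o z ^+ 2 - 1.
    have := mink_fr (- mink o z) (z1 z) (z2 z) (- mink o z) (z1 z) (z2 z) F.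
    by rewrite -(frame_decomp z F) hz => h; rewrite !expr2; lra.
  have h0 : 300 * 300 <= mink o z ^+ 2.
    by have z3 := Zfar Zz; rewrite -sqrrN expr2; apply: (ler_pM _ _ z3 z3); exact: ler0n.
  have h1 : `|z2 z| < 105.
    have -> : z2 z = (z2 z - t b * z1 z) + t b * z1 z by ring.
    apply: le_lt_trans (ler_normD _ _) _.
    have : `|t b * z1 z| <= 1 * 100.
      move/andP: t01 => [t0 t1]; rewrite normrM ger0_norm//.
      by apply: ler_pM => //; exact: ltW.
    lra.
  have h2 : z1 z ^+ 2 <= 100 * 100.
    by rewrite -[leLHS]real_normK ?num_real// expr2; apply: ler_pM => //; exact: ltW.
  have h3 : z2 z ^+ 2 <= 105 * 105.
    by rewrite -[leLHS]real_normK ?num_real// expr2; apply: ler_pM => //; exact: ltW.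
  move: c h0 h2 h3; set x1 := z1 z ^+ 2; set x2 := z2 z ^+ 2; set x3 := mink o z ^+ 2 => c h0 h2 h3.
  have : 300 * 300 <= 100 * 100 + 105 * 105 + 1 :> R by rewrite (le_trans h0)// -lerBlDr -c lerD.
  lra.
(* The least [n] satisfying the upper bound; consecutive levels abut because 800 is 8 times 100. *)
have [n ln] : exists n, level n z.
  have ex : exists n : nat, `|z1 z| < 800 * 8 ^+ n.
    exists (Num.bound `|z1 z|); have bz := archi_boundP (normr_ge0 (z1 z)).
    apply: lt_le_trans bz _; rewrite -[leLHS]mul1r.
    apply: ler_pM => //; first by lra.
    by rewrite -natrX ler_nat; apply/ltnW/ltn_expl.
  have [n n2 nmin] := ex_minnP ex; exists n; rewrite /level n2 andbT.
  case: n n2 nmin => [|n] _ nmin; first by rewrite expr0 mulr1.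
  rewrite leNgt; apply/negP => h; have := nmin n; rewrite ltnn; apply/implyP.
  by apply: lt_le_trans h _; rewrite exprS mulrA ler_pM2r//; lra.
have := gbad n (A b n) (b n); apply; exists z, (t b); split=> //.
by rewrite -AS tlo tup.
Qed.

End CantorSlopes.

Section Slopes.
Local Open Scope ring_scope.
Variable R : realType.
Local Notation vec := 'rV[R]_3.
Implicit Types (x y z o e f : vec) (a t : R).

Lemma hyp_inhabited : exists z : vec, hyp z.
Proof. by exists (vec3 1 0 0); split; rewrite /mink !vec3E; [ring|exact: ltr01]. Qed.

Lemma slope_unit o e f t : frame o e f ->
  unit_tangent o ((Num.sqrt (1 + t ^+ 2))^-1 *: (e + t *: f)).
Proof.
move=> [_ [oe ee] [of' ff] ef _].
have t2 : 0 < 1 + t ^+ 2 by rewrite ltr_pwDl// sqr_ge0.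
have k0 : 0 < Num.sqrt (1 + t ^+ 2) by rewrite sqrtr_gt0.
have := sqr_sqrtr (ltW t2); move: k0; set k := Num.sqrt _ => k0 k2.
split; rewrite !minkE; first by rewrite oe of'; ring.
rewrite ee ff ef (minkC f e) ef.
transitivity ((1 + t ^+ 2) / k ^+ 2); first by field; rewrite gt_eqF.
by rewrite -k2 divff// expf_neq0// gt_eqF.
Qed.

Definition slope_geodesic o e f (F : frame o e f) t : geodesic R :=
  let: And5 ho _ _ _ _ := F in Geodesic ho (slope_unit t F).

Lemma slope_geodesicE o e f (F : frame o e f) t z :
  det3 (gpt (slope_geodesic F t)) (gdir (slope_geodesic F t)) z =
  (Num.sqrt (1 + t ^+ 2))^-1 * (mink f z - t * mink e z).
Proof.
have -> : gpt (slope_geodesic F t) = o by rewrite /slope_geodesic; case: F.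
have -> : gdir (slope_geodesic F t) = (Num.sqrt (1 + t ^+ 2))^-1 *: (e + t *: f).
  by rewrite /slope_geodesic; case: F.
set k := (Num.sqrt _)^-1.
have -> : k *: (e + t *: f) = fr o e f 0 k (k * t).
  by rewrite /fr scale0r add0r scalerDr scalerA.
by rewrite {1}(frame_decomp z F) -{1}(fr100 o e f) det3_fr//; ring.
Qed.

Lemma slope_far o e f (F : frame o e f) t z : 0 <= t <= 1 -> 5 <= `|mink f z - t * mink e z| ->
  3 <= `|det3 (gpt (slope_geodesic F t)) (gdir (slope_geodesic F t)) z|.
Proof.
move=> /andP[t0 t1] h; rewrite slope_geodesicE.
have t2 : 0 < 1 + t ^+ 2 by rewrite ltr_pwDl// sqr_ge0.
have k0 : 0 < Num.sqrt (1 + t ^+ 2) by rewrite sqrtr_gt0.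
have := sqr_sqrtr (ltW t2); move: k0; set k := Num.sqrt _ => k0 k2.
have t22 : t ^+ 2 <= 1 by rewrite expr_le1.
have k5 : k <= 5 / 3.
  have h0 : 0 <= 5 / 3 :> R by lra.
  rewrite -ler_sqr ?nnegrE ?(ltW k0)// k2; lra.
rewrite normrM normfV (gtr0_norm k0) mulrC ler_pdivlMr//; lra.
Qed.

Lemma slope_sign o e f (F : frame o e f) t z :
  (0 <= det3 (gpt (slope_geodesic F t)) (gdir (slope_geodesic F t)) z) = (t * mink e z <= mink f z).
Proof.
rewrite slope_geodesicE pmulr_rge0 ?subr_ge0// invr_gt0 sqrtr_gt0.
by rewrite ltr_pwDl// sqr_ge0.
Qed.

(* Far out in the wedge between two geodesics, a ball of radius [M] fits. *)
Lemma wedge_vertex (Z : set vec) (M : R) o e f t t' : frame o e f ->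
  (forall z, Z z -> hyp z) -> (forall z, hyp z -> exists2 x, Z x & - mink z x <= M) ->
  0 <= t -> t < t' -> t' <= 1 ->
  exists2 z, Z z & t * mink e z < mink f z /\ mink f z < t' * mink e z.
Proof.
move=> F Zh near t0 tt' t'1; have [ho [oe ee] [of' ff] ef _] := F.
have M1 : 1 <= M.
  by have [x Zx h] := near _ ho; have := hyp_mink_le ho (Zh _ Zx); lra.
(* The centre [ze] of the ball lies on the mean slope, at the distance [r] for which both
   functionals [mink f - t mink e] and [t' mink e - mink f] equal [2 M]. *)
pose d := (t' - t) / 2; have d0 : 0 < d by rewrite divr_gt0// subr_gt0.
pose r := 2 * M / d; have rd : r * d = 2 * M by rewrite /r divfK// gt_eqF.
have r0 : 0 < r by rewrite divr_gt0// mulr_gt0//; lra.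
pose tau := (t + t') / 2; pose A := Num.sqrt (1 + r ^+ 2 + (r * tau) ^+ 2).
have A20 : 0 < 1 + r ^+ 2 + (r * tau) ^+ 2.
  by rewrite ltr_pwDl ?sqr_ge0// ltr_pwDl// sqr_ge0.
have A0 : 0 < A by rewrite sqrtr_gt0.
have A2 : A ^+ 2 = 1 + r ^+ 2 + (r * tau) ^+ 2 by rewrite sqr_sqrtr// ltW.
pose ze := fr o e f A r (r * tau).
have [ho1 _] := ho.
have oz : mink o ze = - A by rewrite /ze /fr !minkE ho1 oe of'; ring.
have ez : mink e ze = r by rewrite /ze /fr !minkE (minkC e o) oe ee ef; ring.
have fz : mink f ze = r * tau by rewrite /ze /fr !minkE (minkC f o) (minkC f e) of' ef ff; ring.
have hz : hyp ze.
  apply: (hyp_of_mink ho); last by rewrite oz oppr_lt0.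
  by rewrite /ze mink_fr// -!expr2 A2; ring.
have [x Zx xM] := near _ hz; have hx := Zh _ Zx.
have m1 := hyp_mink_le hz hx.
have m2 : mink ze x ^+ 2 <= M ^+ 2 by rewrite -sqrrN ler_sqr ?nnegrE; lra.
(* The normal has square at most 2. A point [x] beyond it would satisfy [4 M^2 + 1 + u^2 <= 2 M^2]
   by [mink_separated]. *)
have side n u : 0 <= u -> u <= 1 -> mink n n = 1 + u ^+ 2 -> mink n ze = 2 * M -> 0 < mink n x.
  move=> u0 u1 nn nz; rewrite ltNge; apply/negP => neg.
  have := mink_separated hz hx _ neg; rewrite nz nn mulr_ge0//; last by lra.
  move=> /(_ isT); have u2 : u ^+ 2 <= 1 by rewrite expr_le1.
  have u3 : 0 <= u ^+ 2 by exact: sqr_ge0.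
  have M2 : 1 <= M ^+ 2 by rewrite expr_ge1//; lra.
  have : (1 + u ^+ 2) * mink ze x ^+ 2 <= 2 * M ^+ 2 by apply: ler_pM => //; [lra|exact: sqr_ge0|lra].
  by rewrite exprMn; lra.
have t1 : t <= 1 by lra.
exists x => //; split.
  rewrite -subr_gt0 -minkZl -minkNl -minkDl; apply: (side _ t) => //.
    by rewrite !minkE ee ff ef (minkC f e) ef; ring.
  by rewrite minkDl minkNl minkZl fz ez -rd /tau /d; field.
have t'0 : 0 <= t' by lra.
rewrite -subr_gt0 -minkZl -minkNl -minkDl; apply: (side _ t') => //.
  by rewrite !minkE ee ff ef (minkC f e) ef; ring.
by rewrite minkDl minkNl minkZl fz ez -rd /tau /d; field.
Qed.

End Slopes.

(** * Uncountably many states and the choice of constants *)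

Section Final.
Local Open Scope ring_scope.
Variables (R : realType) (p q : nat) (T : set (set 'rV[R]_3)).
Hypothesis p5 : (5 <= p)%N.
Hypothesis hT : regular_tiling p T q.
Hypothesis q31 : (31 <= q)%N.
Local Notation vec := 'rV[R]_3.
Local Notation adjacent := (Defs.adjacent p T).
Local Notation s := (sk R p 1).
Variables (E K : R).
Hypothesis hE : 805 <= E.
Hypothesis hK : 4 * (81 * E ^+ 2 + 66) <= K.

Lemma adjacent_large N : 8 * (N + 1) <= (1 - s ^+ 2) * (q%:R - 1) ^+ 2 ->
  forall x y, adjacent x y -> N <= - mink x y.
Proof.
move=> hN x y xy; have Vx := adjacent_vertex xy.
have [A [A1 qa _ orb]] := star p5 hT Vx.
have [h _] := angle_large p5 A1 q31 qa.
have [e [f F]] := frame_exists (vertex_hyp p5 Vx).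
have [t /(_ y)[/(_ xy)[i ->] _]] := orb e f F.
by rewrite mink_ray// opprK; lra.
Qed.

Hypothesis adj10 : forall x y : vec, adjacent x y -> 10 <= - mink x y.
Hypothesis sep : forall x y : vec, tile_vertices p T x -> tile_vertices p T y -> x <> y ->
  K <= - mink x y.

Hypothesis K300 : 600 * 300 <= K.

(** A point at [cosh] distance 300 from one vertex; every other vertex is at [cosh] distance at
    least [K] from that one, hence at least [K/600 >= 300] from the point. *)
Lemma far_origin : exists2 o, hyp o & forall z, tile_vertices p T z -> 300 <= - mink o z.
Proof.
have [z0 hz0] := hyp_inhabited R; have [M near] := vertex_near p5 hT.
have [x Vx _] := near _ hz0; have hx := vertex_hyp p5 Vx.
have [e [f F]] := frame_exists hx.
pose o := ray x e f 300 0; have xo : mink x o = - 300 by exact: mink_ray.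
have ho : hyp o.
  apply: (hyp_of_mink hx); last by rewrite xo; lra.
  rewrite /o /ray mink_fr// cos0 sin0 !mulr1 !mulr0 addr0 -!expr2 sqr_sqrtr; first by ring.
  by lra.
exists o => // z Vz; rewrite minkC; have [<-|xz] := pselect (x = z).
  by rewrite xo; lra.
have := le_trans (sep Vx Vz xz) (mink_triangle ho hx (vertex_hyp p5 Vz)).
by rewrite (minkC o x) xo (minkC z o); move: K300; lra.
Qed.

(** Two distinct vertices cannot share the integer parts of their spatial coordinates: their
    difference would have Minkowski square at most 2, whereas it is at least [2 K - 2]. *)
Lemma countable_vertices : countable [set: set_type (tile_vertices p T)].
Proof.
apply/countable_injP.
exists (fun x => choice.pickle (Num.floor ((val x : vec) 0 1), Num.floor ((val x : vec) 0 2))).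
move=> x y _ _ /(pcan_inj choice.pickleK)[e1 e2]; apply: val_inj; apply: contrapT => xy.
have Vx := set_valP x; have Vy := set_valP y.
have [hx _] := vertex_hyp p5 Vx; have [hy _] := vertex_hyp p5 Vy.
have k := sep Vx Vy xy; set x' : vec := val x in hx k e1 e2 *; set y' : vec := val y in hy k e1 e2 *.
have fl (a b : R) : Num.floor a = Num.floor b -> (a - b) ^+ 2 <= 1.
  move=> ab; have := floor_itv a; have := floor_itv b; rewrite ab.
  rewrite intrD => /andP[h1 h2] /andP[h3 h4].
  rewrite -real_normK ?num_real// expr_le1//.
  by rewrite ler_norml; apply/andP; split; lra.
have f1 := fl _ _ e1; have f2 := fl _ _ e2.
have m : mink (x' - y') (x' - y') = - 2 + 2 * - mink x' y'.
  by rewrite !minkE hx hy (minkC y' x'); ring.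
have := sqr_ge0 (x' 0 0 - y' 0 0); move: m; rewrite {1}/mink !mxE => m h0.
move: K300 f1 f2 m h0 k; lra.
Qed.

Lemma uncountable_states beta : q.+2%:R <= beta ->
  ~ countable (on_sigma_algebra @`
     (series_sinai_states p T beta `&` extremal (gibbs_measures (tiling_edges p T) beta))).
Proof.
move=> hbeta; have [cc hcc ofar] := far_origin; have [e [f F]] := frame_exists hcc.
have [t [tinj ht]] := slopes_exist hE hK F (fun z => @vertex_hyp R p T p5 z) sep ofar.
have [M near] := vertex_near p5 hT.
have [z0 hz0] := hyp_inhabited R; have [x0 Vx0 _] := near _ hz0.
pose g b := slope_geodesic F (t b).
have edgeE : tiling_edges p T = [set d | exists x y, d = [set x; y] /\ y \in @neighbours R p T x].
  rewrite eqEsubset; split => d /= [x [y [-> xy]]]; exists x, y; split=> //.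
    exact/(neighboursE hT).
  exact/(neighboursE hT).
have st b : exists m : probability (config (set_type (tile_vertices p T))) R,
    [/\ (series_sinai_states p T beta `&` extremal (gibbs_measures (tiling_edges p T) beta)) m &
      forall v, (2^-1%:E < m [set w | w v = @eta_geodesic R p T (g b) v])%E].
  have [m [[L [Lex Lw]] me mv]] := low_temperature_state (nb := @neighbours R p T)
    (neighbours_sym hT) (neighbours_irr p5 hT adj10) edgeE (s := @eta_geodesic R p T (g b))
    (fun x => eq_leq (card_neighbours hT x))
    (geodesic_isoperimetry p5 hT q31 adj10 (fun x Vx => slope_far F (ht b).1 ((ht b).2 x Vx)))
    hbeta countable_vertices (SigSub (mem_set Vx0)).
  by exists m; split=> //; split=> //; exists (g b), L.
have /choice[m hm] := st.
(* At a vertex in the wedge between the two geodesics, one state gives spin +1 and the other spin -1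
   a probability above 1/2, so a common state would have total mass above 1. *)
have lt_case b b' : t b < t b' -> on_sigma_algebra (m b) <> on_sigma_algebra (m b').
  move=> tt' eqm; have [[/andP[t0 _] _] [/andP[_ t1] _]] := (ht b, ht b').
  have [z Vz [z1 z2]] := wedge_vertex F (fun z => @vertex_hyp R p T p5 z) near t0 tt' t1.
  pose v : set_type (tile_vertices p T) := SigSub (mem_set Vz).
  have [_ /(_ v) h1] := hm b; have [_ /(_ v) h2] := hm b'.
  have e1 : @eta_geodesic R p T (g b) v = true.
    by apply/asboolP; rewrite /left_or_on slope_sign; exact: ltW.
  have e2 : @eta_geodesic R p T (g b') v = false.
    by apply/asboolPn/negP; rewrite /left_or_on slope_sign -ltNge.
  rewrite e1 in h1; rewrite e2 in h2.
  have mt := measurable_coord v true; have mf := measurable_coord v false.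
  have := congr1 (fun h => h (exist _ _ mt)) eqm; rewrite /on_sigma_algebra /= => eqt.
  rewrite eqt in h1.
  have : (m b' [set w | w v = true] + m b' [set w | w v = false] <= 1)%E.
    rewrite -measureU//; first by apply: probability_le1; exact: measurableU.
    by rewrite -subset0 => w [/= -> ].
  apply/negP; rewrite -ltNge.
  apply: le_lt_trans (lteD h1 h2).
  by rewrite -EFinD lee_fin; lra.
have minj b b' : on_sigma_algebra (m b) = on_sigma_algebra (m b') -> b = b'.
  move=> eqm; apply: tinj; have [h|h|//] := ltgtP (t b) (t b').
    by case: (lt_case _ _ h).
  by case: (lt_case _ _ h).
move=> /countable_injP[h hinj].
pose c b := h (on_sigma_algebra (m b)).
have cinj b b' : c b = c b' -> b = b'.
  move=> /hinj k; apply: minj; apply: k; rewrite inE; eexists; [|reflexivity| |reflexivity].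
    by have [] := hm b.
  by have [] := hm b'.
(* Cantor's diagonal argument for the injection [c] of bit sequences into [nat]. *)
pose diag n := `[< forall b, c b = n -> b n = false >].
have [d|d] := boolP (diag (c diag)).
  by have /asboolP/(_ diag erefl) := d; rewrite d.
by have /asboolPn := d; apply => b /cinj ->; exact: negbTE.
Qed.

End Final.

Theorem theorem3 (R : realType) (p : nat) (hp : (5 <= p)%N) :
  exists qp : nat, (3 <= qp)%N /\
    forall q : nat, (qp <= q)%N ->
      p%:R^-1 + q%:R^-1 < 2^-1 :> R ->
      exists beta0 : R, 0 < beta0 /\
        forall T : set (set 'rV[R]_3), regular_tiling p T q ->
          forall beta : R, beta0 <= beta ->
            ~ countable (on_sigma_algebra @`
                (series_sinai_states p T beta `&`
                 extremal (gibbs_measures (tiling_edges p T) beta))).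
Proof.
pose s := sk R p 1; have s0 : 0 < s by exact: sk1_gt0.
have s1 : s < 1 by exact: sk1_lt1.
have s2 : 0 < 1 - s ^+ 2 by rewrite subr_gt0 expr_lt1// ltW.
have [E hE] : exists E : R, 805 <= E by exists 805; exact: lexx.
have [K hK K300] : exists2 K : R, 4 * (81 * E ^+ 2 + 66) <= K & 600 * 300 <= K.
  by exists (Num.max (4 * (81 * E ^+ 2 + 66)) (600 * 300)); rewrite le_max lexx ?orbT.
have K0 : 0 <= K by apply: le_trans K300; rewrite mulr_ge0 ?ler0n.
(* The lower bound for [cosh] of the side length: 10 is for the cones, while [K] and the last term
   meet the two conditions of [vertex_separation]. *)
pose N : R := 10 + K + K ^+ 2 / (2 * s ^+ 2).
have N0 : 0 <= K ^+ 2 / (2 * s ^+ 2) by rewrite divr_ge0 ?sqr_ge0// mulr_ge0// sqr_ge0.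
pose c := 8 * (N + 1) / (1 - s ^+ 2).
(* Beyond this value [c <= q - 1 <= (q - 1)^2], which is what [adjacent_large] needs. *)
exists (31 + Num.bound c)%N; split=> // q qq _.
have q31 : (31 <= q)%N by exact: leq_trans (leq_addr _ _) qq.
have hN : 8 * (N + 1) <= (1 - s ^+ 2) * (q%:R - 1) ^+ 2.
  rewrite [leRHS]mulrC -ler_pdivrMr// -/c.
  have c0 : 0 <= c by rewrite divr_ge0 ?(ltW s2)// mulr_ge0// !addr_ge0.
  have h : c <= q%:R - 1.
    rewrite lerBrDr; apply: le_trans (lerD (ltW (archi_boundP c0)) (lexx 1)) _.
    by rewrite natr1 ler_nat (leq_trans _ qq)// addnC -addn1 leq_add2l.
  apply: le_trans h _; rewrite expr2 ler_peMr//.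
    by rewrite subr_ge0 ler1n (leq_trans _ q31).
  by rewrite lerBrDr -[1 + 1]/(2%:R) ler_nat (leq_trans _ q31).
exists q.+2%:R; split; first by rewrite ltr0n.
move=> T hT beta hbeta.
have adjN := adjacent_large hp hT q31 hN.
apply: (@uncountable_states R p q T hp hT q31 E K hE hK _ _ K300 _ hbeta).
- by move=> x y /adjN; apply: le_trans; rewrite /N -addrA lerDl addr_ge0.
move=> x y Vx Vy xy; apply: (vertex_separation hp hT adjN Vx Vy xy).
  by rewrite /N addrAC lerDr addr_ge0.
have -> : K ^+ 2 = 2 * (K ^+ 2 / (2 * s ^+ 2)) * s ^+ 2.
  by field; rewrite gt_eqF.
rewrite ler_pM2r ?exprn_gt0// ler_pM2l//.
by rewrite /N; move: K0; set m := K ^+ 2 / _; clear; lra.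
Qed.
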